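(* Let $(x_i)_{i\in\mathbb Z}$ be a stationary, infinite measure, conservative ergodic Markov chain with values in a countable alphabet $\mathcal A$, with path space $\Pi=\prod_{-\infty}^\infty\mathcal A$, left shift $\sigma$ and shift-invariant Markov measure $\rho$. Assume that for some state $\mathtt a\in\mathcal A$, $\rho$ is normalized so that $\rho[x_0=\mathtt a]=1$. Let $N_n$ be the occupation time process of $\mathtt a$ and let $\alpha\in(0,1)$. The following conditions are equivalent: (a) the return sequence $\overline a_n=\mathbb E(N_n)$ is regularly varying of index $\alpha$; (b) the distribution function $F$ of return times to the state $\mathtt a$ is in the domain of attraction of $G_\alpha$. Suppose (a) (or (b)) holds. Let $\widehat a(\cdot)$ and $\mathtt c$ be as in the context. Then for every $\varphi\in L^1(\Pi,\rho)$, writing $S_n\varphi=\sum_{i=0}^{n-1}\varphi(\sigma^ix)$ for $n>0$, for $\rho$-a.e. $x$: $$\text{(i)}\quad\lim_{k\to\infty}\frac1{\log k}\sum_{n=1}^k\frac{S_n\varphi(x)}{\widehat a(n)}\,\frac1n=\mathtt c\int_\Pi\varphi\,d\rho,$$ $$\text{(ii)}\quad\lim_{k\to\infty}\frac1{\log\widehat a(k)}\sum_{n=1}^k\frac{\varphi(\sigma^nx)}{\widehat a(n)}=\mathtt c\int_\Pi\varphi\,d\rho.$$ (iii) Moreover $\overline a_n\sim\mathtt c\cdot\widehat a(n)$, i.e. $\overline a_n/(\mathtt c\,\widehat a(n))\to1$ as $n\to\infty$; hence (i) and (ii) are equivalent to the same statements with $\widehat a(\cdot)$ replaced by $\overline a_{(\cdot)}$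 and $\mathtt c$ replaced by $1$.
   Context: The Markov measure $\rho$ is determined by a row-stochastic matrix $P=(P_{ab})_{a,b\in\mathcal A}$ and an invariant nonnegative row vector $\widehat\pi=\widehat\pi P$ of infinite total mass. For $A=\{x:x_0=\mathtt a\}$ put $Y_i=\chi_A(\sigma^ix)$; the occupation time process is $N_0=0$, $N_n=\sum_{i=1}^nY_i$ for $n>0$. $\mathbb E(N_n)$ is the expectation with respect to the probability measure $\rho$ restricted to $A$ (chain started at $\mathtt a$), and $F$ is the distribution function, under the same measure, of $\min\{n\ge1:x_n=\mathtt a\}$. $G_\alpha$ is the completely asymmetric $\alpha$-stable law on $(0,\infty)$ with Laplace transform $\exp(-\frac{\Gamma(3-\alpha)}{\alpha(1-\alpha)}w^\alpha)$, $w\ge 0$. $F$ is in its domain of attraction if for $(X_i)_{i\ge0}$ i.i.d. with distribution $F$ there is a normalizing sequence $a_n>0$ with $\frac1{a_n}\sum_{i=0}^{n-1}X_i\to G_\alpha$ in law. $\mathtt c=\mathbb E(\widehat Z(1))$, where $\widehat Z(t)=\inf\{s:Z(s)>t\}$ and $Z$ is the càdlàg process with stationary independent increments, $Z(0)=0$, $Z(1)\sim G_\alpha$. The function $a(\cdot)$ is a $C^1$ increasing function on $[0,\infty)$, regularly varying of index $1/\alpha$ with regularly varying derivative, with $a(n)$ a normalizing sequence for $F$, and such that, with $h=a^\alpha$, the renewal process $\overline N(t)=\#\{n\ge1:X_0+\dots+X_{n-1}\le t\}$ and $\widehat Z$ can be coupled so that a.s. $\frac1{\log T}\int_1^Tt^{-\alpha}\sup_{0\le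 s\le t}|h(\overline N(s))-\widehat Z(s)|\frac{dt}t\to0$; such a function exists. $\widehat a=a^{-1}$ (terms with small $n$ for which $\widehat a(n)$ is undefined or zero are omitted from the sums). *)

(* Defs.v *)
From HB Require Import structures.
From mathcomp Require Import all_boot all_order all_algebra finmap.
From mathcomp Require Import all_classical all_reals all_analysis.

Set Implicit Arguments.
Unset Strict Implicit.
Unset Printing Implicit Defensive.

Import Order.TTheory GRing.Theory Num.Theory.
Import numFieldNormedType.Exports.

Local Open Scope classical_set_scope.
Local Open Scope ring_scope.

Definition regvar (R : realType) (f : R -> R) (gam : R) : Prop :=
  [/\ measurable_fun (`[0, +oo[ : set R) f,
      \forall t \near +oo, 0 < f t &
      forall lam : R, 0 < lam ->
        f (lam * t) / f t @[t --> +oo] --> lam `^ gam].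

Definition regvar_seq (R : realType) (u : nat -> R) (gam : R) : Prop :=
  regvar (fun t : R => u (Num.truncn t)) gam.

Section dynamics.
Context {d} {T : measurableType d} {R : realType}.
Implicit Types (mu : {measure set T -> \bar R}) (f : T -> T).

Definition invariant_measure mu f : Prop :=
  forall B, measurable B -> mu (f @^-1` B) = mu B.

Definition conservative mu f : Prop :=
  forall W, measurable W ->
    trivIset setT (fun n => iter n f @^-1` W) -> mu W = 0%E.

Definition ergodic mu f : Prop :=
  forall B, measurable B -> f @^-1` B = B -> mu B = 0%E \/ mu (~` B) = 0%E.

End dynamics.

(* The state [a] only provides the base point that measurable types require. *)
Definition path_space (A : countType) (a : A) : Type := int -> A.

HB.instance Definition _ (A : countType) (a : A) :=
  Choice.copy (path_space a) (int -> A).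
HB.instance Definition _ (A : countType) (a : A) :=
  isPointed.Build (path_space a) (fun=> a).

Definition coordinate_sets (A : countType) (a : A) :
    set (set (path_space a)) :=
  [set B | exists i b, B = [set x | x i = b]].
Arguments coordinate_sets {A} a.

(* As the alphabet is countable, this is the product of the discrete
   sigma-algebras. *)
Notation Paths a := (g_sigma_algebraType (coordinate_sets a)).

Definition left_shift (A : countType) (a : A) (x : Paths a) : Paths a :=
  fun i => x (i + 1).
Arguments left_shift {A} a x.

Section markov.
Context {R : realType} {A : countType} (a : A).
Implicit Types (P : A -> A -> R) (pi : A -> R).
Implicit Types (rho : {measure set (Paths a) -> \bar R}).

Definition row_stochastic P : Prop :=
  (forall b c, 0 <= P b c) /\
  (forall b, \esum_(c in [set: A]) (P b c)%:E = 1%E).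

Definition invariant_vector P pi : Prop :=
  (forall b, 0 <= pi b) /\
  (forall c, \esum_(b in [set: A]) (pi b * P b c)%:E = (pi c)%:E).

Definition infinite_mass pi : Prop :=
  \esum_(b in [set: A]) (pi b)%:E = +oo%E.

(* rho [x_m = b, x_(m+1) = s_0, x_(m+2) = s_1, ...]
     = pi_b P_(b, s_0) P_(s_0, s_1) ... *)
Definition markov_measure P pi rho : Prop :=
  forall (m : int) (b : A) (s : seq A),
    rho [set x : Paths a | forall i : nat, (i <= size s)%N ->
           x (m + i%:Z) = nth b (b :: s) i]
    = (pi b * \prod_(i < size s) P (nth b (b :: s) i) (nth b s i))%:E.

Definition state_set : set (Paths a) := [set x | x 0 = a].

Definition occupation_time (n : nat) (x : Paths a) : R :=
  \sum_(1 <= i < n.+1) \1_state_set (iter i (left_shift a) x).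

Definition return_sequence rho (n : nat) : R :=
  \int[rho]_(x in state_set) occupation_time n x.

Definition return_time (x : Paths a) : \bar R :=
  ereal_inf [set n%:R%:E | n in [set n : nat | (0 < n)%N /\ x n%:Z = a]].

Definition return_df rho (t : R) : R :=
  fine (rho (state_set `&` [set x | (return_time x <= t%:E)%E])).

Definition birkhoff_sum (phi : Paths a -> R) (n : nat) (x : Paths a) : R :=
  \sum_(0 <= i < n) phi (iter i (left_shift a) x).

(* In the two averages below, the terms where [b n] is zero are omitted. *)
Definition log_average rho (b : nat -> R) (c : R) : Prop :=
  forall phi : Paths a -> R, rho.-integrable setT (EFin \o phi) ->
    {ae rho, forall x,
      (ln k%:R)^-1 *
        \sum_(1 <= n < k.+1 | 0 < b n) birkhoff_sum phi n x / b n * n%:R^-1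
      @[k --> \oo] --> c * \int[rho]_y phi y}.

Definition chung_erdos_average rho (b : nat -> R) (c : R) : Prop :=
  forall phi : Paths a -> R, rho.-integrable setT (EFin \o phi) ->
    {ae rho, forall x,
      (ln (b k))^-1 *
        \sum_(1 <= n < k.+1 | 0 < b n) phi (iter n (left_shift a) x) / b n
      @[k --> \oo] --> c * \int[rho]_y phi y}.

End markov.
Arguments state_set {A} a.

Definition Gamma (R : realType) (s : R) : R :=
  \int[lebesgue_measure]_(t in `]0, +oo[) (t `^ (s - 1) * expR (- t)).

Definition stable_law (R : realType) (alpha : R)
    (G : probability (measurableTypeR R) R) : Prop :=
  G `]0, +oo[%classic = 1%E /\
  forall w : R, 0 <= w ->
    \int[G]_y expR (- (w * y)) =
    expR (- (Gamma (3 - alpha) / (alpha * (1 - alpha)) * w `^ alpha)).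

Section random_variables.
Context {d} {W : measurableType d} {R : realType}.
Implicit Types (Q : probability W R) (G : probability (measurableTypeR R) R).

Definition mutually_independent Q (X : nat -> W -> R) : Prop :=
  forall (J : {fset nat}) (B : nat -> set R), (forall i, measurable (B i)) ->
    Q (\bigcap_(i in [set` J]) (X i @^-1` B i)) =
    (\prod_(i <- J) Q (X i @^-1` B i))%E.

Definition iid_with_df (F : R -> R) Q (X : nat -> {RV Q >-> R}) : Prop :=
  mutually_independent Q (fun i => X i : W -> R) /\
  (forall i t, cdf (X i) t = (F t)%:E).

Definition cvg_in_law Q (Y : nat -> W -> R) G : Prop :=
  forall f : R -> R, continuous f -> (exists M, forall y, `|f y| <= M) ->
    \int[Q]_w f (Y n w) @[n --> \oo] --> \int[G]_y f y.

(* #{n >= 1 : X_0 + ... + X_(n-1) <= t}; [fset_set] returns the empty set on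
   an infinite set, a null event here: return times are almost surely >= 1. *)
Definition renewal_count (X : nat -> W -> R) (w : W) (t : R) : nat :=
  #|` fset_set [set n : nat | (0 < n)%N /\ \sum_(i < n) X i w <= t] |.

Definition cadlag (z : R -> R) : Prop :=
  (forall t, 0 <= t -> z s @[s --> t^'+] --> z t) /\
  (forall t, 0 < t -> cvg (z s @[s --> t^'-])).

(* Only times t >= 0 are relevant; [Z] is unconstrained at negative times. *)
Record stable_process G Q (Z : R -> {RV Q >-> R}) : Prop := {
  stable_process0 : forall w, Z 0 w = 0 ;
  stable_process_cadlag : forall w, cadlag (fun t => Z t w) ;
  stable_process_stationary : forall s t, 0 <= s -> 0 <= t ->
    forall B : set R, measurable B ->
      Q [set w | B (Z (s + t) w - Z s w)] = Q [set w | B (Z t w)] ;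
  stable_process_independent : forall t : nat -> R, 0 <= t 0%N ->
    (forall i, t i <= t i.+1) ->
    mutually_independent Q (fun i w => Z (t i.+1) w - Z (t i) w) ;
  stable_process_law1 : forall B : set R, measurable B ->
    Q [set w | B (Z 1 w)] = G B
}.

(* +oo if Z never exceeds t *)
Definition passage_time (Z : R -> W -> R) (w : W) (t : R) : \bar R :=
  ereal_inf [set s%:E | s in [set s : R | 0 <= s /\ t < Z s w]].

(* The integral is finite for stable processes, so [fine] loses nothing. *)
Definition inverse_mean1 Q (Z : R -> W -> R) : R :=
  fine (\int[Q]_w passage_time Z w 1)%E.

End random_variables.

Definition normalizing_sequence (R : realType) (F : R -> R)
    (G : probability (measurableTypeR R) R) (an : nat -> R) : Prop :=
  (forall n, (0 < n)%N -> 0 < an n) /\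
  exists (d : measure_display) (W : measurableType d) (Q : probability W R)
    (X : nat -> {RV Q >-> R}),
    iid_with_df F X /\
    cvg_in_law Q (fun n w => (an n)^-1 * \sum_(i < n) X i w) G.

Definition domain_of_attraction (R : realType) (F : R -> R)
    (G : probability (measurableTypeR R) R) : Prop :=
  exists an : nat -> R, normalizing_sequence F G an.

Definition derivative_on_halfline (R : realType) (f g : R -> R) : Prop :=
  forall t, 0 <= t ->
    (f s - f t) / (s - t) @[s --> within [set s | 0 <= s /\ s != t] (nbhs t)]
      --> g t.

(* the renewal process with interarrival distribution function F, rescaled by
   h, and the inverse of the stable process can be coupled so as to be
   log-average asymptotic *)
Definition log_average_coupling (R : realType) (alpha : R) (F : R -> R)
    (G : probability (measurableTypeR R) R) (h : R -> R) : Prop :=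
  exists (d : measure_display) (W : measurableType d) (Q : probability W R)
    (X : nat -> {RV Q >-> R}) (Z : R -> {RV Q >-> R}),
    [/\ iid_with_df F X,
        stable_process G Z &
        {ae Q, forall w,
          (((ln T)^-1)%:E *
           \int[lebesgue_measure]_(t in `[1%R, T])
             ((t `^ (- alpha) / t)%:E *
              ereal_sup [set `|(h (renewal_count X w s)%:R)%:E -
                               passage_time Z w s| | s in `[0%R, t]]))%E
          @[T --> +oo] --> 0%E}].

(* [a] stands for a function on [0, +oo[; its values at negative reals are
   irrelevant. *)
Record smooth_normalizer (R : realType) (alpha : R) (F : R -> R)
    (G : probability (measurableTypeR R) R) (a : R -> R) : Prop := {
  normalizer_ge0 : forall t, 0 <= t -> 0 <= a t ;
  normalizer_increasing : forall s t, 0 <= s -> s < t -> a s < a t ;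
  normalizer_regvar : regvar a alpha^-1 ;
  normalizer_C1 : exists g : R -> R,
    [/\ derivative_on_halfline a g,
        {within `[0, +oo[, continuous g} &
        exists gam : R, regvar g gam] ;
  normalizer_normalizing : normalizing_sequence F G (fun n => a n%:R) ;
  normalizer_coupling :
    log_average_coupling alpha F G (fun t => a t `^ alpha)
}.

(* the inverse of [a] on its range, extended by 0 where it is undefined *)
Definition inverse_on_halfline (R : realType) (a : R -> R) (y : R) : R :=
  xget 0 [set t | 0 <= t /\ a t = y].

(* Main.v *)
(* Write u_m for the probability that the chain started at a is at a at time m,
   and tau for the return time. The Laplace transform of u is
   1 / (1 - E e^(-w tau)), and both conditions (a) and (b) say that it varies
   regularly at 0: for (b) by the continuity theorem for Laplace transforms, for
   (a) by Karamata's Abelian and Tauberian theorems, the latter in the form that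
   functionals on [0, 1] with converging moments converge. Since the potential
   of the stable process has the same moments up to the constant C of the
   exponent of G, the Tauberian limit kappa of (sum_(m <= t) u_m) / u^(1/t) also
   gives c = kappa / C; and n (1 - E e^(-tau / a(n))) -> C then yields
   abar_n ~ c ahat(n).
   For the indicator of the state a, the averages (i) and (ii) with respect to
   abar obey a law of large numbers because their variances are at most of the
   order of their means (Chung and Erdos). Hopf's ratio ergodic theorem and
   summation by parts replace the indicator by phi, and abar by ahat. *)

From HB Require Import structures.
Require Import Defs.
From mathcomp Require Import all_boot all_order all_algebra.
From mathcomp Require Import all_classical all_reals all_analysis.
From mathcomp Require Import measurable_realfun.
From mathcomp Require Import ring lra zify.

Set Implicit Arguments.
Unset Strict Implicit.
Unset Printing Implicit Defensive.

Import Order.TTheory GRing.Theory Num.Theory.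
Import numFieldNormedType.Exports.

Local Open Scope classical_set_scope.
Local Open Scope ring_scope.

(** * Positive functionals and their moments *)

(** The constant [kappa] is never computed. The Tauberian theorem shows that all sequences of
    positive functionals whose k-th moment tends to (k+1)^(-alpha) have the same limit on the
    truncated inverse [inv_step 1]. Applied to the renewal measure and to the discretised potential
    of the stable process, this ties [c] to the return sequence without evaluating a Gamma function.
    Moments control continuous test functions only, while [inv_step x] jumps at e^(-x). A continuous
    ramp between two levels x < x' bridges the jump, and regular variation makes the gap between the
    levels small. The law of large numbers lives on the probability obtained by restricting rho to
    the state, whereas the ratio theorem holds rho-almost everywhere. Almost every path visits the
    state, and counting from such a visit changes the number of visits by a bounded amount, which
    the averages do not see. Average (ii) cannot be compared term by term: values of phi bear no
    relation to single visits, only their sums do. Summation by parts against a monotone weight is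
    what carries the ratio theorem over to it. *)

Section weierstrass.
Context {R : realType}.
Implicit Types (h : nat -> R) (x : R).

(* The Bernstein polynomial, [h k] being the value at the k-th node. The
   recursion conditions on the first of n Bernoulli trials. *)
Fixpoint bernstein n h : {poly R} :=
  if n is m.+1 then 'X * bernstein m (h \o S) + (1 - 'X) * bernstein m h
  else (h 0%N)%:P.

Lemma bernsteinS n h x : (bernstein n.+1 h).[x] =
  x * (bernstein n (h \o S)).[x] + (1 - x) * (bernstein n h).[x].
Proof. by rewrite /= !hornerE. Qed.

Lemma bernstein_le n h1 h2 x : 0 <= x <= 1 ->
  (forall k, (k <= n)%N -> h1 k <= h2 k) ->
  (bernstein n h1).[x] <= (bernstein n h2).[x].
Proof.
move=> /andP[x0 x1]; elim: n h1 h2 => [|n IH] h1 h2 h12.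
  by rewrite /= !hornerE h12.
rewrite !bernsteinS lerD ?ler_wpM2l ?subr_ge0 ?IH// => k kn.
  by rewrite /= h12.
by rewrite h12// leqW.
Qed.

(** Mean and variance of a binomial variable in one identity, which is all that Chebyshev's argument
    needs. The centre [c] is free because conditioning on a success replaces it by [c - 1]. *)
Lemma bernstein_quadratic n (a b c x : R) :
  (bernstein n (fun k => a + b * (k%:R - c) ^+ 2)).[x] =
  a + b * (n%:R * x * (1 - x) + (n%:R * x - c) ^+ 2).
Proof.
elim: n c => [|n IH] c; first by rewrite /= !hornerE; ring.
rewrite bernsteinS IH (_ : _ \o S = fun k => a + b * (k%:R - (c - 1)) ^+ 2).
  by rewrite IH -[n.+1]addn1 natrD; ring.
by apply/funext => k /=; rewrite -[k.+1]addn1 natrD; ring.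
Qed.

(** By contradiction: otherwise there are pairs at distance at most 1/(n+1) whose values stay [e]
    apart, and a convergent subsequence violates continuity at its limit. *)
Lemma uniformly_continuous01 (g : R -> R) : continuous g ->
  forall e : R, 0 < e -> exists2 del : R, 0 < del &
    forall x y : R, 0 <= x <= 1 -> `|x - y| <= del -> `|g x - g y| <= e.
Proof.
move=> gc e e0; apply: contrapT => /forall2NP H.
have /choice[z Hz] n : exists z : R * R, [/\ 0 <= z.1 <= 1,
    `|z.1 - z.2| <= n.+1%:R^-1 & e < `|g z.1 - g z.2|].
  have [|] := H (n.+1%:R^-1); first by rewrite invr_gt0 ltr0n.
  move=> /existsNP[x /existsNP[y]] /not_implyP[x01] /not_implyP[xy] /negP.
  by rewrite -ltNge => ?; exists (x, y).
have bz : bounded_fun (fun n => (z n).1).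
  exists 1; split => // M M1 n _; have [/andP[? ?] _ _] := Hz n.
  by rewrite /= ger0_norm// (le_trans _ (ltW M1)).
have [f fi fc] := bolzano_weierstrass bz.
set l := lim (((fun n => (z n).1) \o f) @ \oo) in fc.
have fge n : (n <= f n)%N.
  elim: n => // n IH; rewrite (leq_ltn_trans IH)//.
  by have := leW_mono fi n n.+1; rewrite !ltEnat /= ltnSn.
have c1 : (z (f n)).1 @[n --> \oo] --> l by exact: fc.
have c2 : (z (f n)).2 @[n --> \oo] --> l.
  rewrite (_ : (fun n => (z (f n)).2) =
    (fun n => (z (f n)).1 - ((z (f n)).1 - (z (f n)).2))); last first.
    by apply/funext => n; rewrite subKr.
  rewrite -[l]subr0; apply: cvgB => //.
  apply/cvgr0Pnorm_le => e1 e10; have [N _ HN] := near_infty_natSinv_lt (PosNum e10).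
  near=> n; have [_ + _] := Hz (f n); move=> /le_trans; apply.
  apply: le_trans (ltW (HN n _)); last by near: n; exact: nbhs_infty_ge.
  by rewrite lef_pV2 ?posrE ?ltr0n// ler_nat ltnS fge.
have c3 : (g (z (f n)).1 - g (z (f n)).2) @[n --> \oo] --> g l - g l.
  by apply: cvgB; apply: continuous_cvg => //; exact: gc.
rewrite subrr in c3; move/cvgr0Pnorm_lt : c3 => /(_ e e0)[N _ /(_ N (leqnn _))].
by have [_ _ /ltW] := Hz (f N); rewrite leNgt => /negP.
Unshelve. all: by end_near. Qed.

Lemma bounded_on01 (g : R -> R) : continuous g ->
  exists M : R, forall x : R, 0 <= x <= 1 -> `|g x| <= M.
Proof.
move=> gc; have gc01 : {within `[0, 1], continuous g}.
  by apply: continuous_subspaceT.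
have [c1 _ H1] := EVT_max ler01 gc01.
have [c2 _ H2] := EVT_min ler01 gc01.
exists (`|g c1| + `|g c2|) => x x01.
have xI : x \in `[0, 1] by rewrite in_itv.
have := H1 _ xI; have := H2 _ xI; have := ler_norm (g c1); have := ler_norm (- g c2).
have := normr_ge0 (g c1); have := normr_ge0 (g c2).
by rewrite normrN ler_norml => *; apply/andP; split; lra.
Qed.

Lemma weierstrass_approx (g : R -> R) : continuous g -> forall e : R, 0 < e ->
  exists p : {poly R}, forall x : R, 0 <= x <= 1 -> `|g x - p.[x]| <= e.
Proof.
move=> gc e e0; have [M HM] := bounded_on01 gc.
have e20 : 0 < e / 2 by lra.
have [del del0 Hdel] := uniformly_continuous01 gc e20.
have M0 : 0 <= M by apply: le_trans (HM 0 _); rewrite ?lexx ?ler01.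
(* Chebyshev's constant: beyond distance [del] the oscillation 2M is at most K times the squared
   distance, so a quadratic majorises g x - g y at every node. *)
pose K := 2 * M / del ^+ 2.
have K0 : 0 <= K by apply: divr_ge0; [exact: mulr_ge0|exact: sqr_ge0].
have [N HN] : exists N : nat, K / (e / 2) <= N%:R /\ (0 < N)%N.
  exists (Num.truncn (K / (e / 2))).+1; split => //.
  by apply/ltW; rewrite truncnS_gt.
have [HN1 N0] := HN; have N0' : 0 < N%:R :> R by rewrite ltr0n.
exists (bernstein N (fun k => g (k%:R / N%:R))) => x x01.
have key k : (k <= N)%N -> `|g x - g (k%:R / N%:R)| <=
    e / 2 + K / N%:R ^+ 2 * (k%:R - N%:R * x) ^+ 2.
  move=> kN; set y := k%:R / N%:R.
  have -> : K / N%:R ^+ 2 * (k%:R - N%:R * x) ^+ 2 = K * (x - y) ^+ 2.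
    by rewrite /y; field; lra.
  have [xy|xy] := leP `|x - y| del.
    by apply: (le_trans (Hdel _ _ x01 xy)); rewrite lerDl mulr_ge0 ?sqr_ge0.
  have y01 : 0 <= y <= 1.
    by rewrite /y divr_ge0//= ler_pdivrMr// mul1r ler_nat.
  apply: (@le_trans _ _ (2 * M)).
    apply: (le_trans (ler_normB _ _)); have := HM _ x01; have := HM _ y01; lra.
  apply: (@le_trans _ _ (K * del ^+ 2)).
    by rewrite /K divfK// expf_neq0// gt_eqF.
  have : K * del ^+ 2 <= K * (x - y) ^+ 2.
    rewrite ler_wpM2l// -(real_normK (num_real (x - y))) lerXn2r ?nnegrE//; lra.
  lra.
have bnd : e / 2 + K / N%:R ^+ 2 * (N%:R * x * (1 - x) + (N%:R * x - N%:R * x) ^+ 2) <= e.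
  rewrite subrr expr0n addr0.
  have -> : K / N%:R ^+ 2 * (N%:R * x * (1 - x)) = K / N%:R * (x * (1 - x)).
    by field; lra.
  have : K / N%:R <= e / 2 by rewrite ler_pdivrMr// mulrC -ler_pdivrMr.
  have : 0 <= K / N%:R by rewrite divr_ge0// ltW.
  by case/andP: x01 => *; nra.
have lin n (h : nat -> R) (c : R) :
    c - (bernstein n h).[x] = (bernstein n (fun k => c - h k)).[x].
  elim: n h => [|n IH] h; first by rewrite /= !hornerE.
  by rewrite !bernsteinS -(IH h) -(IH (h \o S)); ring.
rewrite lin.
rewrite ler_norml; apply/andP; split.
  rewrite -[leLHS](_ : (bernstein N (fun k => - e + 0 * (k%:R - 0) ^+ 2)).[x] = _);
    last by rewrite bernstein_quadratic; ring.
  apply: (@le_trans _ _ (bernstein N (fun k => - (e / 2) + (- (K / N%:R ^+ 2)) * (k%:R - N%:R * x) ^+ 2)).[x]).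
    by rewrite !bernstein_quadratic; lra.
  apply: bernstein_le => // k /key; rewrite ler_norml => /andP[+ _]; lra.
apply: (@le_trans _ _ (bernstein N (fun k => e / 2 + K / N%:R ^+ 2 * (k%:R - N%:R * x) ^+ 2)).[x]).
  apply: bernstein_le => // k /key; rewrite ler_norml => /andP[_ +]; lra.
by rewrite bernstein_quadratic.
Qed.

End weierstrass.

Section filters.
Context {R : realType} {T : Type} (F : set_system T) {FF : Filter F}.

Lemma cvg_maxr2 (f g : T -> R) (a b : R) : f @ F --> a -> g @ F --> b ->
  Num.max (f t) (g t) @[t --> F] --> Num.max a b.
Proof.
move=> fa gb; rewrite maxr_absE; under eq_cvg do rewrite maxr_absE.
apply: cvgMl; apply: cvgD; first exact: cvgD.
by apply: cvg_norm; exact: cvgB.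
Qed.

Lemma cvg_minr2 (f g : T -> R) (a b : R) : f @ F --> a -> g @ F --> b ->
  Num.min (f t) (g t) @[t --> F] --> Num.min a b.
Proof.
move=> fa gb; rewrite minr_absE; under eq_cvg do rewrite minr_absE.
apply: cvgMl; apply: cvgB; first exact: cvgD.
by apply: cvg_norm; exact: cvgB.
Qed.

End filters.

(** * Positive functionals on [0, 1] and what their moments determine *)

Section positive_functionals.
Context {R : realType}.
Implicit Types (f g : R -> R) (Phi : (R -> R) -> R).

Definition bounded01 g : Prop := measurable_fun setT g /\
  exists M : R, forall y : R, 0 <= y <= 1 -> `|g y| <= M.

(** A functional is a total map on all functions, but its laws are asked only on [bounded01], where
    the series and expectations used below converge. *)
Record positive_functional Phi : Prop := {
  pf_add : forall f g, bounded01 f -> bounded01 g ->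
    Phi (fun y => f y + g y) = Phi f + Phi g ;
  pf_scale : forall c f, bounded01 f -> Phi (fun y => c * f y) = c * Phi f ;
  pf_le : forall f g, bounded01 f -> bounded01 g ->
    (forall y, 0 <= y <= 1 -> f y <= g y) -> Phi f <= Phi g
}.

Lemma continuous_bounded01 g : continuous g -> bounded01 g.
Proof.
by move=> gc; split; [exact: continuous_measurable_fun|exact: bounded_on01].
Qed.

Lemma bounded01D f g : bounded01 f -> bounded01 g ->
  bounded01 (fun y => f y + g y).
Proof.
move=> [mf [M HM]] [mg [N HN]]; split; first exact: measurable_funD.
by exists (M + N) => y y01; rewrite (le_trans (ler_normD _ _))// lerD ?HM ?HN.
Qed.

Lemma bounded01Z (c : R) f : bounded01 f -> bounded01 (fun y => c * f y).
Proof.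
move=> [mf [M HM]]; split; first exact: measurable_funM.
by exists (`|c| * M) => y y01; rewrite normrM ler_wpM2l// HM.
Qed.

Lemma bounded01_cst (c : R) : bounded01 (fun=> c).
Proof. by split => //; exists `|c|. Qed.

Lemma bounded01X n : bounded01 (fun y => y ^+ n).
Proof. by apply: continuous_bounded01 => x; exact: exprn_continuous. Qed.

Lemma bounded01_horner (p : {poly R}) : bounded01 (horner p).
Proof. by apply: continuous_bounded01 => x; exact: continuous_horner. Qed.

Lemma pf_horner Phi (p : {poly R}) : positive_functional Phi ->
  Phi (horner p) = \sum_(i < size p) p`_i * Phi (fun y => y ^+ i).
Proof.
move=> pfP.
have -> : horner p = fun y => \sum_(i < size p) p`_i * y ^+ i.
  by apply/funext => y; rewrite horner_coef.
have H n : bounded01 (fun y => \sum_(i < n) p`_i * y ^+ i) /\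
  Phi (fun y => \sum_(i < n) p`_i * y ^+ i) =
  \sum_(i < n) p`_i * Phi (fun y => y ^+ i).
  elim: n => [|n [IH1 IH2]].
    have -> : (fun y => \sum_(i < 0) p`_i * y ^+ i) = (fun y : R => 0 * (fun=> 0) y).
      by apply/funext => y; rewrite big_ord0 mul0r.
    split; first by apply: bounded01Z; exact: bounded01_cst.
    by rewrite pf_scale// ?mul0r ?big_ord0//; exact: bounded01_cst.
  have -> : (fun y => \sum_(i < n.+1) p`_i * y ^+ i) =
    fun y => \sum_(i < n) p`_i * y ^+ i + p`_n * y ^+ n.
    by apply/funext => y; rewrite big_ord_recr.
  have b2 : bounded01 (fun y => p`_n * y ^+ n).
    by apply: bounded01Z; exact: bounded01X.
  split; first exact: bounded01D.
  rewrite (pf_add pfP)// IH2 (pf_scale pfP)//; last exact: bounded01X.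
  by rewrite big_ord_recr.
by have [] := H (size p).
Qed.

Lemma pf_dist Phi f g (e : R) : positive_functional Phi -> bounded01 f ->
  bounded01 g -> (forall y, 0 <= y <= 1 -> `|f y - g y| <= e) ->
  `|Phi f - Phi g| <= e * Phi (fun=> 1).
Proof.
move=> pfP bf bg fg; have b1 := bounded01_cst 1.
have be : bounded01 (fun=> e * 1) by exact: (@bounded01Z e (fun=> 1)).
rewrite ler_distlC; apply/andP; split.
  rewrite lerBlDr -(pf_scale pfP)// -(pf_add pfP)//.
  apply: pf_le => //; first exact: bounded01D.
  by move=> y /fg; rewrite ler_distl mulr1 => /andP[]; lra.
rewrite -(pf_scale pfP)// -(pf_add pfP)//.
apply: pf_le => //; first exact: bounded01D.
by move=> y /fg; rewrite ler_distl mulr1 => /andP[]; lra.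
Qed.

(* The moments determine the limit on continuous functions; [L] depends neither
   on the family nor on the filter, so two families can be compared. *)
Lemma moments_continuous (m : nat -> R) g : continuous g ->
  forall e : R, 0 < e -> exists L : R,
  forall (T : Type) (F : set_system T) (FF : Filter F) (Phi : T -> (R -> R) -> R),
  (forall t, positive_functional (Phi t)) ->
  (forall k, Phi t (fun y => y ^+ k) @[t --> F] --> m k) ->
  \forall t \near F, `|Phi t g - L| <= e.
Proof.
move=> gc e e0; pose B := `|m 0%N| + 1.
have B0 : 0 < B by rewrite /B ltr_wpDl.
have eta0 : 0 < e / 2 / B by rewrite !divr_gt0.
have [p Hp] := weierstrass_approx gc eta0.
exists (\sum_(i < size p) p`_i * m i) => T F FF Phi pfP mP.
have c1 : Phi t (horner p) @[t --> F] --> \sum_(i < size p) p`_i * m i.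
  under eq_cvg do rewrite (pf_horner p (pfP _)).
  by apply: cvg_big => [|i _]; [exact: add_continuous|apply: cvgMr => //; exact: mP].
have c0 := mP 0%N.
have e20 : 0 < e / 2 by rewrite divr_gt0.
move/cvgrPdist_le : c1 => /(_ _ e20) c1.
move/cvgrPdist_le : c0 => /(_ _ ltr01) c0.
near=> t.
have h1 : `|\sum_(i < size p) p`_i * m i - Phi t (horner p)| <= e / 2.
  by near: t.
have h0 : `|m 0%N - Phi t (fun y => y ^+ 0)| <= 1 by near: t.
have E1 : Phi t (fun=> 1) = Phi t (fun y => y ^+ 0).
  by congr (Phi t _); apply/funext => y; rewrite expr0.
have P1 : Phi t (fun=> 1) <= B.
  rewrite E1 /B; move: h0; rewrite ler_distlC => /andP[_].
  have := ler_norm (m 0%N); lra.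
have := pf_dist (pfP t) (continuous_bounded01 gc) (bounded01_horner p) Hp.
have : e / 2 / B * Phi t (fun=> 1) <= e / 2.
  by rewrite mulrAC ler_pdivrMr// ler_wpM2l// ltW.
move: h1; rewrite !ler_norml => /andP[? ?] ? /andP[? ?]; apply/andP; split; lra.
Unshelve. all: by end_near. Qed.

Lemma pf_series (v y : nat -> R) : (forall n, 0 <= v n) ->
  (forall n, 0 <= y n <= 1) -> cvgn (series v) ->
  positive_functional (fun g => limn (series (fun n => v n * g (y n)))).
Proof.
move=> v0 y01 cv.
have cs g : bounded01 g -> cvgn (series (fun n => v n * g (y n))).
  move=> [_ [M HM]]; apply: normed_cvg.
  apply: (@series_le_cvg _ _ (fun n => M * v n)).
  - by move=> n; rewrite normr_ge0.
  - move=> n; rewrite mulr_ge0//; apply: le_trans (HM (y n) (y01 n)); exact: normr_ge0.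
  - by move=> n /=; rewrite normrM mulrC (ger0_norm (v0 n)); apply: ler_wpM2r => //; exact: HM.
  - exact: (is_cvg_seriesZ (k := M) cv).
split.
- move=> f g bf bg; rewrite -lim_seriesD; [|exact: cs..].
  by congr (limn (series _)); apply/funext => n; rewrite mulrDr.
- move=> c f bf.
  have -> : c * limn (series (fun n => v n * f (y n))) =
    c *: limn (series (fun n => v n * f (y n))) by [].
  rewrite -lim_seriesZ; last exact: cs.
  by congr (limn (series _)); apply/funext => n /=; rewrite mulrCA.
- move=> f g bf bg fg; apply: lim_series_le; [exact: cs..|].
  by move=> n; rewrite ler_wpM2l// fg.
Qed.

Lemma pf_sum n (phi : nat -> (R -> R) -> R) (c : R) : 0 <= c ->
  (forall k, positive_functional (phi k)) ->
  positive_functional (fun g => c * \sum_(k < n) phi k g).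
Proof.
move=> c0 pfp; split.
- move=> f g bf bg; rewrite -mulrDr -big_split/=; congr (_ * _).
  by apply: eq_bigr => k _; rewrite (pf_add (pfp k)).
- move=> a f bf; rewrite [RHS]mulrCA; congr (c * _); rewrite mulr_sumr.
  by apply: eq_bigr => k _; rewrite (pf_scale (pfp k)).
- by move=> f g bf bg fg; rewrite ler_wpM2l// ler_sum// => k _; exact: (pf_le (pfp k)).
Qed.

Lemma bounded_integrable d (W : measurableType d) (Q : probability W R)
    (f : W -> R) (M : R) : measurable_fun setT f -> (forall w, `|f w| <= M) ->
  Q.-integrable setT (EFin \o f).
Proof.
move=> mf fM; apply: measurable_bounded_integrable => //.
  by rewrite (le_lt_trans (probability_le1 Q measurableT))// ltry.
by exists M; split; [exact: num_real|move=> x Mx w _ /=; rewrite (le_trans (fM w))// ltW].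
Qed.

Lemma pf_expectation d (W : measurableType d) (Q : probability W R)
    (v Y : W -> R) (M : R) : measurable_fun setT v -> measurable_fun setT Y ->
  (forall w, 0 <= v w <= M) -> (forall w, 0 <= Y w <= 1) ->
  positive_functional (fun g => \int[Q]_w (v w * g (Y w))).
Proof.
move=> mv mY v01 Y01.
have bi g : bounded01 g -> Q.-integrable setT (EFin \o (fun w => v w * g (Y w))).
  move=> [mg [N HN]]; apply: (@bounded_integrable _ _ _ _ (M * N)).
    by apply: measurable_funM => //; exact: measurableT_comp.
  move=> w; have /andP[v0 vM] := v01 w; rewrite normrM (ger0_norm v0).
  by apply: ler_pM => //; exact: HN.
split.
- move=> f g bf bg; rewrite -RintegralD//; [|exact: bi..].
  by apply: eq_Rintegral => w _; rewrite mulrDr.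
- move=> c f bf; rewrite -RintegralZl//; last exact: bi.
  by apply: eq_Rintegral => w _; rewrite mulrCA.
- move=> f g bf bg fg; apply: le_Rintegral => //; [exact: bi..|].
  by move=> w _; have /andP[v0 _] := v01 w; rewrite ler_wpM2l// fg.
Qed.

(** Karamata's test function. At y = e^(-m/t) the factor 1/y cancels the exponential weight of a
    Laplace series and leaves the sharp cutoff m <= x t. The cutoff in y keeps it bounded by e^x. *)
Definition inv_step (x y : R) : R := if expR (- x) <= y then y^-1 else 0.

(** The function 1/y switched on linearly between e^(-x') and e^(-x). The maximum in the inverse
    avoids the pole at 0 and changes nothing where the second factor is positive. *)
Let ramp (x x' y : R) := (Num.max y (expR (- x')))^-1 *
  Num.min 1 (Num.max 0 ((y - expR (- x')) / (expR (- x) - expR (- x')))).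

Let ramp_continuous (x x' : R) : continuous (ramp x x').
Proof.
move=> y; apply: cvgM.
  apply: cvgV; first by rewrite gt_eqF// lt_max expR_gt0 orbT.
  by apply: cvg_maxr2; [exact: cvg_id|exact: cvg_cst].
apply: cvg_minr2; first exact: cvg_cst.
apply: cvg_maxr2; first exact: cvg_cst.
apply: cvgMl => //; apply: cvgB; [exact: cvg_id|exact: cvg_cst].
Qed.

Lemma bounded01_inv_step (x : R) : bounded01 (inv_step x).
Proof.
split; last first.
  exists (expR x) => y /andP[y0 y1]; rewrite /inv_step; case: ifPn => h.
    rewrite ger0_norm ?invr_ge0// -[expR x]invrK -expRN lef_pV2 ?posrE ?expR_gt0//.
    by rewrite (lt_le_trans (expR_gt0 _) h).
  by rewrite normr0 expR_ge0.
have -> : inv_step x = fun y => (Num.max y (expR (- x)))^-1 * \1_`[expR (- x), +oo[ y.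
  apply/funext => y; rewrite /inv_step indicE mem_setE in_itv/= andbT.
  case: ifPn => h; last by rewrite mulr0.
  by rewrite mulr1 (max_l h).
apply: measurable_funM => //.
apply: continuous_measurable_fun => y.
apply: cvgV; first by rewrite gt_eqF// lt_max expR_gt0 orbT.
by apply: cvg_maxr2; [exact: cvg_id|exact: cvg_cst].
Qed.

(** On [0, 1] the ramp lies between [inv_step x] and [inv_step x'], so its approximate limit L
    bounds the former from above and the latter from below. As before, L is fixed before the family
    and the filter. *)
Lemma moments_inv_step (m : nat -> R) (x x' : R) : x < x' ->
  forall e : R, 0 < e -> exists L : R,
  forall (T : Type) (F : set_system T) (FF : Filter F) (Phi : T -> (R -> R) -> R),
  (forall t, positive_functional (Phi t)) ->
  (forall k, Phi t (fun y => y ^+ k) @[t --> F] --> m k) ->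
  \forall t \near F, Phi t (inv_step x) <= L + e /\ L - e <= Phi t (inv_step x').
Proof.
move=> xx' e e0.
have [L HL] := moments_continuous m (@ramp_continuous x x') e0.
exists L => T F FF Phi pfP mP; have := HL T F FF Phi pfP mP.
have ee : expR (- x') < expR (- x) by rewrite ltr_expR ltrN2.
have ex0 := expR_gt0 (- x').
apply: filterS => t; rewrite ler_distl => /andP[H1 H2].
have br := continuous_bounded01 (@ramp_continuous x x').
split.
  apply: le_trans H2; apply: (pf_le (pfP t)) => //; first exact: bounded01_inv_step.
  move=> y /andP[y0 y1]; rewrite /inv_step /ramp; case: ifPn => h.
    rewrite max_l; last by lra.
    rewrite min_l ?mulr1// le_max; apply/orP; right.
    by rewrite ler_pdivlMr ?subr_gt0// mul1r; lra.
  rewrite mulr_ge0// ?invr_ge0 ?le_max ?y0// le_min ler01/= le_max lexx//.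
apply: le_trans H1 _; apply: (pf_le (pfP t)) => //; first exact: bounded01_inv_step.
move=> y /andP[y0 y1]; rewrite /inv_step /ramp; case: ifPn => h.
  rewrite max_l// ler_piMr ?invr_ge0//; last by rewrite ge_min lexx.
rewrite (max_l (y := (y - _) / _)); last first.
  by rewrite pmulr_lle0 ?invr_gt0; lra.
by rewrite min_r ?ler01// mulr0.
Qed.

End positive_functionals.

(** * Convergence in law from Laplace transforms at the natural numbers *)

Section method_of_moments.
Context {R : realType}.

Lemma expRN_in01 (y : R) : 0 <= y -> 0 <= expR (- y) <= 1.
Proof. by move=> y0; rewrite expR_ge0/= expR_le1 oppr_le0. Qed.

Lemma expectation1 d (W : measurableType d) (Q : probability W R) (c : R) :
  \int[Q]_w c = c.
Proof. by rewrite Rintegral_cst//= probability_setT mulr1. Qed.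

(** The hypotheses are the moments of e^(-Y), so continuous functions of e^(-Y) are under control. A
    bounded continuous f need not extend to e^(-y) = 0, the point at infinity; it is cut off there
    by [chi], and the mass cut off is bounded by a tail of G. *)
Lemma cvg_in_law_laplace d (W : measurableType d) (Q : probability W R)
    (Y : nat -> W -> R) (G : probability (measurableTypeR R) R) :
  (forall n, measurable_fun setT (Y n)) -> (forall n w, 0 <= Y n w) ->
  G `]0, +oo[%classic = 1%E ->
  (forall k : nat, \int[Q]_w expR (- (k%:R * Y n w)) @[n --> \oo] -->
    \int[G]_y expR (- (k%:R * y))) ->
  cvg_in_law Q Y G.
Proof.
move=> mY Y0 Gpos mom f fc [M HM].
have M0 : 0 <= M by apply: le_trans (HM 0).
(* G charges only the positive half-line, but as a measure on R; the truncation puts e^(-y) into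
   [0, 1] everywhere and changes integrals on a null set only. *)
pose y0 (y : R) := Num.max y 0.
have y00 (y : R) : 0 <= y0 y by rewrite le_max lexx orbT.
have my0 : measurable_fun setT y0 by exact: measurable_maxr.
have GN : G `]-oo, 0]%classic = 0%E.
  rewrite -setCitvr probability_setC// Gpos subee//.
pose Phi (n : nat) (g : R -> R) := \int[Q]_w (1 * g (expR (- Y n w))).
pose Psi (g : R -> R) := \int[G]_y (1 * g (expR (- y0 y))).
have mE d' (W' : measurableType d') (h : W' -> R) : measurable_fun setT h ->
    measurable_fun setT (fun w => expR (- h w)).
  move=> mh; apply: measurableT_comp => //; exact: measurable_funN.
have pfPhi n : positive_functional (Phi n).
  apply: (@pf_expectation _ _ _ Q (fun=> 1) _ 1) => //; first exact: mE.
  - by move=> w; rewrite ler01 lexx.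
  - by move=> w; exact: expRN_in01.
have pfPsi : positive_functional Psi.
  apply: (@pf_expectation _ _ _ G (fun=> 1) _ 1) => //; first exact: mE.
  - by move=> w; rewrite ler01 lexx.
  - by move=> w; exact: expRN_in01.
have eqG (g : R -> R) (N : R) : measurable_fun setT g -> (forall y, `|g y| <= N) ->
    \int[G]_y g (y0 y) = \int[G]_y g y.
  move=> mg gN; congr fine; apply: ae_eq_integral => //.
  - by apply/measurable_EFinP; exact: measurableT_comp.
  - by apply/measurable_EFinP.
  exists `]-oo, 0]%classic; split => //= y; apply: contra_notP => /= yN.
  by move=> _; rewrite /y0 max_l// leNgt; apply/negP => yn; apply: yN; rewrite in_itv/= ltW.
pose mm (k : nat) := \int[G]_y expR (- (k%:R * y0 y)).
have momPsi k : Psi (fun y => y ^+ k) = mm k.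
  by apply: eq_Rintegral => y _; rewrite mul1r -expRM_natl mulrN.
have momPhi k : Phi n (fun y => y ^+ k) @[n --> \oo] --> mm k.
  rewrite (_ : mm k = \int[G]_y expR (- (k%:R * y))).
    rewrite (_ : (fun n => _) = fun n => \int[Q]_w expR (- (k%:R * Y n w))); first exact: mom.
    apply/funext => n; apply: eq_Rintegral => y _.
    by rewrite mul1r -expRM_natl mulrN.
  pose g (y : R) := expR (- (k%:R * y0 y)).
  have -> : mm k = \int[G]_y g (y0 y).
    by apply: eq_Rintegral => y _; rewrite /g /y0 (max_l (y00 y)).
  congr fine; apply: ae_eq_integral => //.
  - apply/measurable_EFinP; apply: measurableT_comp => //.
    by apply: mE; apply: measurable_funM => //; exact: measurableT_comp.
  - by apply/measurable_EFinP; apply: mE; apply: measurable_funM.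
  exists `]-oo, 0]%classic; split => //= y; apply: contra_notP => /= yN.
  move=> _; rewrite /g /y0 max_l// max_l// leNgt; apply/negP => yn; apply: yN; rewrite in_itv/= ltW//.
have clim (g : R -> R) : continuous g -> Phi n g @[n --> \oo] --> Psi g.
  move=> gc; apply/cvgrPdist_le => e e0; have e20 : 0 < e / 2 by rewrite divr_gt0.
  have [L HL] := moments_continuous mm gc e20.
  have /HL H1 : forall k, (Phi n (fun y => y ^+ k)) @[n --> \oo] --> mm k by [].
  have [N0 _ /(_ N0 (leqnn _)) H2] : \forall n \near \oo, `|Psi g - L| <= e / 2.
    apply: (HL nat \oo _ (fun=> Psi)) => [n|k]; first exact: pfPsi.
    by rewrite (momPsi k); exact: (@cvg_cst R).
  apply: filterS (H1 pfPhi) => n; move: H2; rewrite !ler_norml.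
  by move=> /andP[? ?] /andP[? ?]; apply/andP; split; lra.
apply/cvgrPdist_le => e e0.
have e' : 0 < e / (4 * (M + 1)) by rewrite divr_gt0// mulr_gt0// ltr_wpDl.
have tail0 : G `]n%:R, +oo[%classic @[n --> \oo] --> 0%E.
  pose S (n : nat) : set R := `]n%:R, +oo[%classic.
  have <- : G (\bigcap_n S n) = 0%E.
    rewrite (_ : \bigcap_n S n = set0) ?measure0//.
    rewrite -subset0 => y /(_ (Num.truncn y).+1 I); rewrite /S /= in_itv/= andbT.
    by move=> /lt_trans/(_ (truncnS_gt y)); rewrite ltxx.
  apply: nonincreasing_cvg_mu => //.
  - by rewrite (le_lt_trans (probability_le1 G _))// ltry.
  - by apply: bigcap_measurable => //; exists 0%N.
  - move=> n m nm; apply/subsetPset => y; rewrite /S /= !in_itv/= !andbT.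
    by apply: le_lt_trans; rewrite ler_nat.
have /cvgrPdist_lt /(_ _ e') tail : fine (G `]n%:R, +oo[%classic) @[n --> \oo] --> (0 : R).
  by apply: (@fine_cvg _ _ _ _ (fun n : nat => G `]n%:R, +oo[%classic) 0%R).
case: tail => N _ /(_ N (leqnn N)) /= tail.
(* The cutoff [chi] vanishes below [del] and equals 1 above 2 [del] = e^(-N): thus [g] avoids the
   singularity of ln at 0, and 1 - chi(e^(-y)) vanishes unless y > N. *)
pose del := expR (- N%:R) / 2 : R.
have del0 : 0 < del by rewrite divr_gt0 ?expR_gt0.
pose chi (y : R) := Num.min 1 (Num.max 0 (y / del - 1)).
have chi01 y : 0 <= chi y <= 1.
  by rewrite /chi le_min ler01 le_max lexx/= ge_min lexx.
have chic : continuous chi.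
  move=> y; apply: cvg_minr2; first exact: cvg_cst.
  apply: cvg_maxr2; first exact: cvg_cst.
  by apply: cvgB; [apply: cvgMl; exact: cvg_id|exact: cvg_cst].
pose g (y : R) := f (- ln (Num.max y del)) * chi y.
have gc : continuous g.
  move=> y; apply: cvgM; last exact: chic.
  apply: (@cvg_comp _ _ _ (fun y => - ln (Num.max y del)) f); last exact: fc.
  apply: cvgN; apply: (@cvg_comp _ _ _ (fun y => Num.max y del) (@ln R)).
    by apply: cvg_maxr2; [exact: cvg_id|exact: cvg_cst].
  by apply: continuous_ln; rewrite lt_max del0 orbT.
pose psi (y : R) : R := 1 - chi y.
have psic : continuous psi by move=> y; apply: cvgB; [exact: cvg_cst|exact: chic].
have mf : measurable_fun setT f by exact: continuous_measurable_fun.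
have mpsi := continuous_measurable_fun psic.
have mg := continuous_measurable_fun gc.
have fg (y : R) : 0 <= y -> `|f y - g (expR (- y))| <= M * psi (expR (- y)).
  move=> yge; rewrite /g /psi; set E := expR (- y).
  have [Ed|Ed] := leP del E.
    rewrite /E expRK opprK -{1}[f y]mulr1 -mulrBr normrM.
    have /andP[c0 c1] := chi01 E.
    by rewrite (ger0_norm (x := 1 - _)) ?subr_ge0// ler_wpM2r// subr_ge0.
  have -> : chi E = 0.
    rewrite /chi max_l ?min_r// subr_le0 ler_pdivrMr// mul1r; exact: ltW.
  by rewrite mulr0 !subr0 mulr1 HM.
have key d' (W' : measurableType d') (Q' : probability W' R) (h : W' -> R) :
    measurable_fun setT h -> (forall w, 0 <= h w) ->
    `|\int[Q']_w f (h w) - \int[Q']_w (1 * g (expR (- h w)))| <=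
    M * \int[Q']_w (1 * psi (expR (- h w))).
  move=> mh h0.
  have i1 : Q'.-integrable setT (EFin \o (fun w => f (h w))).
    by apply: (@bounded_integrable _ _ _ _ _ M) => //; exact: measurableT_comp.
  have i2 : Q'.-integrable setT (EFin \o (fun w => 1 * g (expR (- h w)))).
    apply: (@bounded_integrable _ _ _ _ _ M).
      by apply: measurable_funM => //; apply: measurableT_comp => //; exact: mE.
    move=> w; rewrite mul1r /g normrM; have /andP[c0 c1] := chi01 (expR (- h w)).
    by rewrite (ger0_norm c0) -[leRHS]mulr1 ler_pM.
  have i3 : Q'.-integrable setT (EFin \o (fun w => 1 * psi (expR (- h w)))).
    apply: (@bounded_integrable _ _ _ _ _ 1).
      by apply: measurable_funM => //; apply: measurableT_comp => //; exact: mE.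
    move=> w; rewrite mul1r /psi; have /andP[c0 c1] := chi01 (expR (- h w)).
    by rewrite ger0_norm ?subr_ge0// gerBl.
  rewrite -RintegralB//; apply: le_trans (le_normr_Rintegral _ _) _ => //.
    exact: (@integrableB _ _ _ _ _ _ (EFin \o (fun w => f (h w))) (EFin \o (fun w => 1 * g (expR (- h w))))).
  rewrite -RintegralZl//; apply: le_Rintegral => //.
  - apply: (@bounded_integrable _ _ _ _ _ (M * 1)).
      apply: measurableT_comp => //; apply: measurable_funB; first exact: measurableT_comp.
      by apply: measurable_funM => //; apply: measurableT_comp => //; exact: mE.
    move=> w; rewrite normr_id mul1r; apply: (le_trans (fg _ (h0 w))).
    by rewrite ler_wpM2l// /psi gerBl; have /andP[] := chi01 (expR (- h w)).
  - exact: (integrableZl measurableT M i3).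
  - by move=> w _; rewrite !mul1r; exact: fg.
have psiPsi : Psi psi <= e / (4 * (M + 1)).
  have Gt : \int[G]_y (\1_(`]N%:R, +oo[%classic : set R) y) <= e / (4 * (M + 1)).
    rewrite /Rintegral integral_indic// setIT.
    by move: tail; rewrite sub0r normrN => /ltW; apply: le_trans; exact: ler_norm.
  apply: le_trans Gt; apply: le_Rintegral => //.
  - apply: (@bounded_integrable _ _ _ _ _ 1).
      by apply: measurable_funM => //; apply: measurableT_comp => //; exact: mE.
    move=> w; rewrite mul1r /psi; have /andP[c0 c1] := chi01 (expR (- y0 w)).
    by rewrite ger0_norm ?subr_ge0// gerBl.
  - apply: (@bounded_integrable _ _ _ _ _ 1) => //.
    by move=> w; rewrite indicE; case: (_ \in _); rewrite ?normr1 ?normr0.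
  move=> y _; rewrite mul1r indicE mem_setE in_itv/= andbT.
  have [yN|yN] := ltP N%:R y; first by rewrite /psi gerBl; have /andP[] := chi01 (expR (- y0 y)).
  rewrite /psi /chi; have h2 : 1 <= expR (- y0 y) / del - 1.
    rewrite lerBrDr ler_pdivlMr// /del mulrCA divff// mulr1 ler_expR lerN2.
    by rewrite /y0 ge_max yN ler0n.
  by rewrite max_r ?(le_trans ler01)// min_l// subrr.
have cg := clim _ gc; have cp := clim _ psic.
have e4 : 0 < e / 4 by rewrite divr_gt0.
move/cvgrPdist_le : cg => /(_ _ e4) cg; move/cvgrPdist_le : cp => /(_ _ e') cp.
near=> n.
have h1 : `|Psi g - Phi n g| <= e / 4 by near: n.
have h2 : `|Psi psi - Phi n psi| <= e / (4 * (M + 1)) by near: n.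
have k1 := key _ _ Q (Y n) (mY n) (Y0 n).
have k2 := key _ _ G y0 my0 y00.
rewrite (eqG f M)// in k2.
have E : M * (e / (4 * (M + 1))) <= e / 4.
  rewrite mulrA ler_pdivrMr ?mulr_gt0 ?ltr_wpDl//; nra.
have u1 : M * Psi psi <= e / 4 by apply: le_trans E; rewrite ler_wpM2l.
have u2 : M * Phi n psi <= e / 4 + e / 4.
  apply: (@le_trans _ _ (M * (e / (4 * (M + 1)) + e / (4 * (M + 1))))).
    by rewrite ler_wpM2l//; move: h2; rewrite ler_distlC => /andP[]; lra.
  by rewrite mulrDr lerD.
have k1' := le_trans k1 u2; have k2' := le_trans k2 u1.
move: h1 k1' k2'; rewrite -/(Psi g) -/(Phi n g) !ler_norml => /andP[? ?] /andP[? ?] /andP[? ?].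
apply/andP; split; lra.
Unshelve. all: by end_near. Qed.

End method_of_moments.

(** * Laplace transforms of renewal sequences *)

Section laplace_series.
Context {R : realType}.
Implicit Types (u v f : nat -> R) (w x t : R).

Definition laplace_series v w : R :=
  limn (series (fun m => v m * expR (- (w * m%:R)))).

Definition sum_upto v x : R := \sum_(0 <= m < (Num.truncn x).+1) v m.

Lemma laplace_series_cvg v w : (forall m, 0 <= v m <= 1) -> 0 < w ->
  cvgn (series (fun m => v m * expR (- (w * m%:R)))).
Proof.
move=> v01 w0; pose g (m : nat) := geometric 1 (expR (- w)) m.
apply: (@series_le_cvg _ _ g).
- by move=> n; have /andP[v0 _] := v01 n; rewrite mulr_ge0// expR_ge0.
- by move=> n; rewrite /g /geometric/= mul1r exprn_ge0// expR_ge0.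
- move=> n; have /andP[v0 v1] := v01 n.
  rewrite /g /geometric/= mul1r -expRM_natr mulNr -[leRHS]mul1r ler_wpM2r//.
- by apply: is_cvg_geometric_series; rewrite ger0_norm ?expR_ge0// expR_lt1 oppr_lt0.
Qed.

Lemma laplace_series_partial v w n : (forall m, 0 <= v m <= 1) -> 0 < w ->
  \sum_(0 <= m < n) v m * expR (- (w * m%:R)) <= laplace_series v w.
Proof.
move=> v01 w0.
apply: (@nondecreasing_cvgn_le _ (series (fun m => v m * expR (- (w * m%:R))))).
  apply: nondecreasing_series => m _ _; have /andP[v0 _] := v01 m.
  by rewrite mulr_ge0// expR_ge0.
exact: laplace_series_cvg.
Qed.

Lemma laplace_series_le v w w' : (forall m, 0 <= v m <= 1) -> 0 < w -> w <= w' ->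
  laplace_series v w' <= laplace_series v w.
Proof.
move=> v01 w0 ww'; apply: lim_series_le.
- by apply: laplace_series_cvg => //; exact: lt_le_trans ww'.
- exact: laplace_series_cvg.
- move=> n; have /andP[v0 _] := v01 n.
  by rewrite ler_wpM2l// ler_expR lerN2 ler_wpM2r.
Qed.

(** For m <= t the weight e^(-m/t) is at least 1/e. This crude bound keeps the Abelian limit
    positive and the Tauberian ratios bounded. *)
Lemma laplace_series_ge_sum_upto v t : (forall m, 0 <= v m <= 1) -> 0 < t ->
  expR (- 1) * sum_upto v t <= laplace_series v t^-1.
Proof.
move=> v01 t0; have it0 : 0 < t^-1 by rewrite invr_gt0.
apply: le_trans (laplace_series_partial (Num.truncn t).+1 v01 it0).
rewrite /sum_upto mulr_sumr; apply: ler_sum_nat => m /andP[_].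
rewrite ltnS => mt; have /andP[v0 _] := v01 m.
rewrite mulrC ler_wpM2l// ler_expR lerN2 mulrC ler_pdivrMr// mul1r.
by rewrite -truncn_ge_nat// ltW.
Qed.

Lemma triangular_sum (a b : nat -> R) N :
  \sum_(0 <= m < N) \sum_(0 <= k < m.+1) b k * a (m - k)%N =
  \sum_(0 <= k < N) b k * \sum_(0 <= j < N - k) a j.
Proof.
elim: N => [|N IH]; first by rewrite !big_geq.
rewrite big_nat_recr//= IH [RHS]big_nat_recr//= [in LHS]big_nat_recr//=.
rewrite subSnn big_nat1 subnn addrA; congr (_ + _).
rewrite -big_split/=; apply: eq_big_nat => k /andP[_ kN].
by rewrite -mulrDr subSn 1?ltnW// big_nat_recr.
Qed.

(** Partial sums replace the Cauchy product: with A_n and B_n those of the weighted u and f,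
    monotonicity gives A_n <= 1 + B_n A_n <= A_(2n), and both ends have the same limit. *)
Lemma renewal_laplace u f w :
  (forall m, 0 <= u m <= 1) -> (forall m, 0 <= f m <= 1) ->
  (forall m, u m = (m == 0%N)%:R + \sum_(0 <= k < m.+1) f k * u (m - k)%N) ->
  0 < w -> laplace_series u w * (1 - laplace_series f w) = 1.
Proof.
move=> u01 f01 ren w0.
pose a m := u m * expR (- (w * m%:R)); pose b m := f m * expR (- (w * m%:R)).
have a0 m : 0 <= a m by have /andP[? _] := u01 m; rewrite mulr_ge0// expR_ge0.
have b0 m : 0 <= b m by have /andP[? _] := f01 m; rewrite mulr_ge0// expR_ge0.
have aE m : a m = (m == 0%N)%:R + \sum_(0 <= k < m.+1) b k * a (m - k)%N.
  rewrite /a ren mulrDl mulr_suml; congr (_ + _).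
    by case: m => [|m]; rewrite ?mulr0 ?oppr0 ?expR0 ?mulr1// mul0r.
  apply: eq_big_nat => k /andP[_]; rewrite ltnS => km.
  rewrite /b mulrACA -expRD; congr (_ * expR _).
  by rewrite natrB// ; ring.
have ca := laplace_series_cvg u01 w0; have cb := laplace_series_cvg f01 w0.
pose A := laplace_series u w; pose B := laplace_series f w.
have SA N : series a N.+1 = 1 + \sum_(0 <= k < N.+1) b k * series a (N.+1 - k)%N.
  rewrite /series/= -triangular_sum (eq_big_nat _ _ (fun m _ => aE m)) big_split/=.
  congr (_ + _); rewrite big_nat_recl//= big1 ?addr0// => i _.
have mono_a : nondecreasing_seq (series a).
  by apply: nondecreasing_series => m _ _; exact: a0.
have up N : series a N.+1 <= 1 + series b N.+1 * series a N.+1.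
  rewrite {1}SA lerD2l /series/= mulr_suml; apply: ler_sum_nat => k /andP[_ kN].
  by rewrite ler_wpM2l//; apply: mono_a; exact: leq_subr.
have lo N : 1 + series b N.+1 * series a N.+1 <= series a (N.+1 + N.+1)%N.
  rewrite [in leRHS]addSn [leRHS]SA lerD2l.
  rewrite (@big_cat_nat _ _ _ N.+1)//= ?ltnS ?leq_addr//.
  rewrite -[leLHS]addr0 lerD//.
    rewrite /series/= mulr_suml; apply: ler_sum_nat => k /andP[_ kN].
    by rewrite ler_wpM2l//; apply: mono_a; rewrite -addSn -addnBA ?leq_addr// ltnW.
  rewrite sumr_ge0// => k _; rewrite mulr_ge0// /series/= sumr_ge0//.
have cA : series a n.+1 @[n --> \oo] --> A by rewrite (cvg_shiftS (series a)).
have cB : series b n.+1 @[n --> \oo] --> B by rewrite (cvg_shiftS (series b)).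
have cAA : series a (n.+1 + n.+1)%N @[n --> \oo] --> A.
  apply: (@cvg_comp _ _ _ (fun n => n.+1 + n.+1)%N (series a) _ \oo) => //.
  move=> P [N _ NP]; exists N => // n /= Nn; apply: NP => /=.
  by rewrite (leq_trans Nn)// (leq_trans (leqnSn n))// leq_addr.
have cR : 1 + series b n.+1 * series a n.+1 @[n --> \oo] --> 1 + B * A.
  by apply: cvgD; [exact: cvg_cst|exact: cvgM].
have le1 : A <= 1 + B * A.
  by apply: (ler_cvg_to cA cR); apply: nearW => n; exact: up.
have le2 : 1 + B * A <= A.
  by apply: (ler_cvg_to cR cAA); apply: nearW => n; exact: lo.
have AE : A = 1 + B * A by apply/le_anti/andP.
by rewrite -/A -/B mulrBr mulr1 {1}AE; ring.
Qed.

Lemma sum_upto_le v x y : (forall m, 0 <= v m) -> x <= y ->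
  sum_upto v x <= sum_upto v y.
Proof.
move=> v0 xy; rewrite /sum_upto.
have h : (Num.truncn x <= Num.truncn y)%N by exact: le_truncn.
rewrite [leRHS](@big_cat_nat _ _ _ (Num.truncn x).+1)//= lerDl sumr_ge0//.
Qed.

End laplace_series.

Section exponential_integrals.
Context {R : realType}.
Notation mu := (@lebesgue_measure R).

Lemma is_derive_expRN (r z : R) : 0 < r ->
  is_derive z (1 : R) (fun x : R => - (r^-1 * expR (- (r * x)))) (expR (- (r * z))).
Proof.
move=> r0.
have d1 : is_derive z (1 : R) (fun x : R => - (r * x)) (- r).
  have d0 : is_derive z (1 : R) (fun x : R => r * x) (r *: 1).
    exact: (@is_deriveZ _ _ _ id r).
  by have dn := is_deriveN d0; rewrite /GRing.scale/= mulr1 in dn; exact: dn.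
have d2 : is_derive z (1 : R) (expR \o (fun x : R => - (r * x)))
    (expR (- (r * z)) * - r).
  by apply: is_derive1_comp; exact: is_derive_expR.
have d3 := is_deriveN (is_deriveZ r^-1 d2).
have E : - (r^-1 *: (expR (- (r * z)) * - r)) = expR (- (r * z)).
  by rewrite /GRing.scale/= mulrN mulrN opprK mulrCA mulVf ?mulr1// gt_eqF.
by rewrite E in d3; exact: d3.
Qed.

Lemma integral_expRN_itvcy (r c : R) : 0 < r ->
  (\int[mu]_(y in `[c, +oo[) (expR (- (r * y)))%:E)%E =
  (r^-1 * expR (- (r * c)))%:E.
Proof.
move=> r0.
have ce : continuous (fun y : R => expR (- (r * y))).
  move=> y; apply: continuous_comp; last exact: continuous_expR.
  by apply: cvgN; apply: cvgMr; exact: cvg_id.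
rewrite (@ge0_continuous_FTC2y _ _ (fun x => - (r^-1 * expR (- (r * x)))) _ 0).
- by rewrite sub0e EFinN oppeK.
- by move=> x _; exact: expR_ge0.
- exact: continuous_subspaceT.
- rewrite -oppr0 -(mulr0 r^-1); apply: cvgN; apply: cvgMr.
  apply: (@cvg_comp _ _ _ (fun x => r * x) (fun z => expR (- z)) _ (pinfty_nbhs R)); last exact: cvgr_expR.
  exact: gt0_cvgMry.
- by move=> x _; have := @is_derive_expRN r x r0 => -[].
- by apply: cvgN; apply: cvgMr; apply: cvg_at_right_filter; exact: ce.
- move=> z _; rewrite derive1E; have := @is_derive_expRN r z r0.
  by move=> ?; rewrite derive_val.
Qed.

Lemma integrable_expRN (r : R) : 0 < r ->
  mu.-integrable `[0, +oo[ (EFin \o (fun y : R => expR (- (r * y)))).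
Proof.
move=> r0; apply/integrableP; split.
  apply/measurable_EFinP; apply: measurable_funTS; apply: continuous_measurable_fun.
  move=> y; apply: continuous_comp; last exact: continuous_expR.
  by apply: cvgN; apply: cvgMr; exact: cvg_id.
under eq_integral do rewrite /= ger0_norm ?expR_ge0//.
by rewrite integral_expRN_itvcy// ltry.
Qed.

End exponential_integrals.

(** * The Abelian theorem for the renewal series *)

Section abelian.
Context {R : realType}.
Notation mu := (@lebesgue_measure R).
Variables (u : nat -> R) (alpha : R).
Hypothesis u01 : forall m, 0 <= u m <= 1.
Hypothesis u0 : u 0%N = 1.

Let u_ge0 m : 0 <= u m. Proof. by have /andP[] := u01 m. Qed.

Lemma sum_upto_ge1 x : 1 <= sum_upto u x.
Proof.
rewrite /sum_upto big_nat_recl//= u0 lerDl sumr_ge0// => m _.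
Qed.

Lemma sum_upto_gt0 x : 0 < sum_upto u x.
Proof. exact: lt_le_trans (sum_upto_ge1 x). Qed.

Lemma eseries_sum_upto (x p : R) : 0 <= x -> 0 <= p ->
  (\sum_(m <oo) (u m * ((m%:R <= x)%R%:R * p))%:E)%E = (sum_upto u x * p)%:E.
Proof.
move=> x0 p0; rewrite (@nneseries_split _ _ 0 (Num.truncn x).+1); last first.
  by move=> k _; rewrite lee_fin mulr_ge0// mulr_ge0.
rewrite add0n eseries0 ?adde0; last first.
  move=> i xi _; rewrite (_ : (i%:R <= x) = false) ?mul0r ?mulr0//.
  by apply/negbTE; rewrite -ltNge (lt_le_trans (truncnS_gt x))// ler_nat.
rewrite sumEFin /sum_upto mulr_suml; congr EFin.
apply: eq_big_nat => i /andP[_]; rewrite ltnS => ix.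
by rewrite -truncn_ge_nat// ix mul1r.
Qed.

Lemma measurable_sum_upto (t : R) (D : set R) : 0 <= t ->
  measurable_fun D (fun y => sum_upto u (t * y)).
Proof.
move=> t0; apply: measurable_funTS; apply: nondecreasing_measurable => //.
by move=> x y xy; apply: sum_upto_le => //; rewrite ler_wpM2l.
Qed.

(** Writing e^(-m/t) as the integral of e^(-y) over y >= m/t and exchanging sum and integral
    collects the terms with m <= t y. *)
Lemma laplace_series_integral (t : R) : 0 < t ->
  (laplace_series u t^-1)%:E =
  (\int[mu]_(y in `[0%R, +oo[) (sum_upto u (t * y) * expR (- y))%:E)%E.
Proof.
move=> t0; have it0 : 0 < t^-1 by rewrite invr_gt0.
pose g (m : nat) (y : R) := (u m * ((m%:R <= t * y)%R%:R * expR (- y)))%:E.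
have g0 m y : (0 <= g m y)%E.
  by rewrite lee_fin mulr_ge0// mulr_ge0// expR_ge0.
have mb m : measurable_fun setT (fun y : R => (m%:R <= t * y)%R%:R : R).
  have -> : (fun y : R => (m%:R <= t * y)%R%:R : R) = \1_(`[m%:R / t, +oo[%classic).
    apply/funext => y; rewrite indicE mem_setE in_itv/= andbT.
    by rewrite ler_pdivrMr// (mulrC y).
  exact: measurable_indic.
have me : measurable_fun setT (fun y : R => expR (- y)).
  by apply: measurableT_comp => //; exact: measurable_funN.
have mg m : measurable_fun (`[0%R, +oo[%classic : set R) (g m).
  apply: measurable_funTS; apply/measurable_EFinP.
  by apply: measurable_funM => //; apply: measurable_funM.
transitivity (\int[mu]_(y in `[0%R, +oo[) (\sum_(m <oo) g m y))%E; last first.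
  apply: eq_integral => y; rewrite inE/= in_itv/= andbT => y0.
  by rewrite eseries_sum_upto ?expR_ge0// mulr_ge0// ltW.
rewrite integral_nneseries//.
rewrite /laplace_series -EFin_lim; last exact: laplace_series_cvg.
congr (limn _); apply/funext => n; rewrite /= /series/= -sumEFin.
apply: eq_bigr => m _; rewrite /g.
have mt0 : 0 <= m%:R / t by rewrite divr_ge0// ltW.
under eq_integral do rewrite EFinM.
rewrite ge0_integralZl_EFin//;
  try (by move=> y _; rewrite lee_fin mulr_ge0// expR_ge0);
  try (by apply: measurable_funTS; apply/measurable_EFinP; apply: measurable_funM; [exact: mb|exact: me]).
rewrite EFinM; congr (_ * _)%E.
rewrite (mulrC t^-1).
have := @integral_expRN_itvcy R 1 (m%:R / t) ltr01.
rewrite invr1 !mul1r => <-.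
rewrite [LHS]integral_mkcond [RHS]integral_mkcond; apply: eq_integral => y _.
rewrite !patchE mul1r; case: ifPn => [|].
  rewrite inE/= in_itv/= andbT => y1; rewrite ifT; last first.
    by rewrite inE/= in_itv/= andbT (le_trans mt0).
  by rewrite (mulrC t) -ler_pdivrMr// y1 mul1r.
rewrite notin_setE/= in_itv/= andbT => /negP; rewrite -ltNge => y1.
case: ifPn => // _; rewrite (_ : (_ <= _) = false) ?mul0r//.
by apply/negbTE; rewrite -ltNge (mulrC t) -ltr_pdivlMr.
Qed.

Hypothesis alpha01 : 0 < alpha < 1.
Hypothesis hU : forall lam : R, 0 < lam ->
  sum_upto u (lam * t) / sum_upto u t @[t --> +oo] --> lam `^ alpha.

Lemma sum_upto_doubling : exists2 t0 : R, 0 < t0 &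
  forall t, t0 <= t -> sum_upto u (2 * t) <= 4 * sum_upto u t.
Proof.
have h2 : 2 `^ alpha < 4 :> R.
  have /andP[_ a1] := alpha01.
  apply: (@le_lt_trans _ _ (2 `^ 1)); last by rewrite powRr1//; lra.
  by apply: ler_powR; [lra|exact: ltW].
have := hU (ltr0n _ 2); move/cvgr_lt => /(_ _ h2) [M [_ HM]].
exists (Num.max M 0 + 1) => [|t tM].
  by rewrite ltr_wpDl// le_max lexx orbT.
have /HM/= : M < t.
  apply: lt_le_trans tM; rewrite ltr_pwDr// le_max lexx//.
by rewrite ltr_pdivrMr ?sum_upto_gt0// => /ltW.
Qed.

(** If j is the least exponent with y <= 2^j, then j doublings cost a factor 4^j, which for j > 0 is
    at most 4 y^2. As e^(y/2) >= 1 + y^2/8, the constant 32 suffices, for j = 0 as well. Half of the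
    exponent is spent here; the other half keeps e^(-y) integrable. *)
Lemma sum_upto_dominated : exists2 t0 : R, 0 < t0 &
  forall t y, t0 <= t -> 0 <= y ->
    sum_upto u (t * y) <= 32 * expR (y / 2) * sum_upto u t.
Proof.
have [t0 t00 H] := sum_upto_doubling; exists t0 => // t y tt y0.
have t_gt0 := lt_le_trans t00 tt.
have Hj j : sum_upto u (2 ^+ j * t) <= 4 ^+ j * sum_upto u t.
  elim: j => [|j IH]; first by rewrite !expr0 !mul1r.
  rewrite exprS -mulrA; apply: (le_trans (H _ _)).
    by apply: (le_trans tt); rewrite ler_peMl ?(ltW t_gt0)//; apply: exprn_ege1; rewrite ler1n.
  by rewrite exprS -mulrA ler_wpM2l.
have [j yj jmin] : exists2 j : nat, y <= 2 ^+ j & forall i : nat, (i < j)%N -> 2 ^+ i < y.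
  have ex : exists j : nat, y <= 2 ^+ j.
    exists (Num.truncn y).+1; rewrite (le_trans (ltW (truncnS_gt y)))//.
    by rewrite -natrX ler_nat ltnW// ltn_expl.
  case: (ex_minnP ex) => j yj jm; exists j => // i ij.
  by rewrite ltNge; apply/negP => /jm; rewrite leqNgt ij.
apply: (@le_trans _ _ (4 ^+ j * sum_upto u t)).
  apply: le_trans (Hj j); apply: sum_upto_le => //.
  by rewrite mulrC ler_wpM2r// ltW.
rewrite ler_wpM2r ?ltW ?sum_upto_gt0//.
have e1 := @expR_ge1Dxn R (y / 2) 1 (divr_ge0 y0 (ler0n _ 2)).
rewrite /= in e1; rewrite (_ : 2`!%:R = 2 :> R) in e1; last by [].
case: j yj jmin {Hj} => [|j] yj jmin.
  by rewrite expr0; have := sqr_ge0 (y / 2); lra.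
have := jmin j (ltnSn j) => jy.
have -> : 4 ^+ j.+1 = 4 * (2 ^+ j) ^+ 2 :> R.
  by rewrite exprS -exprM mulnC exprM; congr (_ * _ ^+ _); ring.
have j0 : 0 < 2 ^+ j :> R by rewrite exprn_gt0.
have : (2 ^+ j) ^+ 2 <= y ^+ 2 by rewrite ler_sqr ?nnegrE; lra.
move: e1; rewrite expr_div_n; lra.
Qed.

(* The doubling bound dominates the integrands [e^-y U(t y) / U(t)]. *)
Lemma abelian : exists2 gam : R, 0 < gam &
  laplace_series u t^-1 / sum_upto u t @[t --> +oo] --> gam.
Proof.
have [t0 t00 dom] := sum_upto_dominated.
pose gam := \int[mu]_(y in `[0%R, +oo[) (y `^ alpha * expR (- y)).
have main : laplace_series u t^-1 / sum_upto u t @[t --> +oo] --> gam.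
  apply/cvg_pinftyP => s sy.
  (* Dominated convergence is sequential, so the limit is tested along sequences; raising the terms
     to at least [t0] makes the domination hold for all n and changes finitely many of them. *)
  pose T n := Num.max (s n) t0.
  have T0 n : 0 < T n by rewrite lt_max t00 orbT.
  have sT : \forall n \near \oo, T n = s n.
    move/cvgryPge : sy => /(_ t0); apply: filterS => n; rewrite /T => h.
    by rewrite max_l.
  have Ty : T n @[n --> \oo] --> +oo.
    apply/cvgryPge => A; move/cvgryPge : sy => /(_ A); apply: filterS => n h.
    by rewrite le_max h.
  have : laplace_series u (T n)^-1 / sum_upto u (T n) @[n --> \oo] --> gam; last first.
    apply: cvg_trans; apply: near_eq_cvg.
    by move: sT; apply: filterS => n ->.
  pose F (n : nat) (y : R) := (sum_upto u (T n * y) / sum_upto u (T n) * expR (- y))%:E.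
  pose f (y : R) := (y `^ alpha * expR (- y))%:E.
  pose g (y : R) := (32 * expR (- (2^-1 * y)))%:E.
  have me : measurable_fun setT (fun y : R => expR (- y)).
    by apply: measurableT_comp => //; exact: measurable_funN.
  have mF n : measurable_fun (`[0%R, +oo[%classic : set R) (F n).
    apply/measurable_EFinP; apply: measurable_funM; last exact: measurable_funTS.
    by apply: measurable_funM => //; apply: measurable_sum_upto; exact: ltW.
  have mf : measurable_fun (`[0%R, +oo[%classic : set R) f.
    apply: measurable_funTS; apply/measurable_EFinP; apply: measurable_funM => //.
  have ig : mu.-integrable (`[0%R, +oo[%classic : set R) g.
    apply: (@integrableZl _ _ _ mu _ (measurable_itv _) 32 (EFin \o (fun y => expR (- (2^-1 * y))))).
    by apply: integrable_expRN; rewrite invr_gt0.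
  have [| |iF _ cv] := @dominated_convergence _ _ _ mu _ (measurable_itv (`[0%R, +oo[ : interval R)) F f g mF mf _ ig.
  - exists [set 0]; split => [||y]; [exact: measurable_set1|exact: lebesgue_measure_set1|].
    apply: contra_notP => /= yn0; rewrite in_itv/= andbT => yge0.
    have y0 : 0 < y by rewrite lt_neqAle yge0 andbT; apply/eqP => y0; exact: yn0.
    apply/fine_cvgP; split; first by apply: nearW.
    rewrite /F /f /= /comp/=; apply: cvgMl.
    have := hU y0 => /cvg_pinftyP /(_ T Ty).
    suff -> : (fun n => sum_upto u (T n * y) / sum_upto u (T n)) =
      fun n => sum_upto u (y * T n) / sum_upto u (T n) by [].
    by apply/funext => n; rewrite (mulrC y).
  - apply: aeW => y n; rewrite /= in_itv/= andbT => y0.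
    rewrite lee_fin ger0_norm; last first.
      by rewrite mulr_ge0 ?expR_ge0// divr_ge0// ltW// sum_upto_gt0.
    have h := dom (T n) y _ y0.
    rewrite (_ : - (2^-1 * y) = y / 2 - y); last by field.
    rewrite expRD mulrA ler_wpM2r ?expR_ge0// ler_pdivrMr ?sum_upto_gt0//.
    by apply: h; rewrite le_max lexx orbT.
  have Fint n : (\int[mu]_(y in `[0%R, +oo[) F n y)%E =
      (laplace_series u (T n)^-1 / sum_upto u (T n))%:E.
    rewrite mulrC EFinM laplace_series_integral// -ge0_integralZl_EFin//.
    - by apply: eq_integral => y _; rewrite /F -EFinM; congr EFin; ring.
    - by move=> y _; rewrite lee_fin mulr_ge0 ?expR_ge0// ltW// sum_upto_gt0.
    - apply/measurable_EFinP; apply: measurable_funM; last exact: measurable_funTS.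
      by apply: measurable_sum_upto; exact: ltW.
    - by rewrite invr_ge0 ltW// sum_upto_gt0.
  have E : (\int[mu]_(y in `[0%R, +oo[) f y)%E = gam%:E.
    by rewrite /gam /Rintegral fineK//; exact: integrable_fin_num.
  rewrite E in cv.
  apply: (@fine_cvg _ _ _ _ (fun n => (laplace_series u (T n)^-1 / sum_upto u (T n))%:E) gam).
  by under eq_cvg do rewrite -Fint.
exists gam => //.
apply: (@lt_le_trans _ _ (expR (- 1))); first exact: expR_gt0.
apply: (ler_cvg_to (cvg_cst _) main); near=> t.
rewrite ler_pdivlMr ?sum_upto_gt0//; exact: laplace_series_ge_sum_upto.
Unshelve. all: by end_near. Qed.

End abelian.

Lemma near_comp (T U : Type) (F : set_system T) (G : set_system U) (f : T -> U)
    (P : U -> Prop) : f x @[x --> F] --> G -> (\forall y \near G, P y) ->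
  \forall x \near F, P (f x).
Proof. by move=> fG; exact: fG. Qed.

Lemma exists_between (R : realType) (x y : R) : x < y ->
  exists z : R, x < z < y.
Proof. by move=> xy; exists ((x + y) / 2); rewrite !(midf_lt xy). Qed.

Lemma powRV (R : realType) (x r : R) : 0 <= x -> x^-1 `^ r = x `^ (- r).
Proof. by move=> x0; rewrite -powR_inv1// -powRrM mulN1r. Qed.

Lemma powR_gt1 (R : realType) (y r : R) : 1 < y -> 0 < r -> 1 < y `^ r.
Proof.
move=> y1 r0; have := @gt0_ltr_powR R r r0 1 y.
by rewrite !nnegrE ler01 (ltW (lt_trans ltr01 y1)) powR1 => /(_ isT isT y1).
Qed.

(** * Regular variation at zero and the Tauberian theorem *)

Section regular_variation_at_zero.
Context {R : realType}.
Variables (u f : nat -> R) (alpha : R).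
Hypothesis u01 : forall m, 0 <= u m <= 1.
Hypothesis f01 : forall m, 0 <= f m <= 1.
Hypothesis u0 : u 0%N = 1.
Hypothesis ren :
  forall m, u m = (m == 0%N)%:R + \sum_(0 <= k < m.+1) f k * u (m - k)%N.
Hypothesis alpha01 : 0 < alpha < 1.

Let psi (w : R) := 1 - laplace_series f w.

Lemma laplace_series_ge1 (w : R) : 0 < w -> 1 <= laplace_series u w.
Proof.
move=> w0; apply: le_trans (laplace_series_partial 1 u01 w0).
by rewrite big_nat1 u0 mulr0 oppr0 expR0 mulr1.
Qed.

Lemma laplace_series_gt0 (w : R) : 0 < w -> 0 < laplace_series u w.
Proof. by move=> w0; apply: lt_le_trans (laplace_series_ge1 w0). Qed.

Lemma survival_laplace (w : R) : 0 < w ->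
  1 - laplace_series f w = (laplace_series u w)^-1.
Proof.
move=> w0; have A0 := laplace_series_gt0 w0.
apply: (mulfI (lt0r_neq0 A0)).
by rewrite (renewal_laplace u01 f01 ren w0) mulfV// gt_eqF.
Qed.

Definition regular_laplace : Prop := forall lam : R, 0 < lam ->
  laplace_series u (lam / t) / laplace_series u t^-1 @[t --> +oo] -->
    lam `^ (- alpha).

(** The Abelian limits at the scales t / lam and t are the same number [gam], which cancels in the
    quotient. *)
Lemma regular_laplace_of_sum :
  (forall lam : R, 0 < lam ->
    sum_upto u (lam * t) / sum_upto u t @[t --> +oo] --> lam `^ alpha) ->
  regular_laplace.
Proof.
move=> hU lam lam0; have [gam gam0 hg] := abelian u01 u0 alpha01 hU.
have il0 : 0 < lam^-1 by rewrite invr_gt0.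
have h1 : laplace_series u (lam / t) / sum_upto u (lam^-1 * t) @[t --> +oo] --> gam.
  have : (fun t => laplace_series u t^-1 / sum_upto u t) (lam^-1 * t) @[t --> +oo] --> gam.
    apply: (@cvg_comp _ _ _ (fun t => lam^-1 * t) _ _ (pinfty_nbhs R)) hg.
    exact: gt0_cvgMry.
  by under eq_cvg do rewrite invfM invrK.
have E : lam^-1 `^ alpha = lam `^ (- alpha).
  by rewrite powRV// ltW.
have h2 := hU _ il0; rewrite E in h2.
have h3 : laplace_series u (lam / t) / sum_upto u (lam^-1 * t) *
    (sum_upto u (lam^-1 * t) / sum_upto u t) *
    (laplace_series u t^-1 / sum_upto u t)^-1 @[t --> +oo] -->
    gam * lam `^ (- alpha) / gam.
  apply: cvgM; first exact: cvgM.
  by apply: cvgV => //; exact: lt0r_neq0.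
rewrite mulrAC mulfV ?mul1r ?gt_eqF// in h3.
apply: cvg_trans h3; apply: near_eq_cvg; near=> t.
rewrite /=; have n1 := lt0r_neq0 (sum_upto_gt0 u01 u0 (lam^-1 * t)).
have n2 := lt0r_neq0 (sum_upto_gt0 u01 u0 t).
by field; rewrite n1 n2 gt_eqF// laplace_series_gt0// invr_gt0; near: t; exact: nbhs_pinfty_gt.
Unshelve. all: by end_near. Qed.

(* [phi t] integrates against the renewal measure carried by the points
   exp(-m/t), normalised to total mass one; it is only used for large t. *)
Let phi (t : R) (g : R -> R) : R :=
  limn (series (fun m => u m * expR (- (m%:R / Num.max t 1)) /
    laplace_series u (Num.max t 1)^-1 * g (expR (- (m%:R / Num.max t 1))))).

Let max1_gt0 (t : R) : 0 < Num.max t 1.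
Proof. by rewrite lt_max ltr01 orbT. Qed.

Let phi_cvg t : cvgn (series (fun m => u m * expR (- (m%:R / Num.max t 1)) /
    laplace_series u (Num.max t 1)^-1)).
Proof.
set c := laplace_series _ _; have T0 := max1_gt0 t.
have it0 : 0 < (Num.max t 1)^-1 by rewrite invr_gt0.
rewrite (_ : (fun m => _) =
  c^-1 *: (fun m => u m * expR (- ((Num.max t 1)^-1 * m%:R)))); last first.
  apply/funext => m.
  change (u m * expR (- (m%:R / Num.max t 1)) / c =
    c^-1 * (u m * expR (- ((Num.max t 1)^-1 * m%:R)))).
  by rewrite mulrC (mulrC _^-1 m%:R).
by apply: is_cvg_seriesZ; exact: laplace_series_cvg.
Qed.

Let phi_pf t : positive_functional (phi t).
Proof.
apply: pf_series => [m|m|]; last exact: phi_cvg.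
  have /andP[um _] := u01 m; rewrite divr_ge0 ?mulr_ge0 ?expR_ge0//.
  by rewrite ltW// laplace_series_gt0// invr_gt0.
by apply: expRN_in01; rewrite divr_ge0// ltW.
Qed.

Let phi_moment t k : 1 <= t ->
  phi t (fun y => y ^+ k) = laplace_series u (k.+1%:R / t) / laplace_series u t^-1.
Proof.
move=> t1; rewrite /phi max_l//; set c := laplace_series u t^-1.
have t0 : 0 < t by exact: lt_le_trans t1.
have kt : 0 < k.+1%:R / t by rewrite divr_gt0.
rewrite mulrC; have := lim_seriesZ c^-1 (laplace_series_cvg u01 kt).
rewrite {2}/GRing.scale/= => <-.
congr (limn (series _)); apply/funext => m.
change (u m * expR (- (m%:R / t)) / c * expR (- (m%:R / t)) ^+ k =
  c^-1 * (u m * expR (- (k.+1%:R / t * m%:R)))).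
have -> : - (k.+1%:R / t * m%:R) = - (m%:R / t) + k%:R * - (m%:R / t).
  by rewrite -[k.+1]addn1 natrD; ring.
by rewrite -expRM_natl expRD; ring.
Qed.

Let phi_step t x : 1 <= t -> 0 <= x ->
  phi t (inv_step x) = sum_upto u (x * t) / laplace_series u t^-1.
Proof.
move=> t1 x0; rewrite /phi max_l//; set c := laplace_series u t^-1.
have t0 : 0 < t by exact: lt_le_trans t1.
have E m : u m * expR (- (m%:R / t)) / c * inv_step x (expR (- (m%:R / t))) =
    c^-1 * (u m * (m%:R <= x * t)%R%:R).
  rewrite /inv_step ler_expR lerN2 ler_pdivrMr//; case: ifPn => _; last by rewrite !mulr0.
  by rewrite mulr1 mulrAC mulfK ?gt_eqF ?expR_gt0// mulrC.
under eq_fun do rewrite E.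
apply/cvg_lim => //; apply: cvg_near_cst.
exists (Num.truncn (x * t)).+1 => // N /= NN.
rewrite /series/= -mulr_sumr mulrC; congr (_ / _).
rewrite (@big_cat_nat _ _ _ (Num.truncn (x * t)).+1)//=.
rewrite [X in _ + X]big_nat_cond [X in _ + X]big1 ?addr0; last first.
  move=> m /andP[/andP[h _] _]; rewrite (_ : (_ <= _) = false) ?mulr0//.
  by apply/negbTE; rewrite -ltNge (lt_le_trans (truncnS_gt _))// ler_nat.
apply: eq_big_nat => m /andP[_]; rewrite ltnS => mx.
by rewrite -truncn_ge_nat ?mulr_ge0// ?(ltW t0)// mx mulr1.
Qed.

Hypothesis reg : regular_laplace.

Let moments (k : nat) : R := k.+1%:R `^ (- alpha).

Let phi_moments k : phi t (fun y => y ^+ k) @[t --> +oo] --> moments k.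
Proof.
have := reg (ltr0Sn R k); apply: cvg_trans; apply: near_eq_cvg.
by near=> t; rewrite phi_moment//; near: t; exact: nbhs_pinfty_ge.
Unshelve. all: by end_near. Qed.

Let H (t : R) : R := sum_upto u t / laplace_series u t^-1.

Let H_scale x t : 0 < x -> 1 <= t -> sum_upto u (x * t) / laplace_series u t^-1 =
  H (x * t) * (laplace_series u (x^-1 / t) / laplace_series u t^-1).
Proof.
move=> x0 t1; have t0 : 0 < t by exact: lt_le_trans t1.
have xt : 0 < x * t by rewrite mulr_gt0.
rewrite /H -invfM; field.
by rewrite !gt_eqF// laplace_series_gt0// invr_gt0.
Qed.

Let H_bound : \forall t \near +oo, 0 <= H t <= expR 1.
Proof.
near=> t; have t0 : 0 < t by near: t; exact: nbhs_pinfty_gt.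
have A0 : 0 < laplace_series u t^-1 by rewrite laplace_series_gt0 ?invr_gt0.
rewrite divr_ge0 ?(ltW A0) ?(ltW (sum_upto_gt0 u01 u0 t))//= ler_pdivrMr//.
have := laplace_series_ge_sum_upto u01 t0.
by rewrite -(ler_pM2l (expR_gt0 1)) mulrA -expRD subrr expR0 mul1r.
Unshelve. all: by end_near. Qed.

(** Let H(t) be the ratio in the statement. The levels 1 and lam bound H(t) from above and a
    rescaled H from below by nearly the same L; for lam close to 1 regular variation makes rescaling
    harmless, so H is Cauchy. Then [phi t (inv_step x)] tends to kappa x^alpha, continuous in x, and
    any other family with these moments is squeezed at x = 1 between levels on both sides. *)
Lemma tauberian : exists2 kappa : R, 0 < kappa &
  sum_upto u t / laplace_series u t^-1 @[t --> +oo] --> kappa /\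
  forall Psi : nat -> (R -> R) -> R, (forall j, positive_functional (Psi j)) ->
    (forall k, Psi j (fun y => y ^+ k) @[j --> \oo] --> k.+1%:R `^ (- alpha)) ->
    Psi j (inv_step 1) @[j --> \oo] --> kappa.
Proof.
have FFp : Filter (pinfty_nbhs R) by typeclasses eauto.
have FFn : Filter \oo by typeclasses eauto.
have /andP[al0 al1] := alpha01.
pose E : R := expR 1; have E0 : 0 < E by exact: expR_gt0.
have Hcvg : cvg (H t @[t --> +oo]).
  apply: cauchy_cvg; apply: cauchy_exP => e e0.
  (* As H <= E, replacing H by H (y + e/(8E)) costs at most e/4; [lam] is the change of scale whose
     factor lam^alpha is [y]. *)
  pose y := 1 + e / (8 * E); pose lam := y `^ alpha^-1.
  have y1 : 1 < y by rewrite ltrDl divr_gt0// mulr_gt0.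
  have lam1 : 1 < lam by apply: powR_gt1 => //; rewrite invr_gt0.
  have lam0 : 0 < lam by exact: lt_trans lam1.
  have lamy : lam `^ alpha = y.
    by rewrite -powRrM mulVf ?gt_eqF// powRr1// ltW// (lt_trans ltr01).
  have e8 : 0 < e / 8 by rewrite divr_gt0.
  have eE : 0 < e / (8 * E) by rewrite divr_gt0// mulr_gt0.
  have [L HL] := moments_inv_step moments lam1 e8.
  have {}HL := HL R (pinfty_nbhs R) FFp phi phi_pf phi_moments.
  exists L.
  have up : \forall t \near +oo, H t <= L + e / 8.
    near=> t; have t1 : 1 <= t by near: t; exact: nbhs_pinfty_ge.
    have [+ _] : phi t (inv_step 1) <= L + e / 8 /\ L - e / 8 <= phi t (inv_step lam).
      by near: t.
    by rewrite phi_step// mul1r.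
  have il0 : 0 < lam^-1 by rewrite invr_gt0.
  have fac : \forall t \near +oo,
      laplace_series u (lam^-1 / t) / laplace_series u t^-1 <= y + e / (8 * E).
    have := reg il0; rewrite powRV ?ltW// opprK lamy => /cvgr_le; apply.
    by rewrite ltrDl.
  have lo : \forall t \near +oo, L - e / 8 <= H (lam * t) + e / 8 + e / 8.
    have Hb : \forall t \near +oo, 0 <= H (lam * t) <= E.
      have lamy' : lam * t @[t --> +oo] --> +oo by exact: gt0_cvgMry.
      exact: (near_comp (P := fun s => 0 <= H s <= E) lamy' H_bound).
    near=> t; have t1 : 1 <= t by near: t; exact: nbhs_pinfty_ge.
    have [_] : phi t (inv_step 1) <= L + e / 8 /\ L - e / 8 <= phi t (inv_step lam).
      by near: t.
    rewrite phi_step ?(ltW lam0)// H_scale// => /le_trans; apply.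
    have /andP[Hb0 Hb1] : 0 <= H (lam * t) <= E by near: t.
    apply: (@le_trans _ _ (H (lam * t) * (y + e / (8 * E)))).
      by apply: ler_wpM2l => //; near: t.
    have -> : H (lam * t) * (y + e / (8 * E)) =
        H (lam * t) + H (lam * t) * (e / (8 * E)) + H (lam * t) * (e / (8 * E)).
      by rewrite /y; ring.
    have : H (lam * t) * (e / (8 * E)) <= e / 8.
      apply: (@le_trans _ _ (E * (e / (8 * E)))); first by rewrite ler_wpM2r// ltW.
      by rewrite le_eqVlt; apply/orP; left; apply/eqP; field; rewrite gt_eqF.
    lra.
  have lo' : \forall t \near +oo, L - e / 8 <= H t + e / 8 + e / 8.
    have lamy' : lam^-1 * t @[t --> +oo] --> +oo by exact: gt0_cvgMry.
    near=> t.
    have : L - e / 8 <= H (lam * (lam^-1 * t)) + e / 8 + e / 8.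
      near: t.
      exact: (near_comp (P := fun s => L - e / 8 <= H (lam * s) + e / 8 + e / 8) lamy' lo).
    by rewrite mulrA mulfV ?mul1r// gt_eqF.
  suff : \forall t \near +oo, ball L e (H t) by [].
  near=> t; rewrite /ball/=.
  have h1 : H t <= L + e / 8 by near: t.
  have h2 : L - e / 8 <= H t + e / 8 + e / 8 by near: t.
  by rewrite ltr_norml; apply/andP; split; lra.
pose kappa := lim (H t @[t --> +oo]).
have Hk : H t @[t --> +oo] --> kappa by exact: Hcvg.
have stepk x : 0 < x -> phi t (inv_step x) @[t --> +oo] --> kappa * x `^ alpha.
  move=> x0; have ix0 : 0 < x^-1 by rewrite invr_gt0.
  have c1 : H (x * t) @[t --> +oo] --> kappa.
    by apply: (@cvg_comp _ _ _ (fun t => x * t) H _ (pinfty_nbhs R)) => //; exact: gt0_cvgMry.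
  have c2 := reg ix0.
  have Ex : x^-1 `^ (- alpha) = x `^ alpha.
    by rewrite powRV ?ltW// opprK.
  rewrite Ex in c2.
  have c3 : H (x * t) * (laplace_series u (x^-1 / t) / laplace_series u t^-1)
    @[t --> +oo] --> kappa * x `^ alpha by exact: cvgM.
  apply: cvg_trans c3; apply: near_eq_cvg; near=> t.
  have t1 : 1 <= t by near: t; exact: nbhs_pinfty_ge.
  by rewrite phi_step ?(ltW x0)// H_scale.
(* With e^(-x) = m1/2, the inequality y <= m1/2 + inv_step x y holds on [0, 1]. In the limit it
   reads m1 <= m1/2 + kappa x^alpha, where m1 is the limit of the first moments. *)
have kappa0 : 0 < kappa.
  pose m1 : R := 2 `^ (- alpha).
  have m10 : 0 < m1 by exact: powR_gt0.
  have m11 : m1 < 1.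
    by rewrite /m1 powRN invf_lt1 ?powR_gt0//; apply: powR_gt1 => //; lra.
  pose x := - ln (m1 / 2).
  have x0 : 0 < x by rewrite oppr_gt0 ln_lt0//; lra.
  have del : expR (- x) = m1 / 2 by rewrite opprK lnK// posrE; lra.
  have c1 : phi t (fun y : R => y ^+ 1) @[t --> +oo] --> m1 := @phi_moments 1%N.
  have c0 : phi t (fun y : R => y ^+ 0) @[t --> +oo] --> (1 : R).
    by have := @phi_moments 0%N; rewrite /moments powR1.
  have cx := stepk _ x0.
  have cr : m1 / 2 * phi t (fun y : R => y ^+ 0) + phi t (inv_step x) @[t --> +oo] -->
      m1 / 2 * 1 + kappa * x `^ alpha.
    by apply: cvgD => //; exact: cvgMr.
  have : m1 <= m1 / 2 * 1 + kappa * x `^ alpha.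
    apply: (ler_cvg_to c1 cr); apply: nearW => t.
    have b0 := bounded01X (R := R) 0%N; have bx := bounded01_inv_step x.
    rewrite -(pf_scale (phi_pf t))// -(pf_add (phi_pf t))//; last exact: bounded01Z.
    apply: (pf_le (phi_pf t)); [exact: bounded01X|by apply: bounded01D => //; exact: bounded01Z|].
    move=> y /andP[y0 y1]; rewrite expr1 expr0 mulr1 /inv_step del.
    case: ifPn => h; last by rewrite addr0 ltW// ltNge.
    have yp : 0 < y by apply: lt_le_trans h; lra.
    have : 1 <= y^-1 by rewrite invf_ge1.
    by lra.
  move=> h; have : 0 < kappa * x `^ alpha by lra.
  by rewrite pmulr_lgt0// powR_gt0.
exists kappa => //; split => // Psi pfPsi mPsi.
apply/cvgrPdist_le => e e0.
have e4 : 0 < e / 4 by rewrite divr_gt0.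
pose y := 1 + e / (4 * kappa); pose lam := y `^ alpha^-1.
have y1 : 1 < y by rewrite ltrDl divr_gt0// mulr_gt0.
have lam1 : 1 < lam by apply: powR_gt1 => //; rewrite invr_gt0.
have lam0 : 0 < lam by exact: lt_trans lam1.
have lamy : lam `^ alpha = y.
  by rewrite -powRrM mulVf ?gt_eqF// powRr1// ltW// (lt_trans ltr01).
have il0 : 0 < lam^-1 by rewrite invr_gt0.
have il1 : lam^-1 < 1 by rewrite invf_lt1.
(* [L] bounds [Psi] at level 1 from above and [L'] bounds it from below. The known limits of [phi]
   at the levels lam and 1/lam give L <= kappa + e/2 and L' >= kappa - e/2. *)
have [L HL] := moments_inv_step moments lam1 e4.
have [L' HL'] := moments_inv_step moments il1 e4.
have h1 := HL _ _ FFp _ phi_pf phi_moments.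
have h1' := HL' _ _ FFp _ phi_pf phi_moments.
have {}HL := HL _ _ FFn _ pfPsi mPsi.
have {}HL' := HL' _ _ FFn _ pfPsi mPsi.
have b1 : L - e / 4 <= kappa + e / 4.
  have c := stepk _ lam0; rewrite lamy in c.
  have -> : kappa + e / 4 = kappa * y by rewrite /y; field; rewrite gt_eqF.
  apply: (ler_cvg_to (cvg_cst _) c).
  by move: h1; apply: filterS => t [].
have b2 : kappa - e / 4 <= L' + e / 4.
  have c := stepk _ il0.
  apply: (@le_trans _ _ (kappa * lam^-1 `^ alpha)); last first.
    apply: (ler_cvg_to c (cvg_cst _)).
    by move: h1'; apply: filterS => t [].
  have -> : lam^-1 `^ alpha = y^-1.
    by rewrite powRV ?ltW// powRN lamy.
  have y0 : 0 < y by exact: lt_trans y1.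
  rewrite ler_pdivlMr//.
  have -> : (kappa - e / 4) * y = kappa - (e / 4) * (e / (4 * kappa)).
    by rewrite /y; field; rewrite gt_eqF.
  by rewrite gerBl mulr_ge0 ?divr_ge0 ?mulr_ge0 ?ltW.
near=> j.
have [h2 _] : Psi j (inv_step 1) <= L + e / 4 /\ L - e / 4 <= Psi j (inv_step lam) by near: j.
have [_ h3] : Psi j (inv_step lam^-1) <= L' + e / 4 /\ L' - e / 4 <= Psi j (inv_step 1) by near: j.
rewrite ler_norml; apply/andP; split; lra.
Unshelve. all: by end_near. Qed.

End regular_variation_at_zero.

(** * The powers (1 - v)^n and the exponential *)

Section poisson_limit.
Context {R : realType}.

Lemma bernoulli_le (q : R) j : 1 <= q -> 1 + j%:R * (q - 1) <= q ^+ j.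
Proof.
move=> q1; elim: j => [|j IH]; first by rewrite mul0r addr0 expr0.
rewrite exprS -[j.+1]addn1 natrD.
apply: (@le_trans _ _ (q * (1 + j%:R * (q - 1)))); last by rewrite ler_wpM2l//; lra.
have : 0 <= j%:R * (q - 1) ^+ 2 by rewrite mulr_ge0// sqr_ge0.
lra.
Qed.

(** The companion of 1 - v <= e^(-v): in 1 + x <= e^x take x = v/(1-v), for which 1 + x =
    1/(1-v). *)
Lemma expRN_div_le (v : R) : v < 1 -> expR (- (v / (1 - v))) <= 1 - v.
Proof.
move=> v1; have h : 0 < 1 - v by rewrite subr_gt0.
rewrite expRN -[leRHS]invrK lef_pV2 ?posrE ?invr_gt0 ?expR_gt0//.
apply: le_trans (expR_ge1Dx _).
by rewrite le_eqVlt; apply/orP; left; apply/eqP; field; rewrite gt_eqF.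
Qed.

Lemma cvg_inv_natmul (y : nat -> R) (x : R) : y @ \oo --> x ->
  y n * n%:R^-1 @[n --> \oo] --> 0.
Proof.
move=> yx; rewrite -(mulr0 x); apply: cvgM => //.
by rewrite -(cvg_shiftS (fun n => n%:R^-1 : R)); exact: cvg_harmonic.
Qed.

Lemma cvg_pow_of_mul (v : nat -> R) (x : R) : (forall n, 0 <= v n <= 1) ->
  n%:R * v n @[n --> \oo] --> x -> (1 - v n) ^+ n @[n --> \oo] --> expR (- x).
Proof.
move=> v01 vx.
have v0 : v n @[n --> \oo] --> 0.
  apply: cvg_trans (cvg_inv_natmul vx); apply: near_eq_cvg.
  near=> n; have n0 : (0 < n)%N by near: n; exact: nbhs_infty_gt.
  by rewrite mulrAC mulfV ?mul1r// pnatr_eq0 -lt0n.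
have v1 : 1 - v n @[n --> \oo] --> (1 : R).
  have : 1 - v n @[n --> \oo] --> (1 - 0 : R) by apply: cvgB => //; exact: cvg_cst.
  by rewrite subr0.
have lo : expR (- (n%:R * v n / (1 - v n))) @[n --> \oo] --> expR (- x).
  apply: continuous_cvg; first exact: continuous_expR.
  apply: cvgN; rewrite -[x]divr1; apply: cvgM => //.
  by apply: cvgV => //; exact: oner_neq0.
have up : expR (- (n%:R * v n)) @[n --> \oo] --> expR (- x).
  by apply: continuous_cvg; [exact: continuous_expR|exact: cvgN].
apply: squeeze_cvgr lo up; near=> n.
have v1n : v n < 1 by near: n; apply: (cvgr_lt _ v0); exact: ltr01.
have /andP[vn0 vn1] := v01 n.
apply/andP; split.
  have -> : - (n%:R * v n / (1 - v n)) = n%:R * - (v n / (1 - v n)) by ring.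
  rewrite expRM_natl lerXn2r ?nnegrE ?expR_ge0 ?subr_ge0//.
  exact: expRN_div_le.
rewrite -mulrN expRM_natl lerXn2r ?nnegrE ?expR_ge0 ?subr_ge0//.
exact: expR_ge1Dx.
Unshelve. all: by end_near. Qed.

(** With y_n = -ln (1 - v_n)^n, eventually y_n (1 - v_n) <= n v_n <= y_n. The upper bound comes
    first: it forces v_n to 0, without which the lower bound would be useless. *)
Lemma cvg_mul_of_pow (v : nat -> R) (x : R) : (forall n, 0 <= v n <= 1) ->
  (1 - v n) ^+ n @[n --> \oo] --> expR (- x) -> n%:R * v n @[n --> \oo] --> x.
Proof.
move=> v01 px; pose y n := - ln ((1 - v n) ^+ n).
have yx : y n @[n --> \oo] --> x.
  rewrite -[x]opprK -[- x]expRK; apply: cvgN; apply: continuous_cvg => //.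
  by apply: continuous_ln; exact: expR_gt0.
have pos : \forall n \near \oo, 0 < (1 - v n) ^+ n.
  by apply: (cvgr_gt _ px); exact: expR_gt0.
have up n : 0 < (1 - v n) ^+ n -> n%:R * v n <= y n.
  move=> p0; have /andP[vn0 vn1] := v01 n.
  rewrite /y lerNr -ler_expR lnK ?posrE// -mulrN expRM_natl.
  by rewrite lerXn2r ?nnegrE ?expR_ge0 ?subr_ge0//; exact: expR_ge1Dx.
have v0 : v n @[n --> \oo] --> 0.
  apply: (squeeze_cvgr _ (cvg_cst 0) (cvg_inv_natmul yx)); near=> n.
  have /andP[vn0 vn1] := v01 n; rewrite vn0/=.
  have n0 : (0 < n)%N by near: n; exact: nbhs_infty_gt.
  rewrite ler_pdivlMr ?ltr0n// mulrC; apply: up.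
  by near: n.
apply: (@squeeze_cvgr _ _ _ _ (fun n => y n * (1 - v n)) y) => //.
  near=> n; have p0 : 0 < (1 - v n) ^+ n by near: n.
  rewrite up// andbT; have /andP[vn0 vn1] := v01 n.
  have v1 : v n < 1 by near: n; apply: (cvgr_lt _ v0); exact: ltr01.
  rewrite -ler_pdivlMr ?subr_gt0// lerNl -ler_expR lnK ?posrE//.
  rewrite -mulrA -mulrN expRM_natl lerXn2r ?nnegrE ?expR_ge0 ?subr_ge0//.
  exact: expRN_div_le.
rewrite -[x]mulr1; apply: cvgM => //.
have : 1 - v n @[n --> \oo] --> (1 - 0 : R) by apply: cvgB => //; exact: cvg_cst.
by rewrite subr0.
Unshelve. all: by end_near. Qed.

Lemma cvg_ratio {T : Type} (F : set_system T) {FF : Filter F} (g : T -> R) (l : R) :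
  0 < l -> (forall y, 1 < y -> \forall t \near F, l / y <= g t <= l * y) ->
  g @ F --> l.
Proof.
move=> l0 H; apply/cvgrPdist_le => e e0.
have y1 : 1 < 1 + e / l by rewrite ltrDl divr_gt0.
have y0 : 0 < 1 + e / l by exact: lt_trans y1.
have := H _ y1; apply: filterS => t /andP[h1 h2].
have e1 : l * (1 + e / l) = l + e by field; rewrite gt_eqF.
have e2 : l - e <= l / (1 + e / l).
  rewrite ler_pdivlMr//.
  have -> : (l - e) * (1 + e / l) = l - e * e / l by field; rewrite gt_eqF.
  by rewrite gerBl divr_ge0 ?mulr_ge0// ltW.
rewrite ler_norml; apply/andP; split; lra.
Qed.

End poisson_limit.

(** * Normalizing sequences and regular variation of the Laplace series *)

Section normalizing.
Context {R : realType}.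
Variables (u f : nat -> R) (alpha C : R).
Hypothesis u01 : forall m, 0 <= u m <= 1.
Hypothesis f01 : forall m, 0 <= f m <= 1.
Hypothesis u0 : u 0%N = 1.
Hypothesis ren :
  forall m, u m = (m == 0%N)%:R + \sum_(0 <= k < m.+1) f k * u (m - k)%N.
Hypothesis alpha01 : 0 < alpha < 1.
Hypothesis C0 : 0 < C.

Let A (t : R) := laplace_series u t.
Let A_gt0 (w : R) : 0 < w -> 0 < A w. Proof. exact: laplace_series_gt0. Qed.
Let A_le (w w' : R) : 0 < w -> w <= w' -> A w' <= A w.
Proof. exact: laplace_series_le. Qed.

(** Doubling t multiplies the series by nearly 2^alpha > 1, hence eventually by at least a fixed [q]
    > 1, and it grows geometrically along powers of 2. *)
Lemma regular_laplace_infty : regular_laplace u alpha ->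
  laplace_series u t^-1 @[t --> +oo] --> +oo.
Proof.
move=> reg; have /andP[al0 al1] := alpha01.
have h0 : 0 < 2^-1 :> R by rewrite invr_gt0.
have := reg _ h0; rewrite powRV// opprK => c.
have p1 : 1 < 2 `^ alpha :> R by apply: powR_gt1 => //; lra.
pose q : R := (1 + 2 `^ alpha) / 2.
have q1 : 1 < q by rewrite /q; lra.
have qp : q < 2 `^ alpha by rewrite /q; lra.
have := cvgr_gt _ c _ qp => -[M [_ HM]].
pose t0 := Num.max M 0 + 1.
have t00 : 0 < t0 by rewrite ltr_wpDl// le_max lexx orbT.
have step t : t0 <= t -> q * A t^-1 <= A (2 * t)^-1.
  move=> tt; have tp := lt_le_trans t00 tt.
  have /HM/= : M < t by apply: lt_le_trans tt; rewrite ltr_pwDr// le_max lexx.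
  by rewrite ltr_pdivlMr ?A_gt0 ?invr_gt0// invfM => /ltW.
have pw j : q ^+ j <= A (2 ^+ j * t0)^-1.
  elim: j => [|j IH].
    by rewrite expr0 mul1r; apply: laplace_series_ge1 => //; rewrite invr_gt0.
  rewrite exprS [in leRHS]exprS -mulrA; apply: le_trans (step _ _); last first.
    by rewrite ler_peMl ?(ltW t00)//; apply: exprn_ege1; rewrite ler1n.
  by rewrite ler_wpM2l// ltW// (lt_trans ltr01).
apply/cvgryPge => B.
have [j qj] : exists j, B <= q ^+ j.
  exists (Num.truncn (B / (q - 1))).+1; apply: le_trans (bernoulli_le _ (ltW q1)).
  have : B / (q - 1) <= (Num.truncn (B / (q - 1))).+1%:R by apply/ltW; exact: truncnS_gt.
  by rewrite ler_pdivrMr ?subr_gt0//; lra.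
near=> t; apply: (le_trans qj); apply: (le_trans (pw j)).
have tj : 2 ^+ j * t0 <= t by near: t; exact: (nbhs_pinfty_ge (num_real _)).
have p0 : 0 < 2 ^+ j * t0 by rewrite mulr_gt0// exprn_gt0.
by apply: A_le; rewrite ?invr_gt0 ?(lt_le_trans p0 tj)// lef_pV2 ?posrE// (lt_le_trans p0 tj).
Unshelve. all: by end_near. Qed.

(** The sequence is a generalised inverse: a(n) is the least positive integer m with n <= C A(1/m).
    Minimality gives C A(1/(m-1)) < n, regular variation makes A(1/m) and A(1/(m-1)) comparable, and
    so n is asymptotic to C A(1/a(n)). *)
Lemma normalizing_of_regular : regular_laplace u alpha ->
  exists a : nat -> R, (forall n, 0 < a n) /\
  forall w, 0 < w ->
    n%:R * (1 - laplace_series f (w / a n)) @[n --> \oo] --> C * w `^ alpha.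
Proof.
move=> reg; have Ay := regular_laplace_infty reg.
have ex n : exists m : nat, (0 < m)%N && (n%:R <= C * A m%:R^-1).
  move/cvgryPge : Ay => /(_ (n%:R / C)) [M [_ HM]].
  exists (Num.truncn (Num.max M 0)).+1; rewrite mulrC -ler_pdivrMr//.
  apply: HM => /=; apply: le_lt_trans (truncnS_gt _); by rewrite le_max lexx.
pose m n := ex_minn (ex n).
have mP n : [/\ (0 < m n)%N, n%:R <= C * A (m n)%:R^-1 &
    forall i, (0 < i < m n)%N -> C * A i%:R^-1 < n%:R].
  rewrite /m; case: ex_minnP => k /andP[k0 kn] kmin; split => // i /andP[i0 ik].
  rewrite ltNge; apply/negP => h; have := kmin i; rewrite i0 h/= => /(_ isT).
  by rewrite leqNgt ik.
have m0 n : 0 < (m n)%:R :> R by rewrite ltr0n; have [] := mP n.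
have my : (m n)%:R @[n --> \oo] --> (+oo : set_system R).
  apply/cvgryPge => B; pose b := (Num.truncn (Num.max B 0)).+1.
  near=> n; have nb : C * A b%:R^-1 < n%:R.
    by near: n; exact: nbhs_infty_gtr.
  have Bb : B <= b%:R.
    by apply/ltW; apply: le_lt_trans (truncnS_gt _); rewrite le_max lexx.
  apply: (le_trans Bb); rewrite ler_nat leqNgt; apply/negP => mb.
  have [_ h _] := mP n; move: nb; apply/negP; rewrite -leNgt; apply: (le_trans h).
  rewrite ler_pM2l//; apply: A_le; first by rewrite invr_gt0 ltr0n.
  by rewrite lef_pV2 ?posrE ?m0 ?ltr0n// ler_nat ltnW.
exists (fun n => (m n)%:R); split => //.
have base : n%:R / A (m n)%:R^-1 @[n --> \oo] --> C.
  apply: cvg_ratio => // y y1; have y0 : 0 < y by exact: lt_trans y1.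
  have [z /andP[z1 zy]] := exists_between y1.
  have z0 : 0 < z by exact: lt_trans z1.
  pose lam := z `^ alpha^-1.
  have /andP[al0 al1] := alpha01.
  have lam1 : 1 < lam by apply: powR_gt1 => //; rewrite invr_gt0.
  have lam0 : 0 < lam by exact: lt_trans lam1.
  have lamz : lam `^ (- alpha) = z^-1.
    by rewrite powRN -powRrM mulVf ?gt_eqF// powRr1// ltW.
  have := reg _ lam0; rewrite lamz => c.
  have zy' : y^-1 < z^-1 by rewrite ltf_pV2.
  have cc : \forall n \near \oo,
      y^-1 < laplace_series u (lam / (m n)%:R) / laplace_series u (m n)%:R^-1.
    exact: (near_comp (P := fun s => y^-1 < laplace_series u (lam / s) / laplace_series u s^-1) my (cvgr_gt _ c _ zy')).
  near=> n; have [mn h1 h2] := mP n.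
  have An0 : 0 < A (m n)%:R^-1 by rewrite A_gt0// invr_gt0.
  apply/andP; split; last first.
    rewrite ler_pdivrMr// (le_trans h1)// ler_wpM2r ?(ltW An0)//.
    by rewrite ler_peMr// ltW.
  (* Large enough for 1/(m-1) <= lam/m, which moves the bound at m - 1 to the scale [lam]; it also
     gives m > 1. *)
  have mbig : lam / (lam - 1) + 2 <= (m n)%:R.
    by near: n; move/cvgryPge : my; apply.
  have l10 : 0 < lam - 1 by rewrite subr_gt0.
  have m2 : (1 < m n)%N.
    rewrite -(ltr_nat R); apply: lt_le_trans mbig.
    by rewrite -[ltLHS]add0r ltr_leD ?divr_gt0// ler1n.
  have pm : (m n).-1%:R = (m n)%:R - 1 :> R by rewrite -subn1 natrB.
  have pm0 : 0 < (m n).-1%:R :> R by rewrite ltr0n -ltnS (prednK mn).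
  have /h2 h3 : (0 < (m n).-1 < m n)%N by rewrite ltn_predL mn andbT -ltnS (prednK mn).
  have h4 : A (lam / (m n)%:R) <= A (m n).-1%:R^-1.
    apply: A_le; first by rewrite invr_gt0.
    rewrite ler_pdivlMr// mulrC ler_pdivrMr// pm.
    have : lam / (lam - 1) <= (m n)%:R - 2 by lra.
    by rewrite ler_pdivrMr// => *; nra.
  apply: (@le_trans _ _ (C * (A (lam / (m n)%:R) / A (m n)%:R^-1))).
    by rewrite ler_pM2l// ltW//; near: n.
  rewrite mulrA ler_pM2r ?invr_gt0// ltW//; apply: le_lt_trans h3.
  by rewrite ler_pM2l.
move=> w w0; have cw := reg _ w0.
have c1 : laplace_series u (w / (m n)%:R) / laplace_series u (m n)%:R^-1
    @[n --> \oo] --> w `^ (- alpha).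
  by apply: (cvg_comp _ _ my cw).
have c2 : n%:R / A (m n)%:R^-1 *
    (laplace_series u (w / (m n)%:R) / laplace_series u (m n)%:R^-1)^-1
    @[n --> \oo] --> C * (w `^ (- alpha))^-1.
  by apply: cvgM => //; apply: cvgV => //; rewrite gt_eqF// powR_gt0.
rewrite -powRN opprK in c2.
apply: cvg_trans c2; apply: near_eq_cvg; apply: nearW => n /=.
have a1 : 0 < (m n)%:R^-1 :> R by rewrite invr_gt0.
have a2 : 0 < w / (m n)%:R by rewrite divr_gt0.
rewrite (survival_laplace u01 f01 u0 ren a2) /A.
by field; rewrite !gt_eqF ?A_gt0.
Unshelve. all: by end_near. Qed.

(** The hypothesis speaks of the points a(n) only. A real t is reached through N(t), the integer
    part of A(1/t): both N / A(1/t) and N / A(w0 / a(N)) tend to 1, and monotonicity of A then makes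
    1/t comparable to w0 / a(N). *)
Lemma regular_of_normalizing (a : nat -> R) : (forall n, (0 < n)%N -> 0 < a n) ->
  (forall w, 0 < w ->
    n%:R * (1 - laplace_series f (w / a n)) @[n --> \oo] --> C * w `^ alpha) ->
  regular_laplace u alpha.
Proof.
move=> a0 ha; have /andP[al0 al1] := alpha01.
have hA w : 0 < w -> n%:R / A (w / a n) @[n --> \oo] --> C * w `^ alpha.
  move=> w0; apply: cvg_trans (ha _ w0); apply: near_eq_cvg; near=> n.
  have n0 : (0 < n)%N by near: n; exact: nbhs_infty_gt.
  by rewrite (survival_laplace u01 f01 u0 ren)// divr_gt0// a0.
have Ay : A t^-1 @[t --> +oo] --> +oo.
  apply/cvgryPge => B.
  have c1 := hA _ ltr01; rewrite powR1 mulr1 in c1.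
  have C1 : C < C + 1 by rewrite ltrDl.
  have [N _ HN] := cvgr_lt _ c1 _ C1.
  pose n := maxn N (Num.truncn (Num.max B 0 * (C + 1))).+1.
  have n0 : (0 < n)%N by rewrite /n; lia.
  have Nn : (N <= n)%N by rewrite /n; lia.
  have := HN n Nn; rewrite /= ltr_pdivrMr ?A_gt0 ?divr_gt0 ?a0// => h.
  have Bn : Num.max B 0 * (C + 1) <= n%:R.
    apply: (@le_trans _ _ (Num.truncn (Num.max B 0 * (C + 1))).+1%:R).
      by apply/ltW; exact: truncnS_gt.
    by rewrite ler_nat /n; lia.
  have C10 : 0 < C + 1 by rewrite addr_gt0.
  have BA : B <= A (1 / a n).
    apply: (@le_trans _ _ (Num.max B 0)); first by rewrite le_max lexx.
    by rewrite -(ler_pM2r C10) (le_trans Bn)// mulrC ltW.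
  near=> t; apply: (le_trans BA).
  have ta : a n <= t by near: t; exact: (nbhs_pinfty_ge (num_real _)).
  have t0 : 0 < t by apply: lt_le_trans ta; exact: a0.
  by apply: A_le; rewrite ?invr_gt0// div1r lef_pV2 ?posrE// a0.
pose N t := Num.truncn (A t^-1).
have Ny : N t @[t --> +oo] --> \oo.
  move=> P [k _ kP]; rewrite /nbhs/=.
  near=> t; apply: kP => /=; rewrite truncn_ge_nat.
    by near: t; move/cvgryPge : Ay; apply.
  by apply/ltW/A_gt0; rewrite invr_gt0; near: t; exact: nbhs_pinfty_gt.
have Nle t : 0 < t -> (N t)%:R <= A t^-1.
  by move=> t0; rewrite truncn_le//; apply/ltW/A_gt0; rewrite invr_gt0.
have N1 : (N t)%:R / A t^-1 @[t --> +oo] --> (1 : R).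
  apply: cvg_ratio => // y y1; have y0 : 0 < y by exact: lt_trans y1.
  near=> t; have t0 : 0 < t by near: t; exact: nbhs_pinfty_gt.
  have At : 0 < A t^-1 by rewrite A_gt0 ?invr_gt0.
  apply/andP; split; last first.
    rewrite mul1r ler_pdivrMr// (le_trans (Nle _ t0))// ler_peMl ?(ltW At)//.
    exact: ltW.
  rewrite mul1r ler_pdivlMr// mulrC ler_pdivrMr//.
  have h : A t^-1 < (N t)%:R + 1 by rewrite natr1; exact: truncnS_gt.
  have : (y - 1)^-1 + 1 <= A t^-1 by near: t; move/cvgryPge : Ay; apply.
  have y10 : 0 < y - 1 by rewrite subr_gt0.
  move=> h2; have h3 : (y - 1)^-1 <= (N t)%:R by lra.
  have : 1 <= (N t)%:R * (y - 1) by rewrite -ler_pdivrMr// div1r.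
  nra.
(* The solution of C w0^alpha = 1, so that n / A(w0 / a(n)) has the same limit 1 as N(t) /
   A(1/t). *)
pose w0 := C `^ (- alpha^-1).
have w00 : 0 < w0 by exact: powR_gt0.
have Cw0 : C * w0 `^ alpha = 1.
  by rewrite -powRrM mulNr mulVf ?gt_eqF// powRN powRr1 ?mulfV ?gt_eqF// ltW.
(* [a (N t)] is asymptotic to [w0 * t]. *)
have key lam : 0 < lam -> (N t)%:R / A (lam / t) @[t --> +oo] --> lam `^ alpha.
  move=> lam0; apply: cvg_ratio => [|y y1]; first exact: powR_gt0.
  have y0 : 0 < y by exact: lt_trans y1.
  have [z /andP[z1 zy]] := exists_between y1.
  have z0 : 0 < z by exact: lt_trans z1.
  pose q := z `^ alpha^-1.
  have q1 : 1 < q by apply: powR_gt1 => //; rewrite invr_gt0.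
  have q0 : 0 < q by exact: lt_trans q1.
  have qz : q `^ alpha = z by rewrite -powRrM mulVf ?gt_eqF// powRr1// ltW.
  have w20 : 0 < w0 * q by rewrite mulr_gt0.
  have w10 : 0 < w0 / q by rewrite divr_gt0.
  have c2 := hA _ w20; have c1 := hA _ w10.
  have E2 : C * (w0 * q) `^ alpha = z by rewrite powRM ?ltW// mulrA Cw0 mul1r qz.
  have E1 : C * (w0 / q) `^ alpha = z^-1.
    by rewrite powRM ?invr_ge0 ?ltW// mulrA Cw0 mul1r powRV ?ltW// powRN qz.
  rewrite E2 in c2; rewrite E1 in c1.
  have b2 : \forall t \near +oo, 1 < (N t)%:R / A (w0 * q / a (N t)).
    exact: (near_comp (P := fun n => 1 < n%:R / A (w0 * q / a n)) Ny (cvgr_gt _ c2 _ z1)).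
  have zi1 : z^-1 < 1 by rewrite invf_lt1.
  have [zm /andP[zmz zm1]] := exists_between zi1.
  have b1 : \forall t \near +oo, (N t)%:R / A (w0 / q / a (N t)) < zm.
    exact: (near_comp (P := fun n => n%:R / A (w0 / q / a n) < zm) Ny (cvgr_lt _ c1 _ zmz)).
  have b0 : \forall t \near +oo, zm < (N t)%:R / A t^-1.
    exact: cvgr_gt N1 _ zm1.
  have d20 : 0 < lam * (w0 * q) by rewrite mulr_gt0.
  have d10 : 0 < lam * (w0 / q) by rewrite mulr_gt0.
  have e2 := hA _ d20; have e1 := hA _ d10.
  have F2 : C * (lam * (w0 * q)) `^ alpha = lam `^ alpha * z.
    by rewrite powRM ?ltW// mulrCA E2.
  have F1 : C * (lam * (w0 / q)) `^ alpha = lam `^ alpha / z.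
    by rewrite powRM ?ltW// mulrCA E1.
  rewrite F2 in e2; rewrite F1 in e1.
  have lz : lam `^ alpha * z < lam `^ alpha * y by rewrite ltr_pM2l// powR_gt0.
  have lz' : lam `^ alpha / y < lam `^ alpha / z.
    by rewrite ltr_pM2l ?powR_gt0// ltf_pV2.
  have g2 : \forall t \near +oo, (N t)%:R / A (lam * (w0 * q) / a (N t)) < lam `^ alpha * y.
    exact: (near_comp (P := fun n => n%:R / A (lam * (w0 * q) / a n) < lam `^ alpha * y) Ny (cvgr_lt _ e2 _ lz)).
  have g1 : \forall t \near +oo, lam `^ alpha / y < (N t)%:R / A (lam * (w0 / q) / a (N t)).
    exact: (near_comp (P := fun n => lam `^ alpha / y < n%:R / A (lam * (w0 / q) / a n)) Ny (cvgr_gt _ e1 _ lz')).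
  near=> t; have t0 : 0 < t by near: t; exact: nbhs_pinfty_gt.
  have NP : (0 < N t)%N by near: t; exact: (near_comp Ny (nbhs_infty_gt 0)).
  have aN := a0 _ NP; have NR : 0 < (N t)%:R :> R by rewrite ltr0n.
  (* Were 1/t larger, then N <= A(1/t) <= A(w0 q / a(N)), although the ratio N / A(w0 q / a(N)) has
     a limit z > 1. *)
  have le2 : t^-1 <= w0 * q / a (N t).
    rewrite leNgt; apply/negP => h.
    have : 1 < (N t)%:R / A (w0 * q / a (N t)) by near: t; exact: b2.
    apply/negP; rewrite -leNgt ler_pdivrMr ?A_gt0 ?divr_gt0// mul1r.
    apply: (le_trans (Nle _ t0)); apply: A_le; rewrite ?divr_gt0//; exact: ltW.
  have le1 : w0 / q / a (N t) <= t^-1.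
    rewrite leNgt; apply/negP => h.
    have h1 : (N t)%:R / A (w0 / q / a (N t)) < zm by near: t; exact: b1.
    have h0 : zm < (N t)%:R / A t^-1 by near: t; exact: b0.
    move: (lt_trans h1 h0); rewrite ltr_pM2l// ltf_pV2 ?posrE ?A_gt0 ?divr_gt0 ?invr_gt0//.
    by rewrite ltNge => /negP; apply; apply: A_le; rewrite ?invr_gt0//; exact: ltW.
  have h1 : lam `^ alpha / y < (N t)%:R / A (lam * (w0 / q) / a (N t)) by near: t; exact: g1.
  have h2 : (N t)%:R / A (lam * (w0 * q) / a (N t)) < lam `^ alpha * y by near: t; exact: g2.
  have lt0 : 0 < lam / t by rewrite divr_gt0.
  apply/andP; split.
    apply: (le_trans (ltW h1)); rewrite ler_pM2l// lef_pV2 ?posrE ?A_gt0 ?divr_gt0//.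
    by apply: A_le; rewrite ?divr_gt0// -!mulrA ler_pM2l// mulrA.
  apply: le_trans (ltW h2); rewrite ler_pM2l// lef_pV2 ?posrE ?A_gt0 ?divr_gt0//.
  by apply: A_le => //; rewrite -!mulrA ler_pM2l// mulrA.
move=> lam lam0; have k1 := key _ lam0.
have k2 : (N t)%:R / A t^-1 * ((N t)%:R / A (lam / t))^-1 @[t --> +oo] -->
    1 * (lam `^ alpha)^-1.
  by apply: cvgM => //; apply: cvgV => //; rewrite gt_eqF// powR_gt0.
rewrite mul1r -powRN in k2.
apply: cvg_trans k2; apply: near_eq_cvg; near=> t.
have t0 : 0 < t by near: t; exact: nbhs_pinfty_gt.
have NP : (0 < N t)%N by near: t; exact: (near_comp Ny (nbhs_infty_gt 0)).
have NR : (N t)%:R != 0 :> R by rewrite pnatr_eq0 -lt0n.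
rewrite /A; field; rewrite NR !gt_eqF ?A_gt0 ?divr_gt0 ?invr_gt0//.
Unshelve. all: by end_near. Qed.

End normalizing.

(** * Independence *)

Lemma integrable_sum_seq d (W : measurableType d) (R : realType)
    (mu : {measure set W -> \bar R}) (D : set W) (I : Type) (r : seq I) (F : I -> W -> R) :
  measurable D -> (forall k, mu.-integrable D (EFin \o F k)) ->
  mu.-integrable D (EFin \o (fun w => \sum_(k <- r) F k w)) /\
  \int[mu]_(w in D) (\sum_(k <- r) F k w) = \sum_(k <- r) \int[mu]_(w in D) F k w.
Proof.
move=> mD iF; elim: r => [|i r [i1 i2]].
  split.
    by under eq_fun do rewrite /= big_nil; exact: integrable0.
  by under eq_Rintegral do rewrite big_nil; rewrite big_nil /Rintegral integral0.
have E w : \sum_(k <- i :: r) F k w = F i w + \sum_(k <- r) F k w by rewrite big_cons.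
split; first by under eq_fun do rewrite /= E; exact: (integrableD mD (iF i) i1).
under eq_Rintegral do rewrite E.
by rewrite RintegralD// i2 big_cons.
Qed.

Section independence.
Context {d} {W : measurableType d} {R : realType} (Q : probability W R).

Let near_unit (x y z : R) :
  x <= y -> y <= x + z -> 0 <= y -> y <= 1 -> z <= 1 -> `|x| <= 2.
Proof. by move=> xy yxz y0 y1 z1; rewrite ler_norml; apply/andP; split; lra. Qed.

Let squeeze (x y z p q : R) : z <= x -> x <= z + p -> z <= y -> y <= z + q ->
  0 <= p -> 0 <= q -> `|x - y| <= p + q.
Proof. by move=> *; rewrite ler_norml; apply/andP; split; lra. Qed.

(* A bounded function f is within 1/n of the simple function that averages the
   indicators of the n level sets {f >= k/n}. *)
Lemma integral_indicator_extend (g X : W -> R) (h : R -> R) (M c : R) :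
  measurable_fun setT g -> measurable_fun setT X -> measurable_fun setT h ->
  (forall w, 0 <= g w <= M) -> (forall y, 0 <= h y <= 1) ->
  (forall B, measurable B -> \int[Q]_(w in X @^-1` B) g w =
     c * fine (Q (X @^-1` B))) ->
  \int[Q]_w (g w * h (X w)) = c * \int[Q]_w h (X w).
Proof.
move=> mg mX mh g0 h01 H.
have gM w : `|g w| <= M by have /andP[? ?] := g0 w; rewrite ger0_norm.
have mhX : measurable_fun setT (fun w => h (X w)) by exact: measurableT_comp.
have hX1 w : `|h (X w)| <= 1 by have /andP[? ?] := h01 (X w); rewrite ger0_norm.
have M0 : 0 <= M by have /andP[? ?] := g0 point; apply: (@le_trans _ _ (g point)).
have ig := bounded_integrable Q mg gM.
pose B (n k : nat) : set R := h @^-1` `[k.+1%:R / n.+1%:R, +oo[%classic.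
have mB n k : measurable (B n k).
  by rewrite -[X in measurable X]setTI; apply: mh => //; exact: measurable_itv.
have mXB n k : measurable (X @^-1` B n k).
  by rewrite -[X in measurable X]setTI; exact: mX.
pose s n w : R := \sum_(k < n.+1) n.+1%:R^-1 * \1_(X @^-1` B n k) w.
have sh n w : s n w <= h (X w) <= s n w + n.+1%:R^-1.
  have n0 : 0 < n.+1%:R :> R by rewrite ltr0n.
  have /andP[h0 h1] := h01 (X w).
  pose t := Num.truncn (n.+1%:R * h (X w)).
  have nh0 : 0 <= n.+1%:R * h (X w) by rewrite mulr_ge0// ltW.
  have tn : (t <= n.+1)%N.
    by rewrite -(ler_nat R); apply: (@le_trans _ _ (n.+1%:R * h (X w))); rewrite ?truncn_le// ler_piMr// ltW.
  have -> : s n w = t%:R / n.+1%:R.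
    have E k : \1_(X @^-1` B n k) w = (k < t)%N%:R :> R.
      rewrite indicE; congr (nat_of_bool _)%:R; apply/idP/idP.
        rewrite inE /B /= in_itv/= andbT ler_pdivrMr// mulrC.
        by rewrite -truncn_ge_nat.
      by rewrite inE /B /= in_itv/= andbT ler_pdivrMr// mulrC -truncn_ge_nat.
    rewrite /s; under eq_bigr do rewrite E.
    rewrite -mulr_sumr mulrC; congr (_ / _).
    rewrite -(big_mkord xpredT (fun k => (k < t)%N%:R)) -natr_sum; congr _%:R.
    rewrite (@big_cat_nat _ _ _ t)//= [X in (_ + X)%N]big_nat_cond [X in (_ + X)%N]big1 ?addn0.
      rewrite (eq_big_nat _ _ (F2 := fun=> 1%N)) ?sum_nat_const_nat ?muln1 ?subn0//.
      by move=> k /andP[_ ->].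
    by move=> k /andP[/andP[tk _] _]; rewrite ltnNge tk.
  have l1 : t%:R <= n.+1%:R * h (X w) by rewrite truncn_le.
  have l2 := truncnS_gt (n.+1%:R * h (X w)).
  apply/andP; split; first by rewrite ler_pdivrMr// mulrC.
  by rewrite -[X in _ + X]div1r -mulrDl ler_pdivlMr// mulrC natr1 ltW.
have is_ n : Q.-integrable setT (EFin \o s n).
  apply: (@bounded_integrable _ _ _ Q _ 2).
    by apply: measurable_sum => k; apply: measurable_funM.
  move=> w; have /andP[s1 s2] := sh n w; have /andP[h0 h1] := h01 (X w).
  have n1 : n.+1%:R^-1 <= 1 :> R by rewrite invf_le1 ?ltr0n// ler1n.
  exact: near_unit s1 s2 h0 h1 n1.
have igs n : Q.-integrable setT (EFin \o (fun w => g w * s n w)).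
  apply: (@bounded_integrable _ _ _ Q _ (M * 2)).
    by apply: measurable_funM => //; apply: measurable_sum => k; apply: measurable_funM.
  move=> w; have /andP[s1 s2] := sh n w; have /andP[h0 h1] := h01 (X w).
  have n1 : n.+1%:R^-1 <= 1 :> R by rewrite invf_le1 ?ltr0n// ler1n.
  by rewrite normrM ler_pM// (near_unit s1 s2 h0 h1 n1).
have ih : Q.-integrable setT (EFin \o (fun w => h (X w))) by exact: (bounded_integrable Q mhX hX1).
have igh : Q.-integrable setT (EFin \o (fun w => g w * h (X w))).
  apply: (@bounded_integrable _ _ _ Q _ (M * 1)); first exact: measurable_funM.
  by move=> w; rewrite normrM ler_pM.
have indE (D : set W) (f : W -> R) : \int[Q]_(w in D) f w = \int[Q]_w (f w * \1_D w).
  rewrite Rintegral_mkcond; apply: eq_Rintegral => w _.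
  by rewrite patchE indicE; case: ifP => _; rewrite ?mulr1 ?mulr0.
have iind (f : W -> R) n k : measurable_fun setT f -> (forall w, `|f w| <= M + 1) ->
    Q.-integrable setT (EFin \o (fun w => f w * \1_(X @^-1` B n k) w)).
  move=> mf fM; apply: (@bounded_integrable _ _ _ Q _ ((M + 1) * 1)).
    by apply: measurable_funM => //; exact: measurable_indic.
  by move=> w; rewrite normrM ler_pM// indicE; case: (_ \in _); rewrite ?normr1 ?normr0.
have lin (f : W -> R) n : measurable_fun setT f -> (forall w, `|f w| <= M + 1) ->
    \int[Q]_w (f w * s n w) =
    \sum_(k < n.+1) n.+1%:R^-1 * \int[Q]_(w in X @^-1` B n k) f w.
  move=> mf fM; under eq_bigr do rewrite indE -RintegralZl ?(iind f)//.
  have iF k : Q.-integrable setT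
      (EFin \o (fun w => n.+1%:R^-1 * (f w * \1_(X @^-1` B n k) w))).
    exact: (integrableZl measurableT n.+1%:R^-1 (iind f n k mf fM)).
  have [_ <-] := integrable_sum_seq (index_enum 'I_n.+1) measurableT (fun k => iF k).
  apply: eq_Rintegral => w _; rewrite /s mulr_sumr; apply: eq_bigr => k _; ring.
have eqs n : \int[Q]_w (g w * s n w) = c * \int[Q]_w s n w.
  have -> : \int[Q]_w s n w = \int[Q]_w (1 * s n w).
    by apply: eq_Rintegral => w _; rewrite mul1r.
  rewrite (lin g n) ?(lin (fun=> 1) n)//; last 2 first.
  - by move=> w; rewrite normr1 lerDr.
  - by move=> w; rewrite (le_trans (gM w))// lerDl.
  rewrite mulr_sumr; apply: eq_bigr => k _.
  by rewrite H// Rintegral_cst// mul1r mulrCA.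
have icst (r : R) : Q.-integrable setT (EFin \o (fun=> r)).
  exact: (bounded_integrable Q (f := fun=> r) (M := `|r|)).
have up n : \int[Q]_w (g w * h (X w)) <= \int[Q]_w (g w * s n w) + M / n.+1%:R.
  rewrite -[M / _](expectation1 Q) -RintegralD//.
  apply: le_Rintegral => //.
    exact: (integrableD measurableT (igs n) (icst (M / n.+1%:R))).
  move=> w _; have /andP[s1 s2] := sh n w; have /andP[g1 g2] := g0 w.
  apply: (@le_trans _ _ (g w * (s n w + n.+1%:R^-1))); first exact: ler_wpM2l.
  by rewrite mulrDr lerD2l ler_wpM2r// invr_ge0.
have lo n : \int[Q]_w (g w * s n w) <= \int[Q]_w (g w * h (X w)).
  apply: le_Rintegral => // w _; have /andP[s1 s2] := sh n w; have /andP[g1 g2] := g0 w.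
  exact: ler_wpM2l.
have up' n : \int[Q]_w h (X w) <= \int[Q]_w s n w + n.+1%:R^-1.
  rewrite -[X in _ <= _ + X](expectation1 Q) -RintegralD//.
  apply: le_Rintegral => //.
    exact: (integrableD measurableT (is_ n) (icst n.+1%:R^-1)).
  by move=> w _; have /andP[] := sh n w.
have lo' n : \int[Q]_w s n w <= \int[Q]_w h (X w).
  by apply: le_Rintegral => // w _; have /andP[] := sh n w.
have c0 : 0 <= c.
  have := H setT measurableT; rewrite preimage_setT probability_setT/= mulr1 => <-.
  by apply: Rintegral_ge0 => w _; have /andP[] := g0 w.
have bnd n : `|\int[Q]_w (g w * h (X w)) - c * \int[Q]_w h (X w)| <= (M + c) / n.+1%:R.
  have h1 := up n; have h2 := lo n; rewrite eqs in h1 h2.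
  have h3 := ler_wpM2l c0 (up' n); have h4 := ler_wpM2l c0 (lo' n).
  rewrite mulrDr in h3.
  have Mn : 0 <= M / n.+1%:R by rewrite divr_ge0.
  have cn : 0 <= c / n.+1%:R by rewrite divr_ge0.
  rewrite mulrDl; exact: squeeze h2 h1 h4 h3 Mn cn.
apply/eqP; rewrite -subr_eq0 -normr_le0; apply/ler_addgt0Pl => e e0; rewrite addr0.
pose n := Num.truncn ((M + c) / e).
apply: (le_trans (bnd n)); rewrite ler_pdivrMr// mulrC -ler_pdivrMr//.
by apply/ltW; exact: truncnS_gt.
Qed.

(** Independence is given for events. The factors are turned into functions one at a time: the
    induction on m treats the first m factors as functions and keeps arbitrary events for the
    others, so that the next factor can be extended from indicators. *)
Lemma expectation_prod_indep (X : nat -> W -> R) (h : R -> R) :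
  (forall i, measurable_fun setT (X i)) -> measurable_fun setT h ->
  (forall y, 0 <= h y <= 1) -> mutually_independent Q X -> forall n,
  \int[Q]_w \prod_(i < n) h (X i w) = \prod_(i < n) \int[Q]_w h (X i w).
Proof.
move=> mX mh h01 ind n.
have mXB i (B : set R) : measurable B -> measurable (X i @^-1` B).
  by move=> mB; rewrite -[X in measurable X]setTI; exact: mX.
have p01 m w : 0 <= \prod_(i < m) h (X i w) <= 1.
  apply/andP; split; first by apply: prodr_ge0 => i _; have /andP[] := h01 (X i w).
  by apply: prodr_ile1 => i _; exact: h01.
have mp m : measurable_fun setT (fun w => \prod_(i < m) h (X i w)).
  by apply: measurable_prod => i _; exact: measurableT_comp.
pose E m n (B : nat -> set R) := \bigcap_(i in [set i | (m <= i < n)%N]) (X i @^-1` B i).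
have mE m k (B : nat -> set R) : (forall i, measurable (B i)) -> measurable (E m k B).
  by move=> mB; apply: bigcap_measurableType => i _; exact: mXB.
have QE m k (B : nat -> set R) : (forall i, measurable (B i)) ->
    fine (Q (E m k B)) = \prod_(m <= i < k) fine (Q (X i @^-1` B i)).
  move=> mB; pose J := finmap.seq_fset tt (index_iota m k).
  have := ind J B mB; set S := (X in \bigcap_(i in X) _).
  have -> : S = [set i | (m <= i < k)%N].
    by apply/seteqP; split => i /=; rewrite /S /= finmap.seq_fsetE mem_index_iota.
  rewrite -/(E m k B) => ->.
  rewrite (perm_big (index_iota m k)); last first.
    apply: uniq_perm; [exact: finmap.fset_uniq|exact: iota_uniq|move=> i].
    exact: (finmap.seq_fsetE tt (index_iota m k) i).
  have fin i : Q (X i @^-1` B i) \is a fin_num.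
    by apply: fin_num_measure; exact: mXB.
  suff : (\prod_(m <= i < k) Q (X i @^-1` B i) =
      (\prod_(m <= i < k) fine (Q (X i @^-1` B i)))%:E)%E by move=> ->.
  elim: (index_iota m k) => [|i l IH]; first by rewrite !big_nil.
  by rewrite !big_cons IH EFinM fineK.
have key m : (m <= n)%N -> forall B, (forall i, measurable (B i)) ->
    \int[Q]_(w in E m n B) \prod_(i < m) h (X i w) =
    (\prod_(i < m) \int[Q]_w h (X i w)) * fine (Q (E m n B)).
  elim: m => [|m IH] mn B mB.
    rewrite big_ord0 mul1r; under eq_Rintegral do rewrite big_ord0.
    by rewrite Rintegral_cst ?mul1r//; exact: mE.
  have indE (D : set W) (f : W -> R) : \int[Q]_(w in D) f w = \int[Q]_w (f w * \1_D w).
    rewrite Rintegral_mkcond; apply: eq_Rintegral => w _.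
    by rewrite patchE indicE; case: ifP => _; rewrite ?mulr1 ?mulr0.
  pose g w : R := \prod_(i < m) h (X i w) * \1_(E m.+1 n B) w.
  pose c := (\prod_(i < m) \int[Q]_w h (X i w)) * fine (Q (E m.+1 n B)).
  rewrite indE big_ord_recr/=.
  transitivity (\int[Q]_w (g w * h (X m w))).
    by apply: eq_Rintegral => w _; rewrite /g big_ord_recr/=; ring.
  rewrite (@integral_indicator_extend g (X m) h 1 c) //.
  - by rewrite /c; ring.
  - by apply: measurable_funM => //; apply: measurable_indic; exact: mE.
  - move=> w; have /andP[p1 p2] := p01 m w; rewrite /g indicE.
    by case: (_ \in _); rewrite ?mulr1 ?mulr0 ?p1 ?lexx ?ler01.
  move=> C mC; pose B' i := if i == m then C else B i.
  have mB' i : measurable (B' i) by rewrite /B'; case: ifP.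
  have := IH (ltnW mn) B' mB'.
  have EE : E m n B' = X m @^-1` C `&` E m.+1 n B.
    apply/seteqP; split => [w Ew|w [Cw Ew] i /= /andP[mi i_n]].
      split; first by have := Ew m; rewrite /= leqnn mn /B' eqxx; apply.
      move=> i /= /andP[mi i_n]; have := Ew i; rewrite /= (ltnW mi) i_n /B'.
      by rewrite gtn_eqF// => /(_ isT).
    move: mi; rewrite leq_eqVlt => /orP[/eqP <-|mi]; first by rewrite /B' eqxx.
    by rewrite /B' gtn_eqF//; apply: Ew; rewrite /= mi.
  have EQ : fine (Q (E m n B')) = fine (Q (X m @^-1` C)) * fine (Q (E m.+1 n B)).
    rewrite !QE// big_ltn// {1}/B' eqxx; congr (_ * _).
    by apply: eq_big_nat => i /andP[mi _]; rewrite /B' gtn_eqF.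
  rewrite EQ EE => IH'; rewrite indE.
  transitivity (\int[Q]_(w in X m @^-1` C `&` E m.+1 n B) \prod_(i < m) h (X i w)).
    rewrite [RHS]indE; apply: eq_Rintegral => w _; rewrite /g -mulrA; congr (_ * _).
    by rewrite !indicE -natrM mulnb in_setI andbC.
  by rewrite IH' /c; ring.
have := key n (leqnn n) (fun=> setT) (fun=> measurableT).
rewrite (_ : E n n _ = setT); last first.
  by apply/seteqP; split => // w _ i /= /andP[ni]; rewrite ltnNge ni.
by rewrite probability_setT/= mulr1.
Qed.

End independence.

(** * Regeneration of the Markov chain *)

Section countable_partition.
Context {d} {T : measurableType d} {R : realType} (mu : {measure set T -> \bar R}).
Context {U : countType}.

Lemma measurable_fibers (h : T -> U) (V : set U) :
  (forall w, measurable [set x | h x = w]) -> measurable (h @^-1` V).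
Proof.
move=> mh; have -> : h @^-1` V = \bigcup_(w in V) [set x | h x = w].
  by apply/seteqP; split => [x Vx|x [w Vw /= ->]] //; exists (h x).
rewrite (_ : \bigcup_(w in V) _ = \bigcup_n (if @unpickle U n is Some w then
    if `[< V w >] then [set x | h x = w] else set0 else set0)).
  apply: bigcup_measurable => n _; case: (unpickle n) => // w.
  by case: asboolP.
apply/seteqP; split => [x [w Vw hw]|x [n _]].
  by exists (pickle w) => //; rewrite pickleK; case: asboolP.
by case: (unpickle n) => // w; case: asboolP => // Vw hw; exists w.
Qed.

Lemma measure_fibers (h : T -> U) (V : set U) (B : set T) :
  (forall w, measurable [set x | h x = w]) -> measurable B ->
  mu (h @^-1` V `&` B) = (\sum_(n <oo)
    (if unpickle n is Some w then
       if `[< pickle (w : U) = n /\ V w >] then mu ([set x | h x = w] `&` B) else 0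
     else 0))%E.
Proof.
move=> mh mB.
(* Several codes may decode to the same value; the test [pickle w = n] retains one code for each
   fibre, which makes the union disjoint. *)
pose F (n : nat) : set T := if @unpickle U n is Some w then
  if `[< pickle w = n /\ V w >] then [set x | h x = w] `&` B else set0 else set0.
have FE : h @^-1` V `&` B = \bigcup_n F n.
  apply/seteqP; split => [x [Vx Bx]|x [n _]]; rewrite /F.
    by exists (pickle (h x)) => //; rewrite pickleK ifT//; apply/asboolP.
  by case: (unpickle n) => // w; case: asboolP => // -[_ Vw] [hw Bx]; split=> //; rewrite /preimage/= hw.
have mF n : measurable (F n).
  by rewrite /F; case: (unpickle n) => // w; case: asboolP => // _; exact: measurableI.
rewrite FE measure_semi_bigcup//; last 2 first.
- apply/trivIsetP => i j _ _ ij; rewrite -subset0 => x []; rewrite /F.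
  case: (unpickle i) => // w; case: asboolP => // -[wi _] [/= hw _].
  case: (unpickle j) => // w'; case: asboolP => // -[wj _] [/= hw' _].
  by move: ij; rewrite -wi -wj -hw -hw' eqxx.
- exact: bigcup_measurable.
apply: eq_eseriesr => n _; rewrite /F.
by case: (unpickle n) => [w|]; [case: asboolP => _|]; rewrite ?measure0.
Qed.

Lemma measure_fibers_scale (h : T -> U) (V : set U) (B1 B2 : set T) (k : R) :
  (forall w, measurable [set x | h x = w]) -> measurable B1 -> measurable B2 ->
  (forall w, V w -> mu ([set x | h x = w] `&` B1) =
                    (k%:E * mu ([set x | h x = w] `&` B2))%E) ->
  mu (h @^-1` V `&` B1) = (k%:E * mu (h @^-1` V `&` B2))%E.
Proof.
move=> mh m1 m2 H; rewrite !measure_fibers// -nneseriesZl; last first.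
  by move=> n _; case: (unpickle n) => // w; case: ifP.
apply: eq_eseriesr => n _; case: (unpickle n) => [w|]; last by rewrite mule0.
by case: asboolP => [[_ Vw]|_]; [exact: H|rewrite mule0].
Qed.

End countable_partition.

Section markov_renewal.
Context {R : realType} {A : countType} (a : A).
Variables (P : A -> A -> R) (pi : A -> R).
Variable rho : {measure set (Paths a) -> \bar R}.
Hypothesis mk : markov_measure P pi rho.
Hypothesis inv : invariant_measure rho (left_shift a).
Hypothesis rhoA : rho (state_set a) = 1%E.

Local Notation T := (Paths a).

Definition path_shift (n : nat) : T -> T := iter n (left_shift a).

Lemma shiftE n x i : path_shift n x i = x (i + n%:Z).
Proof.
elim: n i => [|n IH] i; first by rewrite addr0.
by rewrite /path_shift iterS /left_shift -/(path_shift n x) IH -addrA -intS.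
Qed.

Lemma shiftD m n x : path_shift m (path_shift n x) = path_shift (m + n) x.
Proof. by rewrite /path_shift iterD. Qed.

Lemma measurable_coordinate i b : measurable [set x : T | x i = b].
Proof. by apply: sub_sigma_algebra; exists i, b. Qed.

Lemma measurable_state : measurable (state_set a).
Proof. exact: measurable_coordinate. Qed.

Lemma measurable_left_shift : measurable_fun setT (left_shift a).
Proof.
apply: (@measurability _ _ _ _ setT (left_shift a) (coordinate_sets a)) => //.
move=> _ [_ [i [b ->]] <-]; rewrite setTI.
by apply: (@sub_sigma_algebra _ setT); exists (i + 1), b.
Qed.

Lemma measurable_shift n : measurable_fun setT (path_shift n).
Proof.
elim: n => [|n IH]; first exact: measurable_id.
apply: (@measurableT_comp _ _ _ _ _ _ (left_shift a)) => //.
exact: measurable_left_shift.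
Qed.

Lemma measurable_shift_preimage n (B : set T) : measurable B ->
  measurable (path_shift n @^-1` B).
Proof. by move=> mB; rewrite -[X in measurable X]setTI; exact: measurable_shift. Qed.

Lemma shift_invariant n (B : set T) : measurable B -> rho (path_shift n @^-1` B) = rho B.
Proof.
elim: n B => // n IH B mB.
have -> : path_shift n.+1 @^-1` B = path_shift n @^-1` (left_shift a @^-1` B) by [].
by rewrite IH ?inv// -[X in measurable X]setTI; exact: measurable_left_shift.
Qed.

Definition word (k : nat) (x : T) : seq A := [seq x i%:Z | i <- iota 0 k.+1].

Lemma size_word k x : size (word k x) = k.+1.
Proof. by rewrite size_map size_iota. Qed.

Lemma nth_word b k x i : (i <= k)%N -> nth b (word k x) i = x i%:Z.
Proof. by move=> ik; rewrite (nth_map 0%N) ?size_iota// nth_iota. Qed.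

Lemma word_eqP k x (b : A) (s : seq A) : size s = k ->
  word k x = b :: s <-> forall i : nat, (i <= k)%N -> x i%:Z = nth b (b :: s) i.
Proof.
move=> sk; split => [E i ik|E]; first by rewrite -E nth_word.
apply: (@eq_from_nth _ b); first by rewrite size_word /= sk.
by move=> i; rewrite size_word ltnS => ik; rewrite nth_word// E.
Qed.

Lemma measurable_word k w : measurable [set x | word k x = w].
Proof.
case: w => [|b s].
  rewrite (_ : [set _ | _] = set0)// -subset0 => x /= E.
  by have := size_word k x; rewrite E.
have [sk|sk] := eqVneq (size s) k; last first.
  rewrite (_ : [set _ | _] = set0)// -subset0 => x /= E.
  by have := size_word k x; rewrite E /= => -[sk']; rewrite sk' eqxx in sk.
rewrite (_ : [set _ | _] = \bigcap_(i in `I_k.+1) [set x : T | x i%:Z = nth b (b :: s) i]).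
  by apply: bigcap_measurableType => i _; exact: measurable_coordinate.
apply/seteqP; split => [x /= /(word_eqP _ _ sk) E i ik|x E]; first by apply: E; rewrite -ltnS.
by apply/(word_eqP _ _ sk) => i ik; apply: E; rewrite /= ltnS.
Qed.

Fixpoint path_weight (b : A) (s : seq A) : R :=
  if s is c :: s' then P b c * path_weight c s' else 1.

Lemma path_weight_prod d b s :
  \prod_(i < size s) P (nth d (b :: s) i) (nth d s i) = path_weight b s.
Proof.
elim: s b => [|c s IH] b; first by rewrite big_ord0.
by rewrite /= big_ord_recl/= -(IH c).
Qed.

Lemma path_weight_cat b s s' :
  path_weight b (s ++ s') = path_weight b s * path_weight (last b s) s'.
Proof. by elim: s b => [|c s IH] b /=; rewrite ?mul1r// IH mulrA. Qed.

Lemma rho_word k b s : size s = k ->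
  rho [set x | word k x = b :: s] = (pi b * path_weight b s)%:E.
Proof.
move=> sk; rewrite -(path_weight_prod b) -(mk 0 b s); congr (rho _).
apply/seteqP; split => x /=.
  by move=> /(word_eqP _ _ sk) E i; rewrite sk add0r; exact: E.
by move=> E; apply/(word_eqP _ _ sk) => i; rewrite -{1}sk => /E; rewrite add0r.
Qed.

Lemma pi_base : pi a = 1.
Proof.
apply: EFin_inj; rewrite -rhoA -[pi a]mulr1 -(@rho_word 0 a [::])//.
congr (rho _); apply/seteqP; split => x; rewrite /word /= /state_set/=; first by case.
by move=> ->.
Qed.

(** Restricting to the coordinates 0, ..., k splits such an event into countably many words of known
    weight. Ending at the state gives it mass at most 1, whatever the total mass of rho. *)
Definition past (k : nat) (D : set T) : Prop :=
  (forall x y : T, (forall i : nat, (i <= k)%N -> x i%:Z = y i%:Z) -> D x -> D y) /\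
  (forall x, D x -> x k%:Z = a).

Definition finite_horizon (l : nat) (E : set T) : Prop :=
  (forall x y : T, (forall i : nat, (i <= l)%N -> x i%:Z = y i%:Z) -> E x -> E y) /\
  (forall x, E x -> x 0 = a).

Lemma word_inj k x y : word k x = word k y ->
  forall i : nat, (i <= k)%N -> x i%:Z = y i%:Z.
Proof. by move=> E i ik; rewrite -(nth_word (x 0) x ik) E nth_word. Qed.

Lemma word_preimage k (D : set T) :
  (forall x y : T, (forall i : nat, (i <= k)%N -> x i%:Z = y i%:Z) -> D x -> D y) ->
  D = word k @^-1` (word k @` D).
Proof.
move=> H; apply/seteqP; split => [x Dx|x [y Dy E]]; first by exists x.
by apply: H Dy; exact: word_inj.
Qed.

Lemma past_measurable k D : past k D -> measurable D.
Proof.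
by move=> [/word_preimage -> _]; apply: measurable_fibers; exact: measurable_word.
Qed.

Lemma finite_horizon_measurable k D : finite_horizon k D -> measurable D.
Proof.
by move=> [/word_preimage -> _]; apply: measurable_fibers; exact: measurable_word.
Qed.

Lemma past_le1 k D : past k D -> (rho D <= 1)%E.
Proof.
move=> pD; rewrite -rhoA -(shift_invariant k measurable_state).
apply: le_measure; rewrite ?inE; [exact: past_measurable pD| |].
  by apply: measurable_shift_preimage; exact: measurable_state.
by move=> x /(pD.2 x) xk; rewrite /state_set/= shiftE add0r.
Qed.

Lemma le1_fin_num (D : set T) : (rho D <= 1)%E -> rho D \is a fin_num.
Proof. by move=> h; rewrite ge0_fin_numE// (le_lt_trans h)// ltry. Qed.

(** The Markov property at a visit, as a property of the future event. It survives prefixing an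
    excursion and countable disjoint unions, which is how the joint law of successive returns is
    built. *)
Definition regenerative (E : set T) : Prop :=
  [/\ measurable E, E `<=` state_set a &
  forall k D, past k D -> rho (D `&` path_shift k @^-1` E) = (rho D * rho E)%E].

Lemma word_cat k l x : word (k + l) x = word k x ++ behead (word l (path_shift k x)).
Proof.
apply: (@eq_from_nth _ a).
  by rewrite size_cat size_behead !size_word /= addSn.
move=> i; rewrite size_word ltnS => ikl; rewrite nth_word// nth_cat size_word ltnS.
case: leqP => ik; first by rewrite nth_word.
by rewrite nth_behead nth_word ?shiftE; [congr x; lia|lia].
Qed.

(** The weight of a word splits at the letter where past and future meet. The future part lacks its
    initial weight, but that letter is the base state, whose weight is 1. Summation over words
    extends the product formula first to the past event, then to the future one. *)
Lemma regenerative_horizon l E : finite_horizon l E -> regenerative E.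
Proof.
move=> hE; split; [exact: finite_horizon_measurable hE|by move=> x /(hE.2 x)|].
move=> k D pD.
have mE := finite_horizon_measurable hE; have mD := past_measurable pD.
have fD := le1_fin_num (past_le1 pD).
have word_word w w' : (exists2 x, D x & word k x = w) ->
    (exists2 x, E x & word l x = w') ->
    rho ([set x | word k x = w] `&` path_shift k @^-1` [set x | word l x = w']) =
    (rho [set x | word k x = w] * rho [set x | word l x = w'])%E.
  move=> [x Dx <-] [y Ey <-].
  have xk := pD.2 x Dx; have y0 := hE.2 y Ey.
  have Ey' : word l y = a :: behead (word l y) by rewrite /word /= y0.
  have Ex' : word k x = x 0 :: behead (word k x) by rewrite /word.
  have sx : size (behead (word k x)) = k by rewrite size_behead size_word.
  have sy : size (behead (word l y)) = l by rewrite size_behead size_word.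
  have lx : last (x 0) (behead (word k x)) = a.
    have -> : last (x 0) (behead (word k x)) = last (x 0) (word k x) by rewrite Ex'.
    by rewrite (last_nth (x 0)) size_word /= nth_word.
  have -> : [set z | word k z = word k x] `&` path_shift k @^-1` [set z | word l z = word l y] =
      [set z | word (k + l) z = x 0 :: (behead (word k x) ++ behead (word l y))].
    apply/seteqP; split => z /=.
      by move=> [zx zy]; rewrite word_cat zx zy {1}Ex'.
    rewrite word_cat -cat_cons -Ex' => /eqP; rewrite eqseq_cat ?size_word// => /andP[/eqP zx /eqP zy].
    split=> //; have : word l (path_shift k z) = z k%:Z :: behead (word l (path_shift k z)).
      by rewrite /word /= shiftE add0r.
    by move=> ->; rewrite zy Ey'; congr (_ :: _); rewrite -(nth_word a z (leqnn k)) zx nth_word.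
  rewrite rho_word ?size_cat ?sx ?sy// path_weight_cat lx.
  by rewrite {1}Ex' rho_word// Ey' rho_word// pi_base mul1r -EFinM mulrA.
have step w' : (exists2 x, E x & word l x = w') ->
    rho (D `&` path_shift k @^-1` [set x | word l x = w']) =
    (rho D * rho [set x | word l x = w'])%E.
  move=> Ew'; have fw : rho [set x | word l x = w'] \is a fin_num.
    case: Ew' => y Ey <-; have Ey' : word l y = a :: behead (word l y) by rewrite /word /= (hE.2 y Ey).
    by rewrite Ey' rho_word// size_behead size_word.
  rewrite -(fineK fw) muleC -[in RHS](setIT D) (word_preimage pD.1).
  apply: measure_fibers_scale => //.
  - exact: measurable_word.
  - by apply: measurable_shift_preimage; exact: measurable_word.
  - by move=> w Vw; rewrite setIT word_word// fineK// muleC.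
rewrite setIC -(fineK fD) -[in RHS](shift_invariant k mE) -[in RHS](setIT (_ @^-1` _)).
rewrite (word_preimage hE.1) -comp_preimage.
apply: measure_fibers_scale => //.
- by move=> w; exact: (measurable_shift_preimage k (measurable_word l w)).
- move=> w Ew; rewrite setIT setIC fineK//.
  rewrite (_ : [set x | _] = path_shift k @^-1` [set x | word l x = w])// step//.
  by rewrite shift_invariant//; exact: measurable_word.
Qed.

Lemma regenerative_state : regenerative (state_set a).
Proof.
apply: (@regenerative_horizon 0); split => // x y xy.
by rewrite /state_set/= -[0]/(0%N%:Z) (xy 0%N).
Qed.

Lemma regenerative_step j G E : past j G -> G `<=` state_set a -> regenerative E ->
  regenerative (G `&` path_shift j @^-1` E) /\
  rho (G `&` path_shift j @^-1` E) = (rho G * rho E)%E.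
Proof.
move=> pG Ga [mE Ea rE]; have mG := past_measurable pG.
have GE := rE j G pG; split=> //; split.
- by apply: measurableI => //; exact: measurable_shift_preimage.
- by move=> x [/Ga].
- move=> k D pD.
  have hG : finite_horizon j G by split; [exact: pG.1|exact: Ga].
  have pDG : past (k + j) (D `&` path_shift k @^-1` G).
    split => [x y xy [Dx Gx]|x [_ Gx]].
      split; first by apply: pD.1 Dx => i ik; apply: xy; rewrite (leq_trans ik)// leq_addr.
      apply: pG.1 Gx => i ij; rewrite !shiftE -PoszD; apply: xy.
      by rewrite addnC leq_add2l.
    by have := pG.2 _ Gx; rewrite shiftE -PoszD addnC.
  rewrite preimage_setI setIA -comp_preimage.
  rewrite (_ : (path_shift j \o path_shift k) = path_shift (k + j)); last first.
    by apply/funext => x /=; rewrite shiftD addnC.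
  rewrite (rE _ _ pDG) GE muleA; congr (_ * _)%E.
  by have [_ _] := regenerative_horizon hG; apply.
Qed.

Lemma regenerative_bigcup (E : nat -> set T) : trivIset setT E ->
  (forall n, regenerative (E n)) -> regenerative (\bigcup_n E n).
Proof.
move=> tE rE; have mE n : measurable (E n) by case: (rE n).
split; [exact: bigcup_measurable|by move=> x [n _]; case: (rE n) => _ + _; apply|].
move=> k D pD; have mD := past_measurable pD.
have fD := le1_fin_num (past_le1 pD).
rewrite (measure_semi_bigcup rho)//; last exact: bigcup_measurable.
rewrite -(fineK fD) -nneseriesZl// preimage_bigcup setI_bigcupr.
rewrite measure_semi_bigcup//.
- by apply: eq_eseriesr => n _; have [_ _ ->] := rE n; rewrite ?fineK.
- by move=> n; apply: measurableI => //; exact: measurable_shift_preimage.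
- move/trivIsetP : tE => tE; apply/trivIsetP => i j _ _ ij.
  rewrite -subset0 => x [[_ Ei] [_ Ej]].
  by have := tE i j I I ij; rewrite -subset0 => /(_ (path_shift k x)); apply.
- by apply: bigcup_measurable => n _; apply: measurableI => //; exact: measurable_shift_preimage.
Qed.

End markov_renewal.

(** * First returns, excursions and the renewal equation *)

Section first_return.
Context {R : realType} {A : countType} (a : A).
Variables (P : A -> A -> R) (pi : A -> R).
Variable rho : {measure set (Paths a) -> \bar R}.
Hypothesis mk : markov_measure P pi rho.
Hypothesis inv : invariant_measure rho (left_shift a).
Hypothesis rhoA : rho (state_set a) = 1%E.

Local Notation T := (Paths a).
Local Notation path_shift := (path_shift (a := a)).

Definition first_return (k : nat) : set T :=
  [set x | [/\ (0 < k)%N, x k%:Z = a & forall i : nat, (0 < i < k)%N -> x i%:Z <> a]].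

Definition excursion (k : nat) : set T := state_set a `&` first_return k.

Definition visits (m : nat) : set T := state_set a `&` [set x : T | x m%:Z = a].

Definition return_prob (k : nat) : R := fine (rho (excursion k)).

Definition renewal_prob (m : nat) : R := fine (rho (visits m)).

Lemma first_return_inj k l (x : T) : first_return k x -> first_return l x -> k = l.
Proof.
move=> [k0 xk hk] [l0 xl hl]; case: (ltngtP k l) => // kl.
  by case: (hl k); rewrite ?k0.
by case: (hk l); rewrite ?l0.
Qed.

Lemma first_return_exists (x : T) m : (0 < m)%N -> x m%:Z = a ->
  exists2 k, (k <= m)%N & first_return k x.
Proof.
move=> m0 xm; have ex : exists k : nat, (0 < k)%N && (x k%:Z == a).
  by exists m; rewrite m0 xm eqxx.
case: (ex_minnP ex) => k /andP[k0 /eqP xk] kmin; exists k; first by apply: kmin; rewrite m0 xm eqxx.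
split => // i /andP[i0 ik] xi; have := kmin i; rewrite i0 xi eqxx => /(_ isT).
by rewrite leqNgt ik.
Qed.

Lemma past_excursion k : past k (excursion k).
Proof.
split => [x y xy [x0 [k0 xk h]]|x [_ []]//].
split; first by rewrite /state_set/= -[0]/(0%N%:Z) -(xy 0%N).
split=> //; first by rewrite -xy.
by move=> i /andP[i0 ik]; rewrite -xy ?(ltnW ik)//; apply: h; rewrite i0.
Qed.

Lemma past_visits k : past k (visits k).
Proof.
split => [x y xy [x0 xk]|x []//].
by split; [rewrite /state_set/= -[0]/(0%N%:Z) -(xy 0%N)|rewrite /= -xy].
Qed.

Lemma horizon_visits k : finite_horizon k (visits k).
Proof. by split; [exact: (past_visits k).1|move=> x []]. Qed.

Lemma excursion0 : excursion 0 = set0.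
Proof. by rewrite -subset0 => x [_ []]. Qed.

Lemma trivIset_excursion (B : nat -> set T) :
  trivIset setT (fun k => excursion k `&` B k).
Proof.
apply/trivIsetP => i j _ _ ij; rewrite -subset0 => x [[[_ xi] _] [[_ xj] _]].
by move: ij; rewrite (first_return_inj xi xj) eqxx.
Qed.

Lemma measurable_excursion k : measurable (excursion k).
Proof. exact: past_measurable (past_excursion k). Qed.

Lemma measurable_visits k : measurable (visits k).
Proof. exact: past_measurable (past_visits k). Qed.

Lemma excursion_le1 k : (rho (excursion k) <= 1)%E.
Proof. exact: (past_le1 inv rhoA (past_excursion k)). Qed.

Lemma visits_le1 k : (rho (visits k) <= 1)%E.
Proof. exact: (past_le1 inv rhoA (past_visits k)). Qed.

Lemma return_probE k : (return_prob k)%:E = rho (excursion k).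
Proof. by rewrite fineK// le1_fin_num// excursion_le1. Qed.

Lemma renewal_probE k : (renewal_prob k)%:E = rho (visits k).
Proof. by rewrite fineK// le1_fin_num// visits_le1. Qed.

Lemma return_prob01 k : 0 <= return_prob k <= 1.
Proof. by rewrite fine_ge0//= -lee_fin return_probE excursion_le1. Qed.

Lemma renewal_prob01 k : 0 <= renewal_prob k <= 1.
Proof. by rewrite fine_ge0//= -lee_fin renewal_probE visits_le1. Qed.

Lemma return_prob0 : return_prob 0 = 0.
Proof. by rewrite /return_prob excursion0 measure0. Qed.

Lemma renewal_prob0 : renewal_prob 0 = 1.
Proof.
apply: EFin_inj; rewrite renewal_probE -rhoA; congr (rho _).
by apply/seteqP; split => [x []|x x0].
Qed.

Lemma regenerative_visits k : regenerative rho (visits k).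
Proof. exact: (regenerative_horizon mk inv rhoA (horizon_visits k)). Qed.

Lemma renewal_equation m : renewal_prob m =
  (m == 0%N)%:R + \sum_(0 <= k < m.+1) return_prob k * renewal_prob (m - k).
Proof.
case: m => [|m].
  by rewrite big_nat1 return_prob0 mul0r addr0 renewal_prob0.
rewrite add0r; apply: EFin_inj; rewrite renewal_probE -sumEFin big_mkord.
pose F k := excursion k `&` path_shift k @^-1` visits (m.+1 - k).
have -> : visits m.+1 = \big[setU/set0]_(k < m.+2) F k.
  rewrite -bigcup_mkord; apply/seteqP; split => [x [x0 xm]|x [k /= km [[x0 [k0 xk _]] [_]]]].
    have [k km rk] := first_return_exists (ltn0Sn m) xm.
    exists k; first by rewrite /= ltnS.
    split=> //; split; rewrite /state_set/= shiftE ?add0r; first by case: rk.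
    by rewrite -PoszD subnK.
  by rewrite /= shiftE -PoszD subnK// => xm; split.
rewrite measure_bigsetU//; last 2 first.
- move=> k; apply: measurableI; first exact: measurable_excursion.
  by apply: measurable_shift_preimage; exact: measurable_visits.
- exact: trivIset_excursion.
apply: eq_bigr => k _; rewrite EFinM return_probE renewal_probE.
by have [_ _] := regenerative_visits (m.+1 - k); apply; exact: past_excursion.
Qed.

Lemma rho_two_visits j k : (j <= k)%N ->
  rho (state_set a `&` [set x : T | x j%:Z = a] `&` [set x : T | x k%:Z = a]) =
  (renewal_prob j * renewal_prob (k - j))%:E.
Proof.
move=> jk; rewrite EFinM !renewal_probE.
have [_ _ vis] := regenerative_visits (k - j); rewrite -(vis _ _ (past_visits j)).
congr (rho _); apply/seteqP; split => x /=.
  move=> [[x0 xj] xk]; split=> //; split; rewrite /state_set/= shiftE ?add0r//.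
  by rewrite -PoszD subnK.
by move=> [[x0 xj] [_]]; rewrite /= shiftE -PoszD subnK.
Qed.

Hypothesis cons : conservative rho (left_shift a).

Definition never : set T := state_set a `&` [set x | forall k, ~ first_return k x].

Lemma measurable_never : measurable never.
Proof.
have -> : never =
    state_set a `\` \bigcup_k excursion k.
  apply/seteqP; split => x [x0 h]; split => //; first by move=> [k _ [_]]; exact: h.
  by move=> k rk; apply: h; exists k.
apply: measurableD; first exact: measurable_state.
by apply: bigcup_measurable => k _; exact: measurable_excursion.
Qed.

(** The preimages of [never] are disjoint: a path in the i-th and the j-th, i < j, would visit the
    state at time i without coming back, yet visit it again at time j. *)
Lemma rho_never : rho never = 0%E.
Proof.
apply: cons; first exact: measurable_never.
apply/trivIsetP => i j _ _; wlog ij : i j / (i < j)%N.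
  move=> W ij; case: (ltngtP i j) => [h|h|h]; [exact: W| |by rewrite h eqxx in ij].
  by rewrite setIC; apply: W => //; rewrite eq_sym.
move=> _; rewrite -subset0 => x [[_ h] [xj _]].
have := @first_return_exists (path_shift i x) (j - i); rewrite subn_gt0 ij shiftE => /(_ isT).
rewrite -PoszD subnK ?(ltnW ij)//.
have xj' : x j%:Z = a by move: xj; rewrite /state_set/= -[iter j _ _]/(path_shift j x) shiftE add0r.
by move=> /(_ xj') [k _ rk]; exact: (h k).
Qed.

Lemma return_prob_sum : (\sum_(k <oo) (return_prob k)%:E = 1)%E.
Proof.
under eq_eseriesr do rewrite return_probE.
rewrite -measure_semi_bigcup//; last 3 first.
- exact: measurable_excursion.
- rewrite (_ : excursion = fun k => excursion k `&` setT); first exact: trivIset_excursion.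
  by apply/funext => k; rewrite setIT.
- by apply: bigcup_measurable => k _; exact: measurable_excursion.
have mE : measurable (\bigcup_k excursion k).
  by apply: bigcup_measurable => k _; exact: measurable_excursion.
rewrite -rhoA (_ : state_set a = (\bigcup_k excursion k) `|` never); last first.
  apply/seteqP; split => [x x0|x [[k _ []]|[]]//].
  have [[k rk]|h] := pselect (exists k, first_return k x); first by left; exists k.
  by right; split => // k rk; apply: h; exists k.
rewrite measureU//; last 2 first.
- exact: measurable_never.
- by rewrite -subset0 => x [[k _ [_ rk]] [_ h]]; exact: (h k).
by rewrite [X in (_ + X)%E](_ : _ = 0%E) ?adde0//; exact: rho_never.
Qed.

(** The value 0 marks a path that does not return; [induced] leaves such a path where it is. *)
Definition return_count_time (x : T) : nat := xget 0%N [set k | first_return k x].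

Lemma return_count_timeE k x : first_return k x -> return_count_time x = k.
Proof.
move=> rk; rewrite /return_count_time; case: xgetP => [l -> rl|/(_ k)//].
exact: first_return_inj rl rk.
Qed.

Lemma return_count_time_gt0 x : (0 < return_count_time x)%N ->
  first_return (return_count_time x) x.
Proof. by rewrite /return_count_time; case: xgetP => [l -> //|]. Qed.

Lemma measurable_first_return k : measurable (first_return k).
Proof.
case: k => [|k].
  by rewrite (_ : first_return 0 = set0)// -subset0 => x [].
rewrite (_ : first_return k.+1 = [set x : T | x k.+1%:Z = a] `&`
  \bigcap_(i in [set i | (0 < i < k.+1)%N]) ~` [set x : T | x i%:Z = a]); last first.
  apply/seteqP; split => [x [_ xk h]|x [xk h]]; first by split => // i /h.
  by split => // i /h.
apply: measurableI; first exact: measurable_coordinate.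
by apply: bigcap_measurableType => i _; apply: measurableC; exact: measurable_coordinate.
Qed.

Lemma measurable_return_count_time (k : nat) : measurable [set x | return_count_time x = k].
Proof.
case: k => [|k]; last first.
  rewrite (_ : [set x | _] = first_return k.+1); first exact: measurable_first_return.
  apply/seteqP; split => [x /= h|x /return_count_timeE//].
  by rewrite -h; apply: return_count_time_gt0; rewrite h.
rewrite (_ : [set x | _] = ~` \bigcup_k first_return k).
  by apply: measurableC; apply: bigcup_measurable => k _; exact: measurable_first_return.
apply/seteqP; split => [x /= h [k _ rk]|x h].
  by have := return_count_timeE rk; case: rk => + _ _ => /[swap] <-; rewrite h.
apply/eqP; rewrite /= -leqn0 leqNgt; apply/negP => h0; apply: h.
by exists (return_count_time x) => //; exact: return_count_time_gt0.
Qed.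

Definition induced (x : T) : T := path_shift (return_count_time x) x.

Definition nth_return (i : nat) (x : T) : nat := return_count_time (iter i induced x).

Lemma measurable_induced : measurable_fun setT induced.
Proof.
move=> _ B mB; rewrite setTI.
rewrite (_ : induced @^-1` B =
  \bigcup_k ([set x | return_count_time x = k] `&` path_shift k @^-1` B)).
  apply: bigcup_measurable => k _; apply: measurableI; first exact: measurable_return_count_time.
  exact: measurable_shift_preimage.
apply/seteqP; split => [x Bx|x [k _ [/= <-]]//].
by exists (return_count_time x).
Qed.

Lemma measurable_iter_induced i : measurable_fun setT (iter i induced).
Proof.
elim: i => [|i IH]; first exact: measurable_id.
by apply: (@measurableT_comp _ _ _ _ _ _ induced) => //; exact: measurable_induced.
Qed.

Definition return_rv (i : nat) (x : T) : R := (nth_return i x)%:R.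

Lemma measurable_return_rv i : measurable_fun setT (return_rv i).
Proof.
move=> _ B mB; rewrite setTI.
rewrite (_ : return_rv i @^-1` B = (fun x => return_count_time (iter i induced x)) @^-1`
  [set k : nat | B k%:R])//.
apply: measurable_fibers => k.
rewrite (_ : [set x | _] = iter i induced @^-1` [set x | return_count_time x = k])//.
rewrite -[X in measurable X]setTI; apply: measurable_iter_induced => //.
exact: measurable_return_count_time.
Qed.

(** The first n returns occur and the i-th return time lies in B i. Unrolling one excursion at a
    time makes regenerativity and the product formula an induction on n. *)
Fixpoint return_event (n : nat) (B : nat -> set R) : set T :=
  if n is m.+1 then \bigcup_k (if `[< B 0%N k%:R >] then
    excursion k `&` path_shift k @^-1` return_event m (B \o S) else set0)
  else state_set a.

Lemma return_eventE n B x : return_event n B x <->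
  state_set a x /\ forall i, (i < n)%N -> B i (return_rv i x) /\ (0 < nth_return i x)%N.
Proof.
elim: n B x => [|n IH] B x; first by split => [//|[]].
split => [[k _]|[x0 h]].
  case: asboolP => // Bk [[x0 rk] /IH [_ h]]; split=> // -[_|i].
    by rewrite /return_rv /nth_return /= (return_count_timeE rk); case: rk.
  by rewrite ltnS => /h; rewrite /return_rv /nth_return iterSr /induced (return_count_timeE rk).
have [B0 t0] := h 0%N isT; have rk := return_count_time_gt0 t0.
exists (return_count_time x) => //; rewrite ifT; last exact/asboolP.
split => //; apply/IH; split; first by rewrite /state_set/= shiftE add0r; case: rk.
by move=> i ilt; have := h i.+1 ilt; rewrite /return_rv /nth_return iterSr.
Qed.

Definition return_law (B : set R) : \bar R :=
  (\sum_(k <oo) if `[< B k%:R >] then (return_prob k)%:E else 0)%E.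

Lemma regenerative_set0 : regenerative rho set0.
Proof. by split => // k D _; rewrite preimage_set0 setI0 measure0 mule0. Qed.

Lemma regenerative_return_event n B :
  regenerative rho (return_event n B) /\
  rho (return_event n B) = (\prod_(0 <= i < n) return_law (B i))%E.
Proof.
elim: n B => [|n IH] B.
  by split; [exact: (regenerative_state mk inv rhoA)|rewrite big_geq].
have [rI pI] := IH (B \o S).
pose F k := if `[< B 0%N k%:R >] then
    excursion k `&` path_shift k @^-1` return_event n (B \o S) else set0.
have st k := regenerative_step mk inv rhoA (past_excursion k) (@subIsetl _ _ _) rI.
have rF k : regenerative rho (F k).
  by rewrite /F; case: ifP => _; [exact: (st k).1|exact: regenerative_set0].
have tF : trivIset setT F.
  apply: (@sub_trivIset _ _ _ setT); first by [].
  apply/trivIsetP => i j _ _ ij; rewrite -subset0 => x []; rewrite /F.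
  case: ifP => // _ [[_ ri] _]; case: ifP => // _ [[_ rj] _].
  by move: ij; rewrite (first_return_inj ri rj) eqxx.
split; first exact: regenerative_bigcup.
rewrite /= (measure_semi_bigcup rho _ tF); last 2 first.
- by move=> k; case: (rF k).
- by apply: bigcup_measurable => k _; case: (rF k).
rewrite big_nat_recl//= -pI.
have fin : rho (return_event n (B \o S)) \is a fin_num.
  apply: le1_fin_num; rewrite -rhoA; case: rI => m1 s1 _.
  by apply: le_measure; rewrite ?inE//; exact: measurable_state.
rewrite muleC -(fineK fin) /return_law -nneseriesZl; last first.
  by move=> k _; case: ifP => // _; rewrite return_probE.
apply: eq_eseriesr => k _; rewrite /F; case: ifP => _; last by rewrite measure0 mule0.
by rewrite (st k).2 fineK// return_probE muleC.
Qed.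

Lemma return_lawT : return_law setT = 1%E.
Proof.
rewrite -[RHS]return_prob_sum; apply: eq_eseriesr => k _.
by rewrite ifT//; exact/asboolP.
Qed.

End first_return.

(** * The chain started at the state and its independent return times *)

Section base_probability.
Context {R : realType} {A : countType} (a : A).
Variable rho : {measure set (Paths a) -> \bar R}.
Hypothesis rhoA : rho (state_set a) = 1%E.
Local Notation T := (Paths a).

Definition base_measure : set T -> \bar R := mrestr rho (@measurable_state A a).

HB.instance Definition _ := Measure.on base_measure.

Let base_setT : base_measure setT = 1%E.
Proof. by rewrite /base_measure /mrestr setTI. Qed.

Definition base_probability : probability T R :=
  HB.pack base_measure (Measure_isProbability.Build _ _ _ base_measure base_setT).

Lemma base_probabilityE (B : set T) : base_probability B = rho (B `&` state_set a).
Proof. by []. Qed.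

End base_probability.

Section iid_returns.
Context {R : realType} {A : countType} (a : A).
Variables (P : A -> A -> R) (pi : A -> R).
Variable rho : {measure set (Paths a) -> \bar R}.
Hypothesis mk : markov_measure P pi rho.
Hypothesis inv : invariant_measure rho (left_shift a).
Hypothesis cons : conservative rho (left_shift a).
Hypothesis rhoA : rho (state_set a) = 1%E.
Local Notation T := (Paths a).
Local Notation Q := (base_probability rhoA).

Let X (i : nat) : {RV Q >-> R} :=
  HB.pack (@return_rv R A a i)
    (isMeasurableFun.Build _ _ _ _ _ (@measurable_return_rv R A a i)).

Lemma base_return n (B : nat -> set R) : (forall i, measurable (B i)) ->
  Q (\bigcap_(i in `I_n) (X i @^-1` B i)) =
  (\prod_(0 <= i < n) return_law rho (B i))%E.
Proof.
move=> mB; rewrite base_probabilityE.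
have [rE <-] := regenerative_return_event mk inv rhoA n B.
have [r1 p1] := regenerative_return_event mk inv rhoA n (fun=> [set: R]).
have [mE _ _] := rE.
have [m1 _ _] := r1.
have mA : measurable (state_set a : set T) by exact: measurable_state.
have mI : measurable (\bigcap_(i in `I_n) (X i @^-1` B i)).
  apply: bigcap_measurableType => i _; rewrite -[X in measurable X]setTI.
  exact: (@measurable_return_rv R A a i).
(* [return_event] requires the returns to take place, while the preimages admit the value 0 of a
   missing return. The two events differ inside this null set. *)
have null : rho (state_set a `\` return_event n (fun=> [set: R])) = 0%E.
  have e1 : rho (return_event n (fun=> [set: R])) = 1%E.
    by rewrite p1 big1// => i _; exact: (return_lawT inv rhoA cons).
  have fA : (rho (state_set a) < +oo)%E by rewrite rhoA ltry.
  have := measureD mA m1 fA; rewrite setIidr; last by case: r1.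
  move=> ->; rewrite [X in (X - _)%E](_ : _ = 1%E); last exact: rhoA.
  by rewrite [X in (_ - X)%E](_ : _ = 1%E) ?subee//; exact: e1.
apply/eqP; rewrite eq_le; apply/andP; split; last first.
  apply: le_measure; rewrite ?inE//; first exact: measurableI.
  by move=> x /return_eventE [x0 h]; split => // i /= /h [].
have -> : rho (return_event n B) =
    (rho (return_event n B) + rho (state_set a `\` return_event n (fun=> [set: R])))%E.
  by rewrite null adde0.
apply: le_trans (measureU2 _ _ _) => //; last exact: measurableD.
apply: le_measure; rewrite ?inE; first exact: measurableI.
  by apply: measurableU => //; exact: measurableD.
move=> x [h x0]; have [e|ne] := pselect (return_event n (fun=> [set: R]) x); last by right.
left; apply/return_eventE; split => // i ilt; split; first exact: h.
by have /return_eventE[_ /(_ i ilt)[]] := e.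
Qed.

Let law1 i B : measurable B -> Q (X i @^-1` B) = return_law rho B.
Proof.
move=> mB; pose C (j : nat) : set R := if j == i then B else setT.
have mC j : measurable (C j) by rewrite /C; case: ifP.
have := base_return i.+1 mC.
rewrite (_ : \bigcap_(j in `I_i.+1) (X j @^-1` C j) = X i @^-1` B); last first.
  apply/seteqP; split => [x /(_ i (ltnSn i))|x Bx j _]; first by rewrite /C eqxx.
  by rewrite /C; case: eqP => [->|].
rewrite big_nat_recr//= {2}/C eqxx => ->.
rewrite big_nat_cond big1 ?mul1e// => j /andP[/andP[_ ji] _].
by rewrite /C ltn_eqF// (return_lawT inv rhoA cons).
Qed.

Lemma return_timeP (t : R) (x : T) : (return_time x <= t%:E)%E <->
  exists2 k, first_return k x & k%:R <= t.
Proof.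
split => [h|[k [k0 xk _] kt]]; last first.
  apply: le_trans (_ : k%:R%:E <= _)%E; last by rewrite lee_fin.
  by apply: ereal_inf_lbound; exists k.
have [[k rk]|nk] := pselect (exists k, first_return k x); last first.
  move: h; rewrite /return_time (_ : [set _ | _ in _] = set0) ?ereal_inf0//.
  apply/seteqP; split => // y [m [m0 xm] _].
  by have [k _ rk] := first_return_exists m0 xm; apply: nk; exists k.
exists k => //; rewrite -lee_fin; apply: le_trans h.
apply: le_ereal_inf_tmp => _ [m [m0 xm] <-]; rewrite lee_fin ler_nat.
have [k' k'm rk'] := first_return_exists m0 xm.
by rewrite (first_return_inj rk rk').
Qed.

Lemma return_df_law t : (return_df rho t)%:E = return_law rho [set` `]-oo, t]].
Proof.
pose F k := if `[< [set` `]-oo, t]] (k%:R : R) >] then excursion k else set0 : set T.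
have E : state_set a `&` [set x | (return_time x <= t%:E)%E] = \bigcup_k F k.
  apply/seteqP; split => [x [x0 /return_timeP[k rk kt]]|x [k _]].
    by exists k => //; rewrite /F ifT//; apply/asboolP; rewrite /= in_itv.
  rewrite /F; case: asboolP => // kt [x0 rk]; split => //.
  by apply/return_timeP; exists k => //; move: kt; rewrite /= in_itv.
have mF k : measurable (F k).
  by rewrite /F; case: ifP => // _; exact: measurable_excursion.
have mU : measurable (\bigcup_k F k) by exact: bigcup_measurable.
rewrite /return_df E fineK; last first.
  apply: le1_fin_num; rewrite -rhoA -E; apply: le_measure; rewrite ?inE//.
    by rewrite E.
  exact: measurable_state.
rewrite measure_semi_bigcup//.
  apply: eq_eseriesr => k _; rewrite /F; case: ifP => _; last by rewrite measure0.
  by rewrite (return_probE inv rhoA).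
apply/trivIsetP => i j _ _ ij; rewrite -subset0 => x []; rewrite /F.
case: ifP => // _ [_ ri]; case: ifP => // _ [_ rj].
by move: ij; rewrite (first_return_inj ri rj) eqxx.
Qed.

Lemma iid_returns : iid_with_df (return_df rho) X.
Proof.
split => [J B mB|i t]; last by rewrite return_df_law -(law1 i).
pose e := finmap.enum_fset J.
have [n Jn] : exists n, forall i, i \in e -> (i < n)%N.
  exists (\max_(i <- e) i).+1 => i iJ; rewrite ltnS.
  by apply: leq_bigmax_seq.
(* Filling the gaps of the index set with the whole line, of probability 1, reduces independence to
   initial segments. *)
pose C (j : nat) : set R := if j \in e then B j else setT.
have mC j : measurable (C j) by rewrite /C; case: ifP.
transitivity (Q (\bigcap_(j in `I_n) (X j @^-1` C j))).
  congr (Q _); apply/seteqP; split => [x h j _|x h j /= jJ].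
    by rewrite /C; case: ifPn => // jJ; exact: h.
  by have := h j (Jn j jJ); rewrite /C (_ : j \in e).
rewrite base_return//.
transitivity (\prod_(0 <= j < n | j \in e) return_law rho (B j))%E.
  rewrite [RHS]big_mkcond/=; apply: eq_bigr => j _; rewrite /C.
  by case: ifP => // _; rewrite (return_lawT inv rhoA cons).
rewrite -big_filter; transitivity (\prod_(j <- e) return_law rho (B j))%E.
  apply: perm_big; apply: uniq_perm.
  - by rewrite filter_uniq// iota_uniq.
  - exact: finmap.fset_uniq.
  - move=> j; rewrite mem_filter mem_index_iota/=.
    by case: (boolP (j \in e)) => //= /Jn ->.
by apply: eq_bigr => j _; rewrite law1.
Qed.

End iid_returns.

Section law_of_cdf.
Context {R : realType}.

Lemma cdf_eq_law (m1 m2 : {measure set R -> \bar R}) :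
  (m1 setT < +oo)%E -> (forall t : R, m1 `]-oo, t]%classic = m2 `]-oo, t]%classic) ->
  forall B : set R, measurable B -> m1 B = m2 B.
Proof.
move=> m1f H B mB.
have m1b (D : set R) : measurable D -> (m1 D < +oo)%E.
  by move=> mD; apply: le_lt_trans m1f; apply: le_measure; rewrite ?inE.
apply: (@measure_unique _ _ R (@ocitv R)
  (fun n => `]- (n%:R), n%:R]%classic)) => //.
- exact: ocitvI.
- by move=> n; exact: is_ocitv.
- apply/seteqP; split => // x _; exists (Num.truncn `|x|).+1 => //=.
  rewrite in_itv/=; have := truncnS_gt `|x|; rewrite ltr_norml => /andP[-> /ltW ->] //.
- move=> _ [[b c] _ <-] /=; have [bc|cb] := leP b c; last first.
    by rewrite set_itv_ge ?measure0// bnd_simp -leNgt ltW.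
  have -> : `]b, c]%classic = `]-oo, c]%classic `\` `]-oo, b]%classic :> set R.
    apply/seteqP; split => y /=; rewrite !in_itv/=.
      by move=> /andP[bY ->]; split=> //; apply/negP; rewrite -ltNge.
    by move=> [-> /negP]; rewrite -ltNge => ->.
  have sub : `]-oo, b]%classic `<=` (`]-oo, c]%classic : set R).
    by move=> y /=; rewrite !in_itv/= => /le_trans; apply.
  have m1c : (m1 `]-oo, c]%classic < +oo)%E by exact: m1b.
  have m2c : (m2 `]-oo, c]%classic < +oo)%E by rewrite -H.
  have mc : measurable (`]-oo, c]%classic : set R) by [].
  have mb : measurable (`]-oo, b]%classic : set R) by [].
  have D1 := measureD mc mb m1c; have D2 := measureD mc mb m2c.
  rewrite (setIidr sub) in D1; rewrite (setIidr sub) in D2.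
  apply: (eq_trans D1); apply: esym; apply: (eq_trans D2).
  by congr (_ - _)%E; apply: esym; exact: H.
- by move=> k; exact: m1b.
Qed.

End law_of_cdf.

Section returns_laplace.
Context {R : realType} {A : countType} (a : A).
Variables (P : A -> A -> R) (pi : A -> R).
Variable rho : {measure set (Paths a) -> \bar R}.
Hypothesis inv : invariant_measure rho (left_shift a).
Hypothesis rhoA : rho (state_set a) = 1%E.

(** A normalizing sequence brings its own probability space, so the variable is tied to the chain by
    its distribution function alone; that identifies its law with a series of Dirac masses at the
    integers. *)
Lemma integral_return_law d (W : measurableType d) (Q : probability W R)
    (X : {RV Q >-> R}) (g : R -> \bar R) :
  (forall t, cdf X t = (return_df rho t)%:E) ->
  measurable_fun setT g -> (forall y, (0 <= g y)%E) ->
  (\int[Q]_w g (X w) = \sum_(k <oo) ((return_prob rho k)%:E * g k%:R))%E.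
Proof.
move=> cX mg g0.
have f0 k : 0 <= return_prob rho k by have /andP[] := return_prob01 inv rhoA k.
pose nu : {measure set R -> \bar R} := mseries (fun k => mscale (NngNum (f0 k)) (\d_(k%:R : R))) 0.
have law B : measurable B -> distribution Q X B = nu B.
  apply: (@cdf_eq_law _ (distribution Q X) nu); first by apply: le_lt_trans (probability_le1 (distribution Q X) measurableT) (ltry _).
  move=> t; rewrite [LHS]cX (return_df_law inv rhoA) /nu /mseries /return_law.
  rewrite /=; apply: eq_eseriesr => k _.
  transitivity ((return_prob rho k)%:E * (\1_(`]-oo, t]%classic : set R) (k%:R : R))%:E)%E; last by [].
  rewrite indicE; case: asboolP => h; first by rewrite mem_set// mule1.
  by rewrite memNset// mule0.
rewrite -ge0_integral_distribution//.
transitivity (\int[nu]_y g y)%E.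
  by apply: eq_measure_integral => B mB _; exact: law.
rewrite ge0_integral_measure_series//; apply: eq_eseriesr => k _.
rewrite ge0_integral_mscale//= integral_dirac//= diracT mul1e//.
Qed.

End returns_laplace.

(** * Logarithmic averages *)

Section averages.
Context {R : realType}.
Implicit Types (w v t e D : nat -> R).

Lemma cvgn_inv0 D : D n @[n --> \oo] --> +oo -> (D n)^-1 @[n --> \oo] --> (0 : R).
Proof. by move=> Doo; apply/(gtr0_cvgV0 (f := D)) => //; exact: (cvgry_gt Doo). Qed.

(** The error is measured relative to the weight itself, since weights may vanish and quotients
    would be meaningless. The finitely many bad terms disappear against D. *)
Lemma toeplitz w v D (z l : R) : (forall n, 0 <= w n) ->
  (forall e : R, 0 < e -> \forall n \near \oo, `|v n - z * w n| <= e * w n) ->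
  D n @[n --> \oo] --> +oo ->
  (D k)^-1 * (\sum_(0 <= n < k) w n) @[k --> \oo] --> l ->
  (D k)^-1 * (\sum_(0 <= n < k) v n) @[k --> \oo] --> z * l.
Proof.
move=> w0 vw Doo wl.
have D0 : (D k)^-1 @[k --> \oo] --> (0 : R) by exact: cvgn_inv0.
have l0 : 0 <= l.
  apply: (cvgr_to_ge wl); near=> k; rewrite mulr_ge0 ?sumr_ge0// invr_ge0.
  near: k; exact: (cvgry_ge Doo).
suff : (D k)^-1 * (\sum_(0 <= n < k) (v n - z * w n)) @[k --> \oo] --> (0 : R).
  move=> h; rewrite -[z * l]add0r.
  have E : (fun k => (D k)^-1 * \sum_(0 <= n < k) v n) =
      (fun k => (D k)^-1 * (\sum_(0 <= n < k) (v n - z * w n)) +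
       z * ((D k)^-1 * (\sum_(0 <= n < k) w n))).
    by apply/funext => k; rewrite sumrB -mulr_sumr; ring.
  rewrite E.
  by apply: cvgD => //; exact: cvgMr.
apply/cvgrPdist_lt => e e0.
pose e' := e / (2 * (l + 1)).
have l1 : 0 < l + 1 by rewrite ltr_wpDl.
have e'0 : 0 < e' by rewrite divr_gt0// mulr_gt0.
have [N _ hN] := vw e' e'0.
pose C : R := \sum_(0 <= n < N) `|v n - z * w n|.
have CD : C * (D k)^-1 @[k --> \oo] --> (0 : R).
  by rewrite -(mulr0 C); apply: cvgMr.
have bnd k : (N <= k)%N -> `|\sum_(0 <= n < k) (v n - z * w n)| <=
    C + e' * \sum_(0 <= n < k) w n.
  move=> Nk; rewrite (@big_cat_nat _ _ _ N)//=.
  apply: le_trans (ler_normD _ _) _; apply: lerD; first exact: ler_norm_sum.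
  apply: le_trans (ler_norm_sum _ _ _) _.
  apply: (@le_trans _ _ (\sum_(N <= n < k) e' * w n)).
    by apply: ler_sum_nat => n /andP[Nn _]; exact: hN.
  rewrite -mulr_sumr; apply: ler_wpM2l; first exact: ltW.
  rewrite [leRHS](@big_cat_nat _ _ _ N)//= lerDr.
  exact: sumr_ge0.
near=> k.
have Dk : 0 < D k by near: k; exact: (cvgry_gt Doo).
rewrite sub0r normrN normrM ger0_norm ?invr_ge0 ?ltW//.
apply: (@le_lt_trans _ _ ((D k)^-1 * (C + e' * \sum_(0 <= n < k) w n))).
  apply: ler_wpM2l; first by rewrite invr_ge0 ltW.
  apply: bnd.
  by near: k; exact: nbhs_infty_ge.
rewrite mulrDr mulrCA [X in X + _]mulrC.
have h1 : C * (D k)^-1 < e / 2.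
  by near: k; apply: (cvgr_lt _ CD); rewrite divr_gt0.
have h2 : (D k)^-1 * (\sum_(0 <= n < k) w n) <= l + 1.
  by near: k; apply: (cvgr_le _ wl); rewrite ltrDl.
rewrite (_ : e = e / 2 + e' * (l + 1)); first by rewrite ltr_leD// ler_wpM2l// ltW.
by rewrite /e'; field; rewrite gt_eqF.
Unshelve. all: by end_near. Qed.

(* Summation by parts: the increments of e and t are both averaged against the
   same nonincreasing weights. *)
Lemma abel_domination w e t (eps : R) N k : (N <= k)%N ->
  (forall n, (N <= n)%N -> 0 <= w n.+1 <= w n) ->
  (forall n, (N <= n)%N -> `|e n| <= eps * t n) ->
  `|\sum_(N <= n < k) (e n.+1 - e n) * w n.+1| <=
  eps * (\sum_(N <= n < k) (t n.+1 - t n) * w n.+1 + 2 * t N * w N).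
Proof.
move=> Nk hw he.
have w0 n : (N <= n)%N -> 0 <= w n by move=> /hw /andP[/le_trans]; apply.
(* With the boundary terms at k moved inside, an induction step adds e k (w k - w k.+1) on the left
   and eps t k (w k - w k.+1) on the right, comparable term by term. *)
suff : `|\sum_(N <= n < k) (e n.+1 - e n) * w n.+1 - e k * w k| <=
    eps * (\sum_(N <= n < k) (t n.+1 - t n) * w n.+1 - t k * w k + 2 * t N * w N).
  move=> h; rewrite -[X in `|X|](subrK (e k * w k)).
  apply: le_trans (ler_normD _ _) _.
  have := ler_wpM2r (w0 k Nk) (he k Nk); rewrite normrM [X in _ -> _ + _ * X <= _]ger0_norm ?w0//.
  by move=> h2; apply: le_trans (lerD h h2) _; rewrite le_eqVlt; apply/orP; left; apply/eqP; ring.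
rewrite -(subnKC Nk); elim: (k - N)%N => [|m IH].
  rewrite addn0 !big_geq// !sub0r normrN normrM (ger0_norm (w0 N _))//.
  have := ler_wpM2r (w0 N (leqnn N)) (he N (leqnn N)) => /le_trans; apply.
  by rewrite le_eqVlt; apply/orP; left; apply/eqP; ring.
have Nm : (N <= N + m)%N by rewrite leq_addr.
have /andP[wp wm] := hw _ Nm.
rewrite addnS !big_nat_recr//=; set S := (X in `|X + _ - _|).
set T := (X in eps * (X + _ - _ + _)).
rewrite [X in `|X|](_ : _ = (S - e (N + m)%N * w (N + m)%N) +
   e (N + m)%N * (w (N + m)%N - w (N + m).+1)); last by ring.
apply: le_trans (ler_normD _ _) _.
rewrite (_ : eps * _ = eps * (T - t (N + m)%N * w (N + m)%N + 2 * t N * w N) +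
  eps * t (N + m)%N * (w (N + m)%N - w (N + m).+1)); last by ring.
apply: lerD => //; rewrite normrM (ger0_norm (x := _ - _)) ?subr_ge0//.
by apply: ler_wpM2r; rewrite ?subr_ge0// he.
Qed.

(** Only the sums s and q t are asymptotic, their increments are not, so Toeplitz's lemma does not
    apply. Monotone weights allow [abel_domination] to be used on the difference s - q t. *)
Lemma abel_transfer w s t D (q l : R) N0 :
  (forall n, (N0 <= n)%N -> 0 <= w n.+1 <= w n) ->
  (forall n, 0 <= t n) ->
  (forall e : R, 0 < e -> \forall n \near \oo, `|s n - q * t n| <= e * t n) ->
  D n @[n --> \oo] --> +oo ->
  (D k)^-1 * (\sum_(0 <= n < k) (t n.+1 - t n) * w n.+1) @[k --> \oo] --> l ->
  (D k)^-1 * (\sum_(0 <= n < k) (s n.+1 - s n) * w n.+1) @[k --> \oo] --> q * l.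
Proof.
move=> hw t0 st Doo tl.
have D0 : (D k)^-1 @[k --> \oo] --> (0 : R) by exact: cvgn_inv0.
pose e n := s n - q * t n.
suff : (D k)^-1 * (\sum_(0 <= n < k) (e n.+1 - e n) * w n.+1) @[k --> \oo] --> (0 : R).
  move=> h; rewrite -[q * l]add0r.
  have E : (fun k => (D k)^-1 * \sum_(0 <= n < k) (s n.+1 - s n) * w n.+1) =
      (fun k => (D k)^-1 * (\sum_(0 <= n < k) (e n.+1 - e n) * w n.+1) +
       q * ((D k)^-1 * (\sum_(0 <= n < k) (t n.+1 - t n) * w n.+1))).
    apply/funext => k; rewrite [q * _]mulrCA -mulrDr; congr (_ * _); rewrite mulr_sumr -big_split/=.
    by apply: eq_bigr => n _; rewrite /e; ring.
  rewrite E.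
  by apply: cvgD => //; exact: cvgMr.
apply/cvgrPdist_lt => eps eps0.
pose e' := eps / (2 * (`|l| + 1)).
have l1 : 0 < `|l| + 1 by rewrite ltr_wpDl.
have e'0 : 0 < e' by rewrite divr_gt0// mulr_gt0.
have [N1 _ hN1] := st e' e'0.
pose N := maxn N0 N1.
have hw' n : (N <= n)%N -> 0 <= w n.+1 <= w n.
  by move=> Nn; apply: hw; apply: leq_trans Nn; exact: leq_maxl.
have he n : (N <= n)%N -> `|e n| <= e' * t n.
  by move=> Nn; apply: hN1; apply: leq_trans Nn; exact: leq_maxr.
pose C : R := `|\sum_(0 <= n < N) (e n.+1 - e n) * w n.+1| +
  e' * `|2 * t N * w N - \sum_(0 <= n < N) (t n.+1 - t n) * w n.+1|.
have CD : C * (D k)^-1 @[k --> \oo] --> (0 : R).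
  by rewrite -(mulr0 C); apply: cvgMr.
have bnd k : (N <= k)%N -> `|\sum_(0 <= n < k) (e n.+1 - e n) * w n.+1| <=
    C + e' * \sum_(0 <= n < k) (t n.+1 - t n) * w n.+1.
  move=> Nk; rewrite (@big_cat_nat _ _ _ N)//= [in leRHS](@big_cat_nat _ _ _ N)//=.
  apply: le_trans (ler_normD _ _) _; rewrite /C -addrA; apply: lerD => //.
  apply: le_trans (abel_domination Nk hw' he) _.
  rewrite -mulrDr; apply: ler_wpM2l; first exact: ltW.
  rewrite [leLHS]addrC addrA lerD2r -lerBlDr; exact: ler_norm.
near=> k.
have Dk : 0 < D k by near: k; exact: (cvgry_gt Doo).
rewrite sub0r normrN normrM ger0_norm ?invr_ge0 ?ltW//.
apply: (@le_lt_trans _ _ ((D k)^-1 * (C + e' * \sum_(0 <= n < k) (t n.+1 - t n) * w n.+1))).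
  apply: ler_wpM2l; first by rewrite invr_ge0 ltW.
  apply: bnd.
  by near: k; exact: nbhs_infty_ge.
rewrite mulrDr mulrCA [X in X + _]mulrC.
have h1 : C * (D k)^-1 < eps / 2.
  by near: k; apply: (cvgr_lt _ CD); rewrite divr_gt0.
have h2 : (D k)^-1 * (\sum_(0 <= n < k) (t n.+1 - t n) * w n.+1) <= `|l| + 1.
  by near: k; apply: (cvgr_le _ tl); rewrite ltr_pwDr// ler_norm.
rewrite (_ : eps = eps / 2 + e' * (`|l| + 1)); first by rewrite ltr_leD// ler_wpM2l// ltW.
by rewrite /e'; field; rewrite gt_eqF.
Unshelve. all: by end_near. Qed.

Lemma square_sum v n : (\sum_(0 <= k < n) v k) ^+ 2 =
  \sum_(0 <= k < n) (v k ^+ 2 + 2 * \sum_(0 <= j < k) v j * v k).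
Proof.
elim: n => [|n IH]; first by rewrite !big_geq// expr0n.
rewrite !big_nat_recr//= sqrrD IH -addrA -mulr_suml; congr (_ + _).
by rewrite mulr2n; ring.
Qed.

End averages.

(** * A strong law when the variance is of the order of the mean *)

Section l2_strong_law.
Context {d} {W : measurableType d} {R : realType} (Q : probability W R).

(** The integral of the series is finite, so the series converges almost everywhere and its terms
    vanish; this replaces Chebyshev and Borel-Cantelli. *)
Lemma ae_cvg0 (g : nat -> W -> R) : (forall n, measurable_fun setT (g n)) ->
  (forall n w, 0 <= g n w) ->
  (\sum_(n <oo) \int[Q]_w (g n w)%:E < +oo)%E ->
  {ae Q, forall w, g n w @[n --> \oo] --> (0 : R)}.
Proof.
move=> mg g0 sfin.
pose S w : \bar R := (\sum_(n <oo) (g n w)%:E)%E.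
have mS : measurable_fun setT S.
  apply: ge0_emeasurable_sum; first by move=> n x _ _; rewrite lee_fin.
  by move=> n _; exact/measurable_EFinP.
have S0 w : (0 <= S w)%E by apply: nneseries_ge0 => n _ _; rewrite lee_fin.
have iS : Q.-integrable setT S.
  apply/integrableP; split => //.
  rewrite (eq_integral S); last by move=> w _; rewrite gee0_abs.
  rewrite integral_nneseries//.
    by move=> n; apply/measurable_EFinP.
  by move=> n w _; rewrite lee_fin.
have := integrable_ae measurableT iS; apply: filterS => w /(_ I) Sfin.
have ncv : cvgn (series (fun n => g n w)).
  apply: nondecreasing_is_cvgn; first by apply: nondecreasing_series => n _ _.
  exists (fine (S w)) => _ [n _ <-]; rewrite -lee_fin fineK// /series/= -sumEFin.
  by apply: nneseries_lim_ge => k _ _; rewrite lee_fin.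
exact: cvg_series_cvg_0.
Qed.

End l2_strong_law.

Section square_subsequence.
Context {R : realType}.

(* Along the indices where M first exceeds m^2 the ratio x/M is pinched between
   its values at consecutive squares. *)
Lemma monotone_ratio_cvg (x M : nat -> R) (D : R) (k : nat -> nat) :
  (forall n, 0 <= x n) ->
  {homo x : m n / (m <= n)%N >-> m <= n} -> {homo M : m n / (m <= n)%N >-> m <= n} ->
  M n @[n --> \oo] --> +oo ->
  (forall m n, (k m <= n)%N = (m%:R ^+ 2 <= M n)) ->
  (forall m, M (k m) <= m%:R ^+ 2 + D) ->
  x (k m) / M (k m) @[m --> \oo] --> (1 : R) ->
  x n / M n @[n --> \oo] --> (1 : R).
Proof.
move=> x0 hx hM Moo kE kD xk.
pose m n := Num.truncn (Num.sqrt (M n)).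
have moo : m n @[n --> \oo] --> \oo.
  apply/cvgnyPge => N; near=> n.
  have Mn : 0 <= M n by near: n; exact: (cvgry_ge Moo).
  rewrite truncn_ge_nat ?sqrtr_ge0// -(ger0_norm (ler0n R N)) -sqrtr_sqr ler_wsqrtr//.
  by near: n; exact: (cvgry_ge Moo).
have inv1 : (fun n : nat => n.+1%:R^-1 : R) n @[n --> \oo] --> (0 : R).
  exact: cvg_harmonic.
have inv0 : (fun n : nat => n%:R^-1 : R) n @[n --> \oo] --> (0 : R).
  by rewrite -cvg_shiftS; exact: cvg_harmonic.
have lo : (fun i => x (k i) / M (k i) * (1 - i.+1%:R^-1) ^+ 2) i @[i --> \oo] --> (1 : R).
  rewrite -[X in _ --> X](_ : 1 * (1 - 0) ^+ 2 = 1); last by rewrite subr0 expr1n mul1r.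
  apply: cvgM => //; under eq_fun do rewrite expr2; rewrite expr2.
  by apply: cvgM; apply: cvgB => //; exact: cvg_cst.
have hi : (fun i => x (k i.+1) / M (k i.+1) * ((1 + i%:R^-1) ^+ 2 + D * (i%:R^-1 * i%:R^-1))) i
    @[i --> \oo] --> (1 : R).
  rewrite -[X in _ --> X](_ : 1 * ((1 + 0) ^+ 2 + D * (0 * 0)) = 1); last by ring.
  apply: cvgM; first by move: xk; rewrite -cvg_shiftS.
  apply: cvgD; last by apply: cvgMr; exact: cvgM.
  under eq_fun do rewrite expr2; rewrite expr2.
  by apply: cvgM; apply: cvgD => //; exact: cvg_cst.
have lo' := cvg_comp _ _ moo lo; have hi' := cvg_comp _ _ moo hi.
apply: (squeeze_cvgr _ lo' hi'); near=> n.
have M1 : 1 <= M n by near: n; exact: (cvgry_ge Moo).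
have M0 : 0 < M n by apply: lt_le_trans M1.
have sq : Num.sqrt (M n) ^+ 2 = M n by rewrite sqr_sqrtr// ltW.
have s0 : 0 <= Num.sqrt (M n) by exact: sqrtr_ge0.
have m1 : 0 < (m n)%:R :> R.
  by rewrite ltr0n truncn_ge_nat// -sqrtr1 ler_wsqrtr.
have l1 : (m n)%:R ^+ 2 <= M n.
  by rewrite -[leRHS]sq lerXn2r ?nnegrE// truncn_le.
have l2 : M n < (m n).+1%:R ^+ 2.
  by rewrite -[ltLHS]sq ltrXn2r ?nnegrE// truncnS_gt.
have k1 : (k (m n) <= n)%N by rewrite kE.
have k2 : (n < k (m n).+1)%N by rewrite ltnNge kE -ltNge.
have Mk1 : (m n)%:R ^+ 2 <= M (k (m n)) by rewrite -kE.
have Mk2 : (m n).+1%:R ^+ 2 <= M (k (m n).+1) by rewrite -kE.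
have Mk10 : 0 < M (k (m n)) by apply: lt_le_trans Mk1; rewrite exprn_gt0.
have Mk20 : 0 < M (k (m n).+1) by apply: lt_le_trans Mk2; rewrite exprn_gt0.
apply/andP; split.
  rewrite /=; have -> : 1 - (m n).+1%:R^-1 = (m n)%:R / (m n).+1%:R :> R.
    by rewrite -natr1; field; rewrite natr1 pnatr_eq0.
  have fe (X Y p y : R) : Y != 0 -> y != 0 ->
      X / Y * (p / y) ^+ 2 = X * (p ^+ 2 / Y) / y ^+ 2 by move=> ? ?; field; apply/andP.
  rewrite fe ?pnatr_eq0// ?gt_eqF//.
  apply: ler_pM; rewrite ?mulr_ge0 ?invr_ge0 ?exprn_ge0 ?(ltW Mk10)//.
    rewrite -[leRHS]mulr1; apply: ler_pM; rewrite ?mulr_ge0 ?invr_ge0 ?exprn_ge0 ?(ltW Mk10)//.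
      exact: hx.
    by rewrite ler_pdivrMr// mul1r.
  by rewrite lef_pV2 ?posrE ?exprn_gt0// ltW.
rewrite /= (_ : x (k _) / _ * _ = x (k (m n).+1) * ((M (k (m n).+1))^-1 * ((m n).+1%:R ^+ 2 + D)) *
    ((m n)%:R ^+ 2)^-1); last by rewrite -natr1; field; rewrite (gt_eqF m1) gt_eqF.
apply: ler_pM; rewrite ?invr_ge0 ?(ltW M0)//; last first.
  by rewrite lef_pV2 ?posrE// exprn_gt0.
rewrite -[leLHS]mulr1; apply: ler_pM => //; first exact: hx (ltnW k2).
by rewrite ler_pdivlMl// mulr1.
Unshelve. all: by end_near. Qed.

End square_subsequence.

Section l2_strong_law.
Context {d} {W : measurableType d} {R : realType} (Q : probability W R).

Lemma sum_inv_square n : \sum_(0 <= i < n) (i.+1%:R ^+ 2)^-1 <= 2 :> R.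
Proof.
case: n => [|n]; first by rewrite big_geq.
suff : \sum_(0 <= i < n.+1) (i.+1%:R ^+ 2)^-1 <= 2 - n.+1%:R^-1 :> R.
  by move=> h; apply: (le_trans h); rewrite lerBlDr lerDl invr_ge0.
elim: n => [|n IH]; first by rewrite big_nat1 expr1n invr1; lra.
rewrite big_nat_recr//=; apply: le_trans (lerD IH (lexx _)) _.
have n1 : 0 < n.+1%:R :> R by rewrite ltr0n.
have n2 : 0 < n.+2%:R :> R by rewrite ltr0n.
rewrite -addrA lerD2l -subr_ge0.
have fe (y : R) : 0 < y -> - (y + 1)^-1 - (- y^-1 + ((y + 1) ^+ 2)^-1) =
    (y * (y + 1) ^+ 2)^-1.
  by move=> y0; field; rewrite !gt_eqF// addr_gt0.
by rewrite -[n.+2%:R]natr1 fe// invr_ge0 mulr_ge0// ?sqr_ge0// ltW.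
Qed.

(** The normalised variance of [xi] is of order 1/M. Along the first indices where M reaches m^2 it
    is of order 1/m^2, hence summable, and monotonicity fills the gaps because the steps of M are
    bounded. *)
Lemma l2_strong_law (xi : nat -> W -> R) (c : nat -> R) (D B : R) :
  (forall k, measurable_fun setT (xi k)) ->
  (forall k w, 0 <= xi k w <= c k) ->
  (forall k w, xi k w <= xi k.+1 w) ->
  let M k := \int[Q]_w xi k w in
  M k @[k --> \oo] --> +oo ->
  (forall k, M k.+1 <= M k + D) ->
  (forall k, \int[Q]_w (xi k w) ^+ 2 <= M k ^+ 2 + B * (1 + M k)) ->
  {ae Q, forall w, xi k w / M k @[k --> \oo] --> (1 : R)}.
Proof.
move=> mxi xic xi_nd M Moo MD MB.
have ixi k : Q.-integrable setT (EFin \o xi k).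
  apply: (bounded_integrable Q (M := c k)) => // w.
  by have /andP[h ?] := xic k w; rewrite ger0_norm.
have ixi2 k : Q.-integrable setT (EFin \o (fun w => xi k w ^+ 2)).
  apply: (bounded_integrable Q (M := c k ^+ 2)); first exact: measurable_funX.
  move=> w; have /andP[h ?] := xic k w; rewrite ger0_norm ?sqr_ge0//.
  by rewrite lerXn2r ?nnegrE// (le_trans h).
have homo_xi w : {homo (xi ^~ w) : m n / (m <= n)%N >-> m <= n}.
  by apply: homo_leq => // y x z; exact: le_trans.
have homoM : {homo M : m n / (m <= n)%N >-> m <= n}.
  by move=> m n mn; apply: le_Rintegral => // w _; exact: homo_xi.
have M0 k : 0 <= M k by apply: Rintegral_ge0 => w _; have /andP[] := xic k w.
have var k : \int[Q]_w ((xi k w - M k) ^+ 2) <= B * (1 + M k).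
  have E w : (xi k w - M k) ^+ 2 = xi k w ^+ 2 + (- (2 * M k) * xi k w + M k ^+ 2).
    by ring.
  under eq_Rintegral do rewrite E.
  have i1 : Q.-integrable setT (EFin \o (fun w => - (2 * M k) * xi k w)).
    exact: (integrableZl measurableT (- (2 * M k)) (ixi k)).
  have i2 : Q.-integrable setT (EFin \o (fun=> M k ^+ 2)).
    exact: (bounded_integrable Q (f := fun=> M k ^+ 2) (M := `|M k ^+ 2|)).
  rewrite RintegralD//; last exact: (integrableD measurableT i1 i2).
  rewrite RintegralD// RintegralZl// expectation1 -/(M k).
  by have := MB k; set I := \int[Q]_w _ => h; apply: le_trans (lerD h (lexx _)) _; rewrite le_eqVlt; apply/orP; left; apply/eqP; ring.
have B0 : 0 <= B.
  have := le_trans _ (var 0%N) => /(_ 0).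
  rewrite pmulr_lge0; last by rewrite ltr_wpDr.
  by apply; apply: Rintegral_ge0 => w _; exact: sqr_ge0.
have ex (m : nat) : exists k, m%:R ^+ 2 <= M k.
  have [k _ hk] := cvgry_ge Moo (m%:R ^+ 2); exists k; exact: hk k (leqnn k).
pose k m := ex_minn (ex m).
have kE m n : (k m <= n)%N = (m%:R ^+ 2 <= M n).
  rewrite /k; case: ex_minnP => j hj min; apply/idP/idP => [jn|/min//].
  by apply: le_trans hj _; exact: homoM.
have D0 : 0 <= D by have := MD 0%N; have := homoM 0%N 1%N isT => h1 h2; lra.
(* The index before the first passage is still below m^2 and one step adds at most [D]; the term
   [M 0] covers a threshold already reached at index 0. *)
have kD m : M (k m) <= m%:R ^+ 2 + (D + M 0%N).
  case e : (k m) => [|j]; first by rewrite addrA lerDr addr_ge0// sqr_ge0.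
  apply: le_trans (MD j) _; rewrite addrA ler_wpDr// lerD2r ltW// ltNge -kE e ltnn//.
pose g m w : R := (xi (k m.+1) w / M (k m.+1) - 1) ^+ 2.
have Mk m : m.+1%:R ^+ 2 <= M (k m.+1) by rewrite -kE.
have Mk1 m : 1 <= M (k m.+1) by apply: le_trans (Mk m); rewrite exprn_ege1// ler1n.
have mg m : measurable_fun setT (g m).
  apply: measurable_funX; apply: measurable_funB => //; exact: measurable_funM.
have gint m : (\int[Q]_w (g m w)%:E <= (2 * B * (m.+1%:R ^+ 2)^-1)%:E)%E.
  have Mp : 0 < M (k m.+1) by apply: lt_le_trans (Mk1 m).
  have ge w : g m w = (M (k m.+1) ^+ 2)^-1 * (xi (k m.+1) w - M (k m.+1)) ^+ 2.
    by rewrite /g; field; rewrite gt_eqF.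
  have mx : measurable_fun setT (fun w => (xi (k m.+1) w - M (k m.+1)) ^+ 2).
    by apply: measurable_funX; exact: measurable_funB.
  under eq_integral do rewrite ge EFinM.
  rewrite ge0_integralZl_EFin//; last 3 first.
  - by move=> w _; rewrite lee_fin sqr_ge0.
  - exact/measurable_EFinP.
  - by rewrite invr_ge0 sqr_ge0.
  have iv : Q.-integrable setT (EFin \o (fun w => (xi (k m.+1) w - M (k m.+1)) ^+ 2)).
    apply: (bounded_integrable Q (M := (c (k m.+1) + M (k m.+1)) ^+ 2)) => // w.
    have /andP[h1 h2] := xic (k m.+1) w.
    rewrite ger0_norm ?sqr_ge0// -[leLHS]real_normK ?num_real// lerXn2r ?nnegrE ?normr_ge0//.
      by rewrite addr_ge0// (le_trans h1).
    apply: le_trans (ler_normB _ _) _; rewrite !ger0_norm//; exact: lerD.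
  rewrite -(fineK (integrable_fin_num measurableT iv)) -EFinM lee_fin.
  have vk := var (k m.+1); rewrite /Rintegral in vk.
  apply: (@le_trans _ _ ((M (k m.+1) ^+ 2)^-1 * (B * (1 + M (k m.+1))))).
    by apply: ler_wpM2l => //; rewrite invr_ge0 sqr_ge0.
  apply: (@le_trans _ _ ((M (k m.+1) ^+ 2)^-1 * (B * (2 * M (k m.+1))))).
    apply: ler_wpM2l; first by rewrite invr_ge0 sqr_ge0.
    by apply: ler_wpM2l => //; rewrite mulrDl mul1r lerD2r.
  rewrite [leLHS](_ : _ = 2 * B * (M (k m.+1))^-1); last by field; rewrite gt_eqF.
  by apply: ler_wpM2l; rewrite ?mulr_ge0// lef_pV2// posrE exprn_gt0.
have := @ae_cvg0 _ _ _ Q g mg (fun n w => sqr_ge0 _).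
have fin : (\sum_(n <oo) \int[Q]_w (g n w)%:E < +oo)%E.
  apply: (@le_lt_trans _ _ (\sum_(n <oo) (2 * B * (n.+1%:R ^+ 2)^-1)%:E)%E).
    apply: lee_nneseries => n _; last exact: gint.
    by move=> _; apply: integral_ge0 => w _; rewrite lee_fin sqr_ge0.
  apply: (@le_lt_trans _ _ (2 * B * 2)%:E); last exact: ltry.
  apply: lime_le.
    by apply: is_cvg_nneseries => n _ _; rewrite lee_fin !mulr_ge0// invr_ge0 sqr_ge0.
  apply: nearW => n; rewrite sumEFin lee_fin -mulr_sumr.
  by apply: ler_wpM2l (sum_inv_square n); rewrite mulr_ge0.
move=> /(_ fin); apply: filterS => w gw.
apply: (@monotone_ratio_cvg _ _ M (D + M 0%N) k) => //.
- by move=> n; have /andP[] := xic n w.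
rewrite -cvg_shiftS.
apply/cvgrPdist_lt => e e0.
near=> m.
have : g m w < e ^+ 2 by near: m; exact: (cvgr_lt _ gw _ (exprn_gt0 2 e0)).
rewrite /g -real_normK ?num_real// => h.
by rewrite distrC /= -ltr_sqr ?nnegrE ?normr_ge0// ltW.
Unshelve. all: by end_near. Qed.

End l2_strong_law.

Lemma cvgn_ln (R : realType) (D : nat -> R) :
  D n @[n --> \oo] --> +oo -> ln (D n) @[n --> \oo] --> +oo.
Proof.
move=> Doo; apply/cvgryPge => M; near=> n.
rewrite -[M]expRK ler_ln ?posrE ?expR_gt0//; last by near: n; exact: (cvgry_gt Doo).
by near: n; exact: (cvgry_ge Doo).
Unshelve. all: by end_near. Qed.

(** * Sums weighted by reciprocals of their partial sums *)

Section logarithmic_sums.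
Context {R : realType} (v : nat -> R).
Hypothesis v01 : forall n, 0 <= v n <= 1.
Let abar n : R := \sum_(0 <= j < n) v j.
Hypothesis aoo : abar n @[n --> \oo] --> +oo.

Let v0 n : 0 <= v n. Proof. by have /andP[] := v01 n. Qed.
Let v1 n : v n <= 1. Proof. by have /andP[] := v01 n. Qed.
Let aS n : abar n.+1 = abar n + v n. Proof. by rewrite /abar big_nat_recr. Qed.
Let a0 n : 0 <= abar n. Proof. exact: sumr_ge0. Qed.
Let a_le n : abar n <= abar n.+1. Proof. by rewrite aS lerDl. Qed.

(** A Riemann sum for the logarithm: since v is bounded and abar tends to infinity, the increment of
    ln abar is asymptotic to v n / abar n.+1, and the increments telescope. *)
Lemma log_sum :
  (ln (abar k))^-1 * (\sum_(0 <= n < k) v n / abar n.+1) @[k --> \oo] --> (1 : R).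
Proof.
(* The truncation makes all increments nonnegative and L 0 = 0, and coincides with ln abar for large
   n. *)
pose L n : R := ln (Num.max 1 (abar n)).
have L_le n : L n <= L n.+1.
  rewrite ler_ln ?posrE; last 2 first.
  - by rewrite lt_max ltr01.
  - by rewrite lt_max ltr01.
  by rewrite ge_max le_max lexx/= le_max a_le orbT.
have lnoo : ln (abar k) @[k --> \oo] --> +oo.
  exact: cvgn_ln.
rewrite -[X in _ --> X]mul1r; apply: (@toeplitz _ (fun n => L n.+1 - L n)) => //.
- by move=> n; rewrite subr_ge0.
- move=> e e0; near=> n.
  have a1 : 1 <= abar n by near: n; exact: (cvgry_ge aoo).
  have ae : e^-1 <= abar n by near: n; exact: (cvgry_ge aoo).
  have p0 : 0 < abar n by apply: lt_le_trans a1.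
  have p1 : 0 < abar n.+1 by rewrite aS ltr_wpDr.
  have a1' : 1 <= abar n.+1 by apply: le_trans a1 _.
  rewrite mul1r /L !max_r//.
  have lo : v n / abar n.+1 <= ln (abar n.+1) - ln (abar n).
    have := @le_ln1Dx R (abar n / abar n.+1 - 1).
    rewrite ltrBrDl subrr divr_gt0// => /(_ isT).
    rewrite addrC subrK lnM ?posrE ?invr_gt0// lnV ?posrE// => h.
    have e1 : abar n / abar n.+1 - 1 = - (v n / abar n.+1).
      by rewrite (aS n); field; rewrite -(aS n) gt_eqF.
    by rewrite e1 in h; rewrite -lerN2 opprB.
  have hi : ln (abar n.+1) - ln (abar n) <= v n / abar n.
    have := @le_ln1Dx R (v n / abar n).
    have -> : 1 + v n / abar n = abar n.+1 / abar n.
      by rewrite (aS n); field; rewrite gt_eqF.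
    rewrite lnM ?posrE ?invr_gt0// lnV ?posrE//; apply.
    by apply: lt_le_trans (_ : 0 <= _); rewrite ?oppr_lt0// divr_ge0.
  have gap : v n / abar n <= v n / abar n.+1 + e * (v n / abar n.+1).
    have -> : v n / abar n = v n / abar n.+1 + (v n / abar n) * (v n / abar n.+1).
      by rewrite (aS n); field; rewrite -(aS n) !gt_eqF.
    rewrite lerD2l; apply: ler_wpM2r; first by rewrite divr_ge0// ltW.
    apply: (@le_trans _ _ (abar n)^-1).
      by rewrite -[leRHS]mul1r; apply: ler_wpM2r => //; rewrite invr_ge0.
    by rewrite -[e]invrK lef_pV2 ?posrE// invr_gt0.
  have h := ler_wpM2l (ltW e0) lo.
  rewrite distrC ger0_norm ?subr_ge0//.
  by rewrite lerBlDl; apply: (le_trans hi); apply: (le_trans gap); rewrite lerD2l.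
- have E n : \sum_(0 <= i < n) (L i.+1 - L i) = L n.
    have L0 : L 0 = 0 by rewrite /L /abar big_geq// max_l// ln1.
    by rewrite telescope_sumr// L0 subr0.
  apply: cvg_near_cst; near=> n; rewrite E /L max_r.
    by rewrite mulVf// gt_eqF//; near: n; exact: (cvgry_gt lnoo).
  by near: n; exact: (cvgry_ge aoo).
Unshelve. all: by end_near. Qed.

End logarithmic_sums.

Lemma harmonic_log_sum (R : realType) :
  (ln k%:R)^-1 * (\sum_(0 <= n < k) n.+1%:R^-1) @[k --> \oo] --> (1 : R).
Proof.
have E : (fun n => \sum_(0 <= j < n) 1) = (fun n => n%:R) :> (nat -> R).
  by apply/funext => n; rewrite sumr_const_nat subn0.
have := @log_sum R (fun=> 1) (fun=> _).
have E' n : \sum_(0 <= j < n) 1 = n%:R :> R by rewrite -[RHS](congr1 (@^~ n) E).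
rewrite E => /(_ _ cvgr_idn).
under eq_fun do [rewrite E'; under eq_bigr do rewrite E' div1r].
by apply => _; rewrite ler01 lexx.
Qed.

(* The regular variation of abar makes its dyadic blocks grow geometrically. *)
Lemma sum_ratio_le (R : realType) (abar : nat -> R) (alpha : R) : 0 < alpha ->
  abar 0 = 0 -> {homo abar : m n / (m <= n)%N >-> m <= n} ->
  regvar_seq abar alpha ->
  exists B C : R, [/\ 0 <= B, 0 <= C & forall m,
    \sum_(0 <= n < m) abar n.+1 / n.+1%:R <= B * abar m + C].
Proof.
move=> al0 a0 hom [_ apos rv].
have ag0 n : 0 <= abar n by rewrite -a0; exact: hom.
have al1 : 1 < 2 `^ alpha by rewrite powR_gt1 ?ltr1n.
pose q : R := (1 + 2 `^ alpha) / 2.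
have q1 : 1 < q by rewrite /q ltr_pdivlMr// mul1r; lra.
have q2 : q < 2 `^ alpha by rewrite /q ltr_pdivrMr//; lra.
have [N hN] : exists N, forall n, (N <= n)%N -> q * abar n <= abar (n * 2)%N.
  have rv2 := rv 2 (ltr0Sn _ _).
  have c2 := cvg_comp _ _ (@cvgr_idn R) rv2.
  have : \forall n \near \oo, q * abar n <= abar (n * 2)%N.
    near=> n.
    have p0 : 0 < abar n.
      have : 0 < abar (Num.truncn (n%:R : R)) by near: n; exact: (cvgr_idn apos).
      by rewrite natrK.
    have : q < abar (Num.truncn (2 * n%:R : R)) / abar (Num.truncn (n%:R : R)).
      by near: n; exact: (cvgr_gt _ c2).
    by rewrite -natrM !natrK ltr_pdivlMr// mulnC => /ltW.
  by move=> [N _ hN]; exists N => n; exact: hN.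
pose S m := \sum_(0 <= n < m) abar n.+1 / n.+1%:R.
have S_le : {homo S : m n / (m <= n)%N >-> m <= n}.
  move=> m n mn; rewrite /S [leRHS](@big_cat_nat _ _ _ m)//= lerDl.
  by apply: sumr_ge0 => i _; rewrite divr_ge0.
(* The fixed point of B = B/q + 1: the sum up to m is the sum up to m/2 plus a block of size at most
   abar m, and abar (m/2) <= abar m / q. *)
pose B := q / (q - 1).
have q0 : 0 < q - 1 by rewrite subr_gt0.
have B0 : 0 <= B by rewrite divr_ge0// ltW// (lt_trans ltr01).
have S0 m : 0 <= S m by apply: sumr_ge0 => i _; rewrite divr_ge0.
exists B, (S (N * 2).+2); split => // m.
rewrite -/(S m); elim/ltn_ind: m => m IH.
have [mN|Nm] := leqP m (N * 2).+2.
  by apply: (le_trans (S_le _ _ mN)); rewrite lerDr mulr_ge0.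
pose h := m./2.
have hm : (h < m)%N by rewrite /h; lia.
have h2 : (h * 2 <= m)%N by rewrite /h; lia.
have Nh : (N <= h)%N by rewrite /h; lia.
have mh : (m - h <= h.+1)%N by rewrite /h; lia.
rewrite /S (@big_cat_nat _ _ _ h)//= ?(ltnW hm)// -/(S h).
have blk : \sum_(h <= n < m) abar n.+1 / n.+1%:R <= abar m.
  apply: (@le_trans _ _ (\sum_(h <= n < m) abar m / h.+1%:R)).
    apply: ler_sum_nat => n /andP[hn nm]; apply: ler_pM; rewrite ?invr_ge0//.
      exact: hom.
    by rewrite lef_pV2 ?posrE ?ltr0n// ler_nat ltnS.
  rewrite sumr_const_nat -(mulr_natr (abar m / h.+1%:R)) -mulrA -[leRHS]mulr1; apply: ler_wpM2l => //.
  by rewrite mulrC ler_pdivrMr ?ltr0n// mul1r ler_nat.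
have aq : abar h <= abar m / q.
  rewrite ler_pdivlMr ?(lt_trans ltr01)// mulrC; apply: (le_trans (hN h Nh)).
  exact: hom.
apply: le_trans (lerD (IH h hm) blk) _.
rewrite -addrA [S _ + _]addrC addrA lerD2r.
apply: (@le_trans _ _ (B * (abar m / q) + abar m)).
  by rewrite lerD2r; apply: ler_wpM2l.
rewrite le_eqVlt; apply/orP; left; apply/eqP; rewrite /B; field.
by rewrite gt_eqF//= gt_eqF// (lt_trans ltr01).
Unshelve. all: by end_near. Qed.

Lemma triangle_exchange (R : realType) (F : nat -> nat -> R) n :
  \sum_(0 <= k < n) \sum_(0 <= j < k) F j k =
  \sum_(0 <= j < n) \sum_(j.+1 <= k < n) F j k.
Proof.
elim: n => [|n IH]; first by rewrite !big_geq.
rewrite big_nat_recr//= IH [RHS]big_nat_recr//= [X in _ = _ + X]big_geq// addr0.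
rewrite -big_split/=; apply: eq_big_nat => j /andP[_ jn].
by rewrite [RHS]big_nat_recr.
Qed.

(** * Laws of large numbers for weighted visits *)

Section chung_erdos.
Context {d} {W : measurableType d} {R : realType} (Q : probability W R).
Variables (V : nat -> W -> R) (v : nat -> R).
Hypothesis mV : forall k, measurable_fun setT (V k).
Hypothesis V01 : forall k w, 0 <= V k w <= 1.
Hypothesis VV : forall k w, V k w * V k w = V k w.
Hypothesis EV : forall k, \int[Q]_w V k w = v k.
(** In the application V k indicates a visit at time k + 1, so the visits numbered j and k lie k - j
    apart, which is the index k - j - 1 of v. *)
Hypothesis EVV : forall j k, (j < k)%N ->
  \int[Q]_w (V j w * V k w) = v j * v (k - j.+1)%N.
Let abar n : R := \sum_(0 <= j < n) v j.
Hypothesis aoo : abar n @[n --> \oo] --> +oo.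

Let iV (X : W -> R) (c : R) : measurable_fun setT X -> (forall w, 0 <= X w <= c) ->
  Q.-integrable setT (EFin \o X).
Proof.
move=> mX Xc; apply: (bounded_integrable Q (M := c)) => // w.
by have /andP[h ?] := Xc w; rewrite ger0_norm.
Qed.

Let v01 n : 0 <= v n <= 1.
Proof.
rewrite -EV; apply/andP; split.
  by apply: Rintegral_ge0 => w _; have /andP[] := V01 n w.
rewrite -(expectation1 Q 1); apply: le_Rintegral => //.
- exact: (iV (c := 1)).
- by apply: (iV (c := 1)) => // w; rewrite ler01 lexx.
- by move=> w _; have /andP[] := V01 n w.
Qed.

Let v0 n : 0 <= v n. Proof. by have /andP[] := v01 n. Qed.
Let v1 n : v n <= 1. Proof. by have /andP[] := v01 n. Qed.
Let aS n : abar n.+1 = abar n + v n. Proof. by rewrite /abar big_nat_recr. Qed.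
Let a0 n : 0 <= abar n. Proof. exact: sumr_ge0. Qed.
Let a_le : {homo abar : m n / (m <= n)%N >-> m <= n}.
Proof. by apply: homo_leq => [//|y x z|n]; [exact: le_trans|rewrite aS lerDl]. Qed.

(** For small k the sum abar may vanish; its inverse is then 0, in accordance with omitting such
    terms. *)
Let w k : R := (abar k.+1)^-1.

Let w0 k : 0 <= w k. Proof. by rewrite invr_ge0. Qed.

Let w_bounded : exists2 C : R, 0 <= C & forall k, w k <= C.
Proof.
have [N _ hN] := cvgry_ge aoo 1.
have S0 : 0 <= \sum_(0 <= i < N) w i by apply: sumr_ge0.
exists (\sum_(0 <= i < N) w i + 1) => [|k]; first by rewrite addr_ge0.
have [kN|Nk] := ltnP k N.
  rewrite (big_mkord xpredT w) (bigD1 (Ordinal kN))//= -addrA lerDl addr_ge0//.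
  exact: sumr_ge0.
apply: (@le_trans _ _ 1); last by rewrite lerDr.
by rewrite invf_le1 ?(lt_le_trans ltr01)//; apply: hN => /=; rewrite ltnW.
Qed.

Let vw1 k : v k * w k <= 1.
Proof.
have [a1|] := ltP 0 (abar k.+1).
  by rewrite ler_pdivrMr// mul1r aS lerDr.
move=> h; have e : abar k.+1 = 0 by apply/eqP; rewrite eq_le h a0.
by rewrite /w e invr0 mulr0.
Qed.

Let Rint_sum n (F : nat -> W -> R) : (forall k, Q.-integrable setT (EFin \o F k)) ->
  \int[Q]_w (\sum_(0 <= k < n) F k w) = \sum_(0 <= k < n) \int[Q]_w F k w.
Proof. by move=> iF; have [_ <-] := integrable_sum_seq (index_iota 0 n) measurableT iF. Qed.

Let Rint_square n (X : nat -> W -> R) (c : nat -> R) :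
  (forall k, measurable_fun setT (X k)) -> (forall k w, 0 <= X k w <= c k) ->
  \int[Q]_w (\sum_(0 <= k < n) X k w) ^+ 2 =
  \sum_(0 <= k < n) (\int[Q]_w (X k w) ^+ 2 +
    2 * \sum_(0 <= j < k) \int[Q]_w (X j w * X k w)).
Proof.
move=> mX Xc; under eq_Rintegral do rewrite square_sum.
have i2 j k : Q.-integrable setT (EFin \o (fun x => X j x * X k x)).
  apply: (iV (c := c j * c k)); first exact: measurable_funM.
  move=> x; have /andP[? ?] := Xc j x; have /andP[? ?] := Xc k x.
  by rewrite mulr_ge0//= ler_pM.
have i1 k : Q.-integrable setT (EFin \o (fun x => X k x ^+ 2)).
  by under eq_fun do rewrite /= expr2; exact: i2.
have i3 k : Q.-integrable setT (EFin \o (fun x => \sum_(0 <= j < k) X j x * X k x)).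
  by have [] := integrable_sum_seq (index_iota 0 k) measurableT (fun j => i2 j k).
have i4 k : Q.-integrable setT (EFin \o (fun x => 2 * \sum_(0 <= j < k) X j x * X k x)).
  exact: (integrableZl measurableT 2 (i3 k)).
have i5 k : Q.-integrable setT
    (EFin \o (fun x => X k x ^+ 2 + 2 * \sum_(0 <= j < k) X j x * X k x)).
  exact: (integrableD measurableT (i1 k) (i4 k)).
rewrite Rint_sum//; apply: eq_bigr => k _; rewrite RintegralD//; congr (_ + _).
rewrite RintegralZl//; congr (_ * _).
by have [_ ->] := integrable_sum_seq (index_iota 0 k) measurableT (fun j => i2 j k).
Qed.

(* Summation by parts: the partial sums of v (k - j - 1) - v k are at most
   abar (j + 1), and 1 / abar is nonincreasing. *)
Let covariance_tail j n : 0 < abar j.+1 ->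
  \sum_(j.+1 <= k < n) (v (k - j.+1)%N - v k) * w k <= 1.
Proof.
move=> aj; have [nj|jn] := leqP n j.+1; first by rewrite big_geq.
(* With the nonnegative boundary term of the summation by parts added, the left side is
   nonincreasing in m and equals abar j.+1 * w j = 1 at m = 0. *)
suff : forall m, \sum_(j.+1 <= k < j.+1 + m) (v (k - j.+1)%N - v k) * w k +
    (abar (j.+1 + m)%N - abar m) * w (j + m)%N <= 1.
  move=> /(_ (n - j.+1)%N); rewrite subnKC 1?ltnW//; apply: le_trans.
  rewrite lerDl mulr_ge0// subr_ge0; apply: a_le; exact: leq_subr.
elim=> [|m IH].
  by rewrite addn0 addn0 big_geq// add0r /abar [X in _ - X]big_geq// subr0 mulfV// gt_eqF.
apply: le_trans IH; rewrite addnS big_nat_recr ?leq_addr//= addKn -addrA lerD2l.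
rewrite addnS !(aS m) (aS (j.+1 + m)) addSn.
rewrite (_ : _ + _ = (abar (j + m).+1 - abar m) * w (j + m).+1); last by ring.
apply: ler_wpM2l; first by rewrite subr_ge0; apply: a_le; lia.
have am : 0 < abar (j + m).+1 by apply: (lt_le_trans aj); apply: a_le; lia.
rewrite /w lef_pV2 ?posrE//; last by apply: (lt_le_trans am); exact: a_le.
exact: a_le.
Qed.

Let M n : R := \sum_(0 <= k < n) v k * w k.

(** For fixed j the covariances with all later k add up to at most v j * w j by [covariance_tail].
    Twice the sum over j, plus the diagonal, bounds the variance by (C + 2) times the mean, as the
    strong law requires. *)
Lemma chung_erdos :
  {ae Q, forall x, (ln (abar n))^-1 * (\sum_(0 <= k < n) V k x / abar k.+1)
    @[n --> \oo] --> (1 : R)}.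
Proof.
have [C C0 wC] := w_bounded.
pose X k x := V k x * w k.
have mX k : measurable_fun setT (X k) by exact: measurable_funM.
have Xc k x : 0 <= X k x <= w k.
  have /andP[h1 h2] := V01 k x.
  by rewrite /X mulr_ge0//= -[leRHS]mul1r ler_wpM2r.
pose xi n x := \sum_(0 <= k < n) X k x.
have EX k : \int[Q]_x X k x = v k * w k.
  by rewrite RintegralZr ?EV//; exact: (iV (c := 1)).
have Exi n : \int[Q]_x xi n x = M n.
  rewrite Rint_sum; first by apply: eq_bigr => k _; exact: EX.
  by move=> k; exact: (iV (c := w k)).
have M0 n : 0 <= M n by apply: sumr_ge0 => k _; rewrite mulr_ge0.
have lnoo : ln (abar n) @[n --> \oo] --> +oo by exact: cvgn_ln.
have Mln : (ln (abar n))^-1 * M n @[n --> \oo] --> (1 : R) by exact: log_sum.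
have Moo : M n @[n --> \oo] --> +oo.
  apply/cvgryPge => K; near=> n.
  have l0 : 0 < ln (abar n) by near: n; exact: (cvgry_gt lnoo).
  have l1 : 2 * `|K| <= ln (abar n) by near: n; exact: (cvgry_ge lnoo).
  have : 2^-1 < (ln (abar n))^-1 * M n.
    by near: n; apply: (cvgr_gt _ Mln); rewrite invf_lt1// ltr1n.
  rewrite ltr_pdivlMl// => /ltW; apply: le_trans; apply: (le_trans (ler_norm K)).
  by rewrite ler_pdivlMr// mulrC.
have int2 n : \int[Q]_x (xi n x) ^+ 2 <= M n ^+ 2 + (C + 2) * (1 + M n).
  rewrite /xi (@Rint_square n X w)// /M square_sum -/(M n).
  apply: (@le_trans _ _ (\sum_(0 <= k < n) (2 * \sum_(0 <= j < k) v j * w j * (v k * w k)) +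
      (C * M n + 2 * M n))); last first.
    apply: lerD; first by apply: ler_sum => k _; rewrite lerDr sqr_ge0.
    by rewrite -mulrDl ler_wpM2l ?addr_ge0// lerDr.
  rewrite big_split/= addrCA; apply: lerD.
    rewrite /M mulr_sumr; apply: ler_sum => k _.
    have -> : \int[Q]_x X k x ^+ 2 = w k * (v k * w k).
      transitivity (\int[Q]_x (w k * X k x)).
        by apply: eq_Rintegral => x _; rewrite /X -[V k x in RHS]VV; ring.
      by rewrite RintegralZl ?EX//; exact: (iV (c := w k)).
    by apply: ler_wpM2r => //; rewrite mulr_ge0.
  rewrite -!mulr_sumr -mulrDr; apply: ler_wpM2l => //.
  have E j k : (j < k)%N -> \int[Q]_x (X j x * X k x) =
      v j * w j * (v k * w k) + v j * w j * ((v (k - j.+1)%N - v k) * w k).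
    move=> jk; transitivity (\int[Q]_x (w j * w k * (V j x * V k x))).
      by apply: eq_Rintegral => x _; rewrite /X; ring.
    rewrite RintegralZl//; last first.
      apply: (iV (c := 1 * 1)); first exact: measurable_funM.
      move=> x; have /andP[? ?] := V01 j x; have /andP[? ?] := V01 k x.
      by rewrite mulr_ge0//= ler_pM.
    by rewrite EVV//; ring.
  have -> : \sum_(0 <= k < n) \sum_(0 <= j < k) \int[Q]_x (X j x * X k x) =
     \sum_(0 <= k < n) \sum_(0 <= j < k) (v j * w j * (v k * w k)) +
     \sum_(0 <= k < n) \sum_(0 <= j < k) v j * w j * ((v (k - j.+1)%N - v k) * w k).
    rewrite -big_split/=; apply: eq_bigr => k _; rewrite -big_split/=.
    by apply: eq_big_nat => j /andP[_ jk]; rewrite E.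
  rewrite lerD2l triangle_exchange /M; apply: ler_sum => j _.
  rewrite -mulr_sumr -[leRHS]mulr1.
  have [aj|] := ltP 0 (abar j.+1).
    by apply: ler_wpM2l; [rewrite mulr_ge0|exact: covariance_tail].
  move=> h; have e : abar j.+1 = 0 by apply/eqP; rewrite eq_le h a0.
  by rewrite /w e invr0 mulr0 !mul0r.
have Exi' : (fun n => \int[Q]_x xi n x) = M by apply/funext => n; exact: Exi.
have := @l2_strong_law _ _ _ Q xi (fun n => \sum_(0 <= k < n) w k) 1 (C + 2).
rewrite Exi'; have mxi n : measurable_fun setT (xi n) by exact: measurable_sum.
have xic n x : 0 <= xi n x <= \sum_(0 <= k < n) w k.
  apply/andP; split; first by apply: sumr_ge0 => k _; have /andP[] := Xc k x.
  by apply: ler_sum => k _; have /andP[] := Xc k x.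
have xiS n x : xi n x <= xi n.+1 x.
  by rewrite /xi big_nat_recr//= lerDl; have /andP[] := Xc n x.
have MS n : M n.+1 <= M n + 1 by rewrite /M big_nat_recr//= lerD2l.
move=> /(_ mxi xic xiS Moo MS int2); apply: filterS => x h.
rewrite -[X in _ --> X](mulr1 1).
apply: (cvg_trans _ (cvgM Mln h)); apply: near_eq_cvg; near=> n.
have Mn : 0 < M n by near: n; exact: (cvgry_gt Moo).
by rewrite /= -mulrA [M n * _]mulrCA divff ?gt_eqF// mulr1.
Unshelve. all: by end_near. Qed.

Let N n x := \sum_(0 <= j < n) V j x.

(** Pairs j < n <= k contribute at most abar n * abar m, because the factors v (k - j - 1) add up to
    at most abar m. The excess over the product of the means comes from the shorter window only, by
    its diagonal and its pairs. *)
Let count_covariance n m : (n <= m)%N ->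
  \int[Q]_x (N n x * N m x) <= abar n * abar m + abar n + 2 * abar n ^+ 2.
Proof.
move=> nm.
have iVV j k : Q.-integrable setT (EFin \o (fun x => V j x * V k x)).
  apply: (iV (c := 1 * 1)); first exact: measurable_funM.
  move=> x; have /andP[? ?] := V01 j x; have /andP[? ?] := V01 k x.
  by rewrite mulr_ge0//= ler_pM.
have mN k : measurable_fun setT (N k) by exact: measurable_sum.
have Nn k x : 0 <= N k x <= k%:R.
  apply/andP; split; first by apply: sumr_ge0 => i _; have /andP[] := V01 i x.
  apply: (@le_trans _ _ (\sum_(0 <= j < k) 1)); last by rewrite sumr_const_nat subn0.
  by apply: ler_sum => i _; have /andP[] := V01 i x.
have iNN : Q.-integrable setT (EFin \o (fun x => N n x ^+ 2)).
  apply: (iV (c := n%:R * n%:R)); first exact: measurable_funX.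
  by move=> x; have /andP[? ?] := Nn n x; rewrite sqr_ge0/= expr2 ler_pM.
have iT : Q.-integrable setT
    (EFin \o (fun x => \sum_(0 <= j < n) \sum_(n <= k < m) V j x * V k x)).
  have i1 j : Q.-integrable setT (EFin \o (fun x => \sum_(n <= k < m) V j x * V k x)).
    by have [] := integrable_sum_seq (index_iota n m) measurableT (fun k => iVV j k).
  by have [] := integrable_sum_seq (index_iota 0 n) measurableT (fun j => i1 j).
have E x : N n x * N m x = N n x ^+ 2 +
    \sum_(0 <= j < n) \sum_(n <= k < m) V j x * V k x.
  rewrite {2}/N (@big_cat_nat _ _ _ n)//= mulrDr -expr2; congr (_ + _).
  by rewrite /N mulr_suml; apply: eq_bigr => j _; rewrite mulr_sumr.
under eq_Rintegral do rewrite E.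
rewrite RintegralD// addrC -addrA; apply: lerD.
  rewrite Rint_sum; last first.
    by move=> j; have [] := integrable_sum_seq (index_iota n m) measurableT (fun k => iVV j k).
  rewrite /abar mulr_suml; apply: ler_sum_nat => j /andP[_ jn].
  have [_ ->] := integrable_sum_seq (index_iota n m) measurableT (fun k => iVV j k).
  rewrite (eq_big_nat _ _ (F2 := fun k => v j * v (k - j.+1)%N)); last first.
    by move=> k /andP[nk _]; rewrite EVV//; exact: leq_trans nk.
  rewrite -mulr_sumr; apply: ler_wpM2l => //.
  apply: (@le_trans _ _ (\sum_(j.+1 <= k < m) v (k - j.+1)%N)).
    by rewrite [leRHS](@big_cat_nat _ _ _ n)//= lerDr; exact: sumr_ge0.
  rewrite -{1}[j.+1]add0n big_addn.
  under eq_bigr do rewrite addnK.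
  by apply: a_le; exact: leq_subr.
rewrite (@Rint_square n V (fun=> 1))// big_split/=; apply: lerD.
  by apply: ler_sum => k _; rewrite -EV; under eq_Rintegral do rewrite expr2 VV.
rewrite -mulr_sumr; apply: ler_wpM2l => //.
rewrite (eq_big_nat _ _ (F2 := fun k => \sum_(0 <= j < k) v j * v (k - j.+1)%N)); last first.
  by move=> k _; apply: eq_big_nat => j /andP[_ jk]; rewrite EVV.
rewrite triangle_exchange expr2 {2}/abar mulr_suml; apply: ler_sum => j _.
rewrite -mulr_sumr; apply: ler_wpM2l => //.
rewrite -{1}[j.+1]add0n big_addn.
under eq_bigr do rewrite addnK.
by apply: a_le; exact: leq_subr.
Qed.

(** The excess covariance of terms j <= k is of order abar j / j times the k-th weight. Regular
    variation enters through [sum_ratio_le]: these terms add up to a multiple of abar k, so the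
    variance is again of the order of the mean. *)
Lemma count_log_average (alpha : R) : 0 < alpha -> regvar_seq abar alpha ->
  {ae Q, forall x, (ln n%:R)^-1 * (\sum_(0 <= k < n) N k.+1 x / abar k.+1 / k.+1%:R)
    @[n --> \oo] --> (1 : R)}.
Proof.
move=> al0 rv; have [C C0 wC] := w_bounded.
have abar0 : abar 0%N = 0 by rewrite /abar big_geq.
have [B [C1 [B0 C10 BC]]] := sum_ratio_le al0 abar0 a_le rv.
pose X k x := N k.+1 x * w k / k.+1%:R.
have mN k : measurable_fun setT (N k) by exact: measurable_sum.
have Nn k x : 0 <= N k x <= k%:R.
  apply/andP; split; first by apply: sumr_ge0 => i _; have /andP[] := V01 i x.
  apply: (@le_trans _ _ (\sum_(0 <= j < k) 1)); last by rewrite sumr_const_nat subn0.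
  by apply: ler_sum => i _; have /andP[] := V01 i x.
have mX k : measurable_fun setT (X k).
  by apply: measurable_funM => //; exact: measurable_funM.
have Xc k x : 0 <= X k x <= w k.
  have /andP[h1 h2] := Nn k.+1 x; rewrite /X !mulr_ge0//=.
  by rewrite mulrAC -[leRHS]mul1r ler_wpM2r// ler_pdivrMr ?ltr0n// mul1r.
pose xi n x := \sum_(0 <= k < n) X k x.
pose e k := abar k.+1 * w k / k.+1%:R.
have e0 k : 0 <= e k by rewrite !mulr_ge0.
have EX k : \int[Q]_x X k x = e k.
  have iN : Q.-integrable setT (EFin \o N k.+1) by exact: (iV (c := k.+1%:R)).
  rewrite /X; under eq_Rintegral do rewrite -mulrA.
  rewrite RintegralZr// /e -mulrA; congr (_ * _).
  rewrite Rint_sum; first by apply: eq_bigr => j _; rewrite EV.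
  by move=> j; exact: (iV (c := 1)).
pose Me n := \sum_(0 <= k < n) e k.
have Exi n : \int[Q]_x xi n x = Me n.
  rewrite Rint_sum; first by apply: eq_bigr => k _; exact: EX.
  by move=> k; exact: (iV (c := w k)).
have Me0 n : 0 <= Me n by exact: sumr_ge0.
have lnoo : ln (n%:R : R) @[n --> \oo] --> +oo by apply: cvgn_ln; exact: cvgr_idn.
have aw k : 0 < abar k.+1 -> abar k.+1 * w k = 1.
  by move=> h; rewrite mulfV// gt_eqF.
have Mln : (ln n%:R)^-1 * Me n @[n --> \oo] --> (1 : R).
  rewrite -[X in _ --> X](mul1r 1).
  apply: (toeplitz _ _ lnoo (@harmonic_log_sum R)) => [n|eps eps0].
    by rewrite invr_ge0.
  near=> n; rewrite mul1r /e aw ?mul1r ?subrr ?normr0 ?mulr_ge0 ?invr_ge0 ?(ltW eps0)//.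
  apply: (@lt_le_trans _ _ (abar n)); last exact: a_le.
  by near: n; exact: (cvgry_gt aoo).
have Moo : Me n @[n --> \oo] --> +oo.
  apply/cvgryPge => K; near=> n.
  have l0 : 0 < ln (n%:R : R) by near: n; exact: (cvgry_gt lnoo).
  have l1 : 2 * `|K| <= ln (n%:R : R) by near: n; exact: (cvgry_ge lnoo).
  have : 2^-1 < (ln n%:R)^-1 * Me n.
    by near: n; apply: (cvgr_gt _ Mln); rewrite invf_lt1// ltr1n.
  rewrite ltr_pdivlMl// => /ltW; apply: le_trans; apply: (le_trans (ler_norm K)).
  by rewrite ler_pdivlMr// mulrC.
(* The 2 counts both orders of a pair, C + 2 compares [g j] with abar j.+1 / j.+1, and B + C1 C
   absorbs the additive constant of [sum_ratio_le] through 1 = abar * w <= C abar. *)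
pose C2 := 2 * ((C + 2) * (B + C1 * C)).
have C20 : 0 <= C2 by rewrite !mulr_ge0 ?addr_ge0// mulr_ge0.
have int2 n : \int[Q]_x (xi n x) ^+ 2 <= Me n ^+ 2 + C2 * (1 + Me n).
  rewrite /xi (@Rint_square n X w)// /Me square_sum.
  apply: (@le_trans _ _ (\sum_(0 <= k < n)
      (e k ^+ 2 + 2 * \sum_(0 <= j < k) e j * e k + C2 * e k))); last first.
    by rewrite big_split/= -mulr_sumr lerD2l ler_wpM2l// lerDr.
  apply: ler_sum => k _.
  pose g j := (abar j.+1 + 2 * abar j.+1 ^+ 2) * (w j * w k) / (j.+1%:R * k.+1%:R).
  have E j : (j <= k)%N -> \int[Q]_x (X j x * X k x) <= e j * e k + g j.
    move=> jk; have iNN : Q.-integrable setT (EFin \o (fun x => N j.+1 x * N k.+1 x)).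
      apply: (iV (c := j.+1%:R * k.+1%:R)); first exact: measurable_funM.
      move=> x; have /andP[? ?] := Nn j.+1 x; have /andP[? ?] := Nn k.+1 x.
      by rewrite mulr_ge0//= ler_pM.
    have -> : \int[Q]_x (X j x * X k x) =
        \int[Q]_x (N j.+1 x * N k.+1 x) * (w j * w k / (j.+1%:R * k.+1%:R)).
      rewrite -RintegralZr//; apply: eq_Rintegral => x _; rewrite /X invfM; ring.
    apply: (@le_trans _ _ ((abar j.+1 * abar k.+1 + abar j.+1 + 2 * abar j.+1 ^+ 2) *
        (w j * w k / (j.+1%:R * k.+1%:R)))).
      by apply: ler_wpM2r; [rewrite !mulr_ge0// invr_ge0 mulr_ge0|exact: count_covariance].
    by rewrite le_eqVlt; apply/orP; left; apply/eqP; rewrite /e /g invfM; ring.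
  have g0 j : 0 <= g j.
    by rewrite !mulr_ge0 ?invr_ge0 ?mulr_ge0// addr_ge0// mulr_ge0// sqr_ge0.
  have gk : 2 * \sum_(0 <= j < k.+1) g j <= C2 * e k.
    rewrite /C2 -mulrA; apply: ler_wpM2l => //.
    have gj j : g j <= (C + 2) * (w k / k.+1%:R) * (abar j.+1 / j.+1%:R).
      rewrite /g [leLHS](_ : _ = ((abar j.+1 * w j) + 2 * (abar j.+1 * w j) * abar j.+1) *
        (w k / (j.+1%:R * k.+1%:R))); last by ring.
      rewrite [leRHS](_ : _ = ((C + 2) * abar j.+1) *
        (w k / (j.+1%:R * k.+1%:R))); last by rewrite invfM; ring.
      apply: ler_wpM2r; first by rewrite mulr_ge0// invr_ge0 mulr_ge0.
      have [aj|] := ltP 0 (abar j.+1).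
        rewrite aw// mulr1 [leRHS]mulrDl lerD2r -[leLHS](aw _ aj) mulrC.
        exact: ler_wpM2r.
      move=> h; have -> : abar j.+1 = 0 by apply/eqP; rewrite eq_le h a0.
      by rewrite !(mulr0, mul0r) addr0.
    apply: (@le_trans _ _ (\sum_(0 <= j < k.+1)
        (C + 2) * (w k / k.+1%:R) * (abar j.+1 / j.+1%:R))); first exact: ler_sum.
    rewrite -mulr_sumr -[leLHS]mulrA -[leRHS]mulrA; apply: ler_wpM2l; first by rewrite addr_ge0.
    have [ak|] := ltP 0 (abar k.+1); last first.
      move=> h; have h0 : abar k.+1 = 0 by apply/eqP; rewrite eq_le h a0.
      by rewrite /e /w h0 invr0 !(mul0r, mulr0).
    apply: (@le_trans _ _ (w k / k.+1%:R * (B * abar k.+1 + C1))).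
      by apply: ler_wpM2l; [rewrite mulr_ge0|exact: BC].
    rewrite /e [leRHS](_ : _ = w k / k.+1%:R * (B * abar k.+1 + C1 * C * abar k.+1)); last by ring.
    apply: ler_wpM2l; first by rewrite mulr_ge0.
    rewrite lerD2l -mulrA -[leLHS]mulr1; apply: ler_wpM2l => //.
    by rewrite -(aw _ ak) mulrC; apply: ler_wpM2r.
  have h1 : \int[Q]_x X k x ^+ 2 <= e k ^+ 2 + g k.
    by under eq_Rintegral do rewrite expr2; rewrite expr2; exact: E.
  have h2 : \sum_(0 <= j < k) \int[Q]_x (X j x * X k x) <=
      \sum_(0 <= j < k) e j * e k + \sum_(0 <= j < k) g j.
    by rewrite -big_split/=; apply: ler_sum_nat => j /andP[_ jk]; apply: E; exact: ltnW.
  rewrite big_nat_recr//= in gk.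
  apply: le_trans (lerD h1 (ler_wpM2l _ h2)) _ => //.
  have gk0 := g0 k; set S1 := \sum_(0 <= j < k) e j * e k; set S2 := \sum_(0 <= j < k) g j.
  rewrite -/S2 in gk; rewrite [leLHS](_ : _ = e k ^+ 2 + 2 * S1 + (g k + 2 * S2)); last by ring.
  rewrite lerD2l; apply: le_trans gk; rewrite mulrDr addrC lerD2l.
  by rewrite mulrDl mul1r lerDl.
have Exi' : (fun n => \int[Q]_x xi n x) = Me by apply/funext => n; exact: Exi.
have := @l2_strong_law _ _ _ Q xi (fun n => \sum_(0 <= k < n) w k) 1 C2.
rewrite Exi'; have mxi n : measurable_fun setT (xi n) by exact: measurable_sum.
have xic n x : 0 <= xi n x <= \sum_(0 <= k < n) w k.
  apply/andP; split; first by apply: sumr_ge0 => k _; have /andP[] := Xc k x.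
  by apply: ler_sum => k _; have /andP[] := Xc k x.
have xiS n x : xi n x <= xi n.+1 x.
  by rewrite /xi big_nat_recr//= lerDl; have /andP[] := Xc n x.
have MS n : Me n.+1 <= Me n + 1.
  rewrite /Me big_nat_recr//= lerD2l /e.
  have [ak|] := ltP 0 (abar n.+1); first by rewrite aw// mul1r invf_le1 ?ltr0n// ler1n.
  move=> h; have -> : abar n.+1 = 0 by apply/eqP; rewrite eq_le h a0.
  by rewrite !mul0r.
move=> /(_ mxi xic xiS Moo MS int2); apply: filterS => x h.
rewrite -[X in _ --> X](mulr1 1).
apply: (cvg_trans _ (cvgM Mln h)); apply: near_eq_cvg; near=> n.
have Mn : 0 < Me n by near: n; exact: (cvgry_gt Moo).
by rewrite /= -mulrA [Me n * _]mulrCA divff ?gt_eqF// mulr1.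
Unshelve. all: by end_near. Qed.

End chung_erdos.

(** * The ratio ergodic theorem *)

Section hopf.
Context {d} {T : measurableType d} {R : realType}.
Variables (mu : {measure set T -> \bar R}) (f : T -> T).
Hypothesis mf : measurable_fun setT f.
Hypothesis inv : invariant_measure mu f.
Implicit Types (phi psi : T -> R) (x : T) (n : nat).

Definition ergodic_sum phi n x : R := \sum_(0 <= i < n) phi (iter i f x).

Lemma ergodic_sumS phi n x : ergodic_sum phi n.+1 x = phi x + ergodic_sum phi n (f x).
Proof.
rewrite /ergodic_sum big_nat_recl//=; congr (_ + _).
by apply: eq_bigr => i _; rewrite -iterSr.
Qed.

Lemma measurable_iter_map n : measurable_fun setT (iter n f).
Proof.
elim: n => [|n IH]; first exact: measurable_id.
exact: measurableT_comp mf IH.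
Qed.

Lemma measurable_ergodic_sum phi n : measurable_fun setT phi ->
  measurable_fun setT (ergodic_sum phi n).
Proof.
move=> mp; apply: measurable_sum => i.
exact: measurableT_comp mp (measurable_iter_map i).
Qed.

Lemma ergodic_sumD phi psi n x :
  ergodic_sum (fun y => phi y + psi y) n x = ergodic_sum phi n x + ergodic_sum psi n x.
Proof. by rewrite /ergodic_sum big_split. Qed.

Lemma ergodic_sumZ (c : R) phi n x :
  ergodic_sum (fun y => c * phi y) n x = c * ergodic_sum phi n x.
Proof. by rewrite /ergodic_sum mulr_sumr. Qed.

(** The maximum of the ergodic sums of lengths 0 to n, with the first step split off so that the
    maximal inequality is a one-line comparison with the shifted path. *)
Fixpoint max_sum phi n x : R :=
  if n is m.+1 then Num.max 0 (phi x + max_sum phi m (f x)) else 0.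

Lemma max_sum_ge0 phi n x : 0 <= max_sum phi n x.
Proof. by case: n => //= n; rewrite le_max lexx. Qed.

Lemma max_sum_leS phi n x : max_sum phi n x <= max_sum phi n.+1 x.
Proof.
elim: n x => [|n IH] x; first by rewrite /= le_max lexx.
rewrite [leLHS]/= [leRHS]/=; rewrite ge_max le_max lexx/= le_max; apply/orP; right.
by rewrite lerD2l; exact: IH.
Qed.

Lemma ergodic_sum_le_max phi n x : ergodic_sum phi n x <= max_sum phi n x.
Proof.
elim: n x => [|n IH] x; first by rewrite /ergodic_sum big_geq.
by rewrite ergodic_sumS /= le_max lerD2l IH orbT.
Qed.

Lemma measurable_max_sum phi n : measurable_fun setT phi ->
  measurable_fun setT (max_sum phi n).
Proof.
move=> mp; elim: n => [|n IH] /=; first exact: measurable_cst.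
apply: measurable_maxr => //; apply: measurable_funD => //.
exact: measurableT_comp IH mf.
Qed.

Lemma integral_invariant (g : T -> \bar R) : measurable_fun setT g ->
  (forall x, 0 <= g x)%E -> (\int[mu]_x g (f x) = \int[mu]_x g x)%E.
Proof.
move=> mg g0.
have := ge0_integral_pushforward mf mu measurableT mg (fun x _ => g0 x).
rewrite preimage_setT => <-.
by apply: eq_measure_integral => B mB _; exact: inv.
Qed.

Lemma integrable_invariant phi : mu.-integrable setT (EFin \o phi) ->
  mu.-integrable setT (EFin \o (phi \o f)).
Proof.
move=> /integrableP[mp fp]; apply/integrableP; split.
  exact: measurableT_comp mp mf.
rewrite (@integral_invariant (fun x => `|(phi x)%:E|%E))//.
exact: measurableT_comp mp.
Qed.

Lemma Rintegral_invariant phi : measurable_fun setT phi -> (forall x, 0 <= phi x) ->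
  \int[mu]_x phi (f x) = \int[mu]_x phi x.
Proof.
move=> mp p0; rewrite /Rintegral; congr fine.
by rewrite (@integral_invariant (EFin \o phi))//; exact/measurable_EFinP.
Qed.

Lemma integrable_max_sum phi n : mu.-integrable setT (EFin \o phi) ->
  mu.-integrable setT (EFin \o max_sum phi n).
Proof.
move=> ip; have mp : measurable_fun setT phi.
  by apply/measurable_EFinP; exact: (measurable_int mu ip).
elim: n => [|n IH]; first exact: integrable0.
have i1 : mu.-integrable setT (EFin \o (fun x => `|phi x| + max_sum phi n (f x))).
  exact: (integrableD measurableT (integrable_abse ip) (integrable_invariant IH)).
apply: (le_integrable measurableT _ _ i1).
  by apply/measurable_EFinP; exact: measurable_max_sum.
move=> x _; rewrite lee_fin ger0_norm ?max_sum_ge0// ger0_norm; last first.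
  by rewrite addr_ge0// max_sum_ge0.
by rewrite /= ge_max addr_ge0 ?max_sum_ge0//= lerD2r ler_norm.
Qed.

(* On {max_sum > 0} the maximum is attained by a nonempty sum, so
   max_sum phi n x <= phi x + max_sum phi n (f x). *)
Lemma maximal_inequality phi n : mu.-integrable setT (EFin \o phi) ->
  0 <= \int[mu]_x (phi x * \1_[set y | 0 < max_sum phi n y] x).
Proof.
move=> ip; have mp : measurable_fun setT phi.
  by apply/measurable_EFinP; exact: (measurable_int mu ip).
pose m := max_sum phi n.
have mm : measurable_fun setT m by exact: measurable_max_sum.
have im : mu.-integrable setT (EFin \o m) by exact: integrable_max_sum.
have imf : mu.-integrable setT (EFin \o (m \o f)) by exact: integrable_invariant.
have mE : measurable [set y | 0 < m y].
  rewrite (_ : [set y | 0 < m y] = m @^-1` `]0, +oo[%classic); last first.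
    by apply/seteqP; split => y /=; rewrite in_itv/= andbT.
  by rewrite -[X in measurable X]setTI; exact: mm.
have iE : mu.-integrable setT (EFin \o (fun x => phi x * \1_[set y | 0 < m y] x)).
  apply: (le_integrable measurableT _ _ ip).
    by apply/measurable_EFinP; apply: measurable_funM => //; exact: measurable_indic.
  move=> x _; rewrite /= lee_fin normrM indicE.
  by case: (_ \in _); rewrite ?normr1 ?normr0 ?mulr1 ?mulr0.
have E0 : \int[mu]_x (m x - m (f x)) = 0.
  rewrite RintegralB// (Rintegral_invariant mm) ?subrr// => x.
  exact: max_sum_ge0.
rewrite -{1}E0; apply: le_Rintegral => //; first exact: (integrableB measurableT im imf).
move=> x _; rewrite indicE.
have m0 := max_sum_ge0 phi n (f x).
case: (boolP (x \in _)) => [|]; rewrite ?inE ?notin_setE /=.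
  rewrite mulr1 lerBlDr /m; case: (n) m0 => [|k] m0 h; first by rewrite ltxx in h.
  rewrite /= in h *; rewrite lt_max ltxx/= in h.
  rewrite ge_max (le_trans (ltW h)) ?lerD2l ?max_sum_leS//=.
move=> /negP; rewrite -leNgt mulr0 => h; rewrite subr_le0.
exact: (le_trans h).
Qed.

(** The sets where [max_sum] is positive increase to a set of full measure, and dominated
    convergence removes the indicator from the maximal inequality. *)
Lemma maximal_ergodic phi : mu.-integrable setT (EFin \o phi) ->
  {ae mu, forall x, exists n, 0 < ergodic_sum phi n x} -> 0 <= \int[mu]_x phi x.
Proof.
move=> ip pos.
have mp : measurable_fun setT phi.
  by apply/measurable_EFinP; exact: (measurable_int mu ip).
pose E n := [set y | 0 < max_sum phi n y].
have mE n : measurable (E n).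
  rewrite (_ : E n = max_sum phi n @^-1` `]0, +oo[%classic); last first.
    by apply/seteqP; split => y /=; rewrite in_itv/= andbT.
  by rewrite -[X in measurable X]setTI; exact: measurable_max_sum.
pose g n x := (phi x * \1_(E n) x)%:E.
have mg n : measurable_fun setT (g n).
  by apply/measurable_EFinP; apply: measurable_funM => //; exact: measurable_indic.
have cg : {ae mu, forall x, setT x -> g n x @[n --> \oo] --> (phi x)%:E}.
  apply: filterS pos => x [n0 hn0] _.
  apply: cvg_near_cst; near=> n.
  rewrite /g indicE mem_set ?mulr1// /E/=.
  apply: (lt_le_trans hn0); apply: (le_trans (ergodic_sum_le_max _ _ _)).
  have hm : {homo (max_sum phi ^~ x) : m n / (m <= n)%N >-> m <= n}.
    by apply: homo_leq => [//|y a b|k]; [exact: le_trans|exact: max_sum_leS].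
  by apply: hm; near: n; exact: nbhs_infty_ge.
have dom : {ae mu, forall x n, setT x -> (`|g n x| <= `|(phi x)%:E|)%E}.
  apply: aeW => x n _; rewrite /g lee_fin normrM indicE.
  by case: (_ \in _); rewrite ?normr1 ?normr0 ?mulr1 ?mulr0.
have [_ _ cv] := dominated_convergence measurableT mg (measurable_int mu ip) cg
  (integrable_abse ip) dom.
apply: fine_ge0; apply: (cvge_to_ge cv); apply: nearW => n.
have ign : mu.-integrable setT (g n).
  apply: (le_integrable measurableT (mg n) _ ip) => x _.
  by rewrite /g /= lee_fin normrM indicE; case: (_ \in _);
    rewrite ?normr1 ?normr0 ?mulr1 ?mulr0.
rewrite /= -(fineK (integrable_fin_num measurableT ign)) lee_fin.
exact: maximal_inequality.
Unshelve. all: by end_near. Qed.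

Hypothesis erg : ergodic mu f.

(** Paths with sums unbounded above form an invariant set. Ergodicity makes it null or of full
    measure, and full measure would contradict the sign of the integral by [maximal_ergodic]. *)
Lemma ergodic_sum_bounded psi : mu.-integrable setT (EFin \o psi) ->
  \int[mu]_x psi x < 0 ->
  {ae mu, forall x, exists C, forall n, ergodic_sum psi n x <= C}.
Proof.
move=> ip neg; have mp : measurable_fun setT psi.
  by apply/measurable_EFinP; exact: (measurable_int mu ip).
pose E (C n : nat) := [set x | C%:R < ergodic_sum psi n x].
have mE C n : measurable (E C n).
  rewrite (_ : E C n = ergodic_sum psi n @^-1` `]C%:R, +oo[%classic); last first.
    by apply/seteqP; split => y /=; rewrite in_itv/= andbT.
  by rewrite -[X in measurable X]setTI; exact: measurable_ergodic_sum.
pose B := \bigcap_C \bigcup_n E C n.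
have mB : measurable B.
  by apply: bigcap_measurableType => C _; apply: bigcup_measurable => n _.
have invB : f @^-1` B = B.
  apply/seteqP; split => x h C _.
    have [n _ hn] := h (Num.truncn (C%:R + `|psi x|)).+1 I; exists n.+1 => //.
    rewrite /E/= ergodic_sumS; move: hn; rewrite /E/=.
    have := truncnS_gt (C%:R + `|psi x|).
    have := ler_norm (- psi x); rewrite normrN => h1 h2 h3.
    have h4 := lt_trans h2 h3; lra.
  have [[|n] _ hn] := h (Num.truncn (C%:R + `|psi x|)).+1 I.
    by move: hn; rewrite /E/= /ergodic_sum big_geq// ltNge ler0n.
  exists n => //; move: hn; rewrite /E/= ergodic_sumS.
  have := truncnS_gt (C%:R + `|psi x|).
  have := ler_norm (psi x) => h1 h2 h3.
  have h4 := lt_trans h2 h3; lra.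
have [B0|B0] := erg mB invB.
  exists B; split => // x /= nx; apply: contrapT => nB; apply: nx.
  have [C hC] : exists C : nat, forall n, ~ C%:R < ergodic_sum psi n x.
    apply: contrapT => h; apply: nB => C _; apply: contrapT => h'; apply: h; exists C => n hn.
    by apply: h'; exists n.
  by exists C%:R => n; rewrite leNgt; apply/negP; exact: hC.
have := @maximal_ergodic psi ip; rewrite leNgt neg/= => h; exfalso.
suff /h : {ae mu, forall x, exists n, 0 < ergodic_sum psi n x} by [].
exists (~` B); split => //; first exact: measurableC.
move=> x nx Bx; apply: nx; have [n _ hn] := Bx 0%N I.
by exists n.
Qed.

Let ratio_bound (s p k h C1 C2 D1 D2 : R) : C1 <= D1 -> C2 <= D2 -> 0 <= D1 ->
  0 <= D2 -> D1 + D2 <= h -> k <= h -> - s + (p - k) <= C1 -> s - (p + k) <= C2 ->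
  `|s - p| <= h + h.
Proof. by move=> *; rewrite ler_norml; apply/andP; split; lra. Qed.

(** Both phi - (q + 1/k) 1_A and (q - 1/k) 1_A - phi have negative integral, so their ergodic sums
    are bounded above almost everywhere. The bounds are absorbed by the visits to A, which tend to
    infinity. *)
Lemma ergodic_ratio (A : set T) phi (q : R) : measurable A -> mu A = 1%E ->
  mu.-integrable setT (EFin \o phi) -> q = \int[mu]_x phi x ->
  {ae mu, forall x, ergodic_sum \1_A n x @[n --> \oo] --> +oo} ->
  {ae mu, forall x, forall e : R, 0 < e -> \forall n \near \oo,
    `|ergodic_sum phi n x - q * ergodic_sum \1_A n x| <= e * ergodic_sum \1_A n x}.
Proof.
move=> mA A1 ip qE Noo.
have iA : mu.-integrable setT (EFin \o (\1_A : T -> R)).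
  apply/integrableP; split; first by apply/measurable_EFinP; exact: measurable_indic.
  rewrite (eq_integral (fun x => (\1_A x)%:E)).
    by rewrite integral_indic// setIT A1 ltry.
  by move=> x _; rewrite /= ger0_norm.
have EA : \int[mu]_x \1_A x = 1 :> R by rewrite /Rintegral integral_indic// setIT A1.
have one (s c : R) : s * q + c < 0 ->
    {ae mu, forall x, exists C, forall n,
      s * ergodic_sum phi n x + c * ergodic_sum \1_A n x <= C}.
  move=> sc.
  have i1 : mu.-integrable setT (EFin \o (fun x => s * phi x)).
    exact: (integrableZl measurableT s ip).
  have i2 : mu.-integrable setT (EFin \o (fun x => c * \1_A x)).
    exact: (integrableZl measurableT c iA).
  have := @ergodic_sum_bounded (fun x => s * phi x + c * \1_A x).
  move=> /(_ (integrableD measurableT i1 i2)).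
  rewrite RintegralD// !RintegralZl// EA mulr1 -qE => /(_ sc).
  apply: filterS => x [C hC]; exists C => n; apply: le_trans (hC n).
  by rewrite ergodic_sumD !ergodic_sumZ.
have up' k : {ae mu, forall x, exists C, forall n,
    1 * ergodic_sum phi n x + (- (q + k.+1%:R^-1)) * ergodic_sum \1_A n x <= C}.
  by apply: one; rewrite mul1r opprD addrA subrr sub0r oppr_lt0 invr_gt0.
have dn k : {ae mu, forall x, exists C, forall n,
    (-1) * ergodic_sum phi n x + (q - k.+1%:R^-1) * ergodic_sum \1_A n x <= C}.
  by apply: one; rewrite mulN1r addrA addNr sub0r oppr_lt0 invr_gt0.
have := ae_foralln up'; have := ae_foralln dn; move: Noo.
apply: filterS3 => x Noo hd hu e e0.
have [k ke] : exists k : nat, k.+1%:R^-1 <= e / 2.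
  exists (Num.truncn (e / 2)^-1); rewrite -[leRHS]invrK lef_pV2 ?posrE ?ltr0n//.
    exact/ltW/truncnS_gt.
  by rewrite invr_gt0 divr_gt0.
have [C1 h1] := hd k; have [C2 h2] := hu k.
near=> n.
have N0 : 0 <= ergodic_sum \1_A n x by near: n; exact: (cvgry_ge Noo).
have big : (`|C1| + `|C2|) / (e / 2) <= ergodic_sum \1_A n x.
  by near: n; exact: (cvgry_ge Noo).
rewrite ler_pdivrMr ?divr_gt0// mulrC in big.
have g1 := h1 n; have g2 := h2 n.
have kN := ler_wpM2r N0 ke.
have c1 := ler_norm C1; have c2 := ler_norm C2.
have c1' := normr_ge0 C1; have c2' := normr_ge0 C2.
set s := ergodic_sum phi n x in g1 g2 *; set t := ergodic_sum \1_A n x in N0 big g1 g2 kN *.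
rewrite mulN1r mulrBl in g1; rewrite mul1r mulNr mulrDl in g2.
rewrite [leRHS](_ : _ = e / 2 * t + e / 2 * t); last by field.
exact: ratio_bound c1 c2 c1' c2' big kN g1 g2.
Unshelve. all: by end_near. Qed.

End hopf.

(** * Occupation times *)

Section transfer.
Context {R : realType}.
Variables (abar b t : nat -> R) (c q : R).
Hypothesis c0 : 0 < c.
Hypothesis aoo : abar n @[n --> \oo] --> +oo.
Hypothesis b0 : forall n, 0 <= b n.
Hypothesis ab : abar n / (c * b n) @[n --> \oo] --> (1 : R).
Hypothesis t_nd : {homo t : m n / (m <= n)%N >-> m <= n}.
Hypothesis t0 : forall n, 0 <= t n.

Let ratio : abar n / b n @[n --> \oo] --> c.
Proof.
rewrite -[X in _ --> X]mulr1.
have E : (fun n => abar n / b n) = (fun n => c * (abar n / (c * b n))).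
  by apply/funext => n; rewrite invfM [RHS]mulrCA (mulrA c) mulfV ?mul1r// gt_eqF.
by rewrite E; exact: cvgMr.
Qed.

Let b_gt0 : \forall n \near \oo, 0 < b n.
Proof.
near=> n; rewrite lt_def b0 andbT; apply/negP => /eqP bn.
have : 0 < abar n / b n by near: n; exact: (cvgr_gt _ ratio).
by rewrite bn invr0 mulr0 ltxx.
Unshelve. all: by end_near. Qed.

Let near_c (e : R) : 0 < e -> \forall n \near \oo, `|abar n / b n - c| <= e.
Proof.
by move=> e0; have /cvgrPdist_lt/(_ e e0) := ratio; apply: filterS => n; rewrite distrC => /ltW.
Qed.

Lemma log_average_transfer (s : nat -> R) :
  (forall e : R, 0 < e -> \forall n \near \oo, `|s n - q * t n| <= e * t n) ->
  (ln n%:R)^-1 * (\sum_(0 <= k < n) t k.+1 / abar k.+1 / k.+1%:R)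
    @[n --> \oo] --> (1 : R) ->
  (forall n, 0 <= abar n) ->
  (ln k%:R)^-1 * (\sum_(1 <= n < k.+1 | 0 < b n) s n / b n * n%:R^-1)
    @[k --> \oo] --> c * q.
Proof.
move=> st H abar0.
have E : (fun k : nat => (ln k%:R)^-1 * (\sum_(1 <= n < k.+1 | 0 < b n) s n / b n * n%:R^-1)) =
   (fun k => (ln k%:R)^-1 * (\sum_(0 <= n < k) (if 0 < b n.+1 then s n.+1 / b n.+1 * n.+1%:R^-1 else 0))).
  by apply/funext => k; rewrite big_mkcond big_add1.
rewrite E -[X in _ --> X]mulr1.
apply: (toeplitz _ _ _ H) => [n|e e0|]; first by rewrite !divr_ge0.
- have K0 : 0 < c + 1 + `|q| by rewrite ltr_wpDr// addr_gt0.
  (* The two relative errors combine to dl (c + dl + |q|), which is at most [e] once dl <= 1. *)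
  pose dl := Num.min 1 (e / (c + 1 + `|q|)).
  have dl0 : 0 < dl by rewrite lt_min ltr01 divr_gt0.
  have dl1 : dl <= 1 by rewrite ge_min lexx.
  have dle : dl * (c + 1 + `|q|) <= e by rewrite -ler_pdivlMr// ge_min lexx orbT.
  have nS (Pr : nat -> Prop) : (\forall n \near \oo, Pr n) -> \forall n \near \oo, Pr n.+1.
    by move=> [N _ hN]; exists N => // n /= Nn; apply: hN; exact: leqW.
  have n1 := nS _ b_gt0; have n2 := nS _ (cvgry_gt aoo 0).
  have n3 := nS _ (st dl dl0); have n4 := nS _ (near_c dl0).
  near=> n.
  have bn : 0 < b n.+1 by near: n; exact: n1.
  have an : 0 < abar n.+1 by near: n; exact: n2.
  have h1 : `|s n.+1 - q * t n.+1| <= dl * t n.+1 by near: n; exact: n3.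
  have h2 : `|abar n.+1 / b n.+1 - c| <= dl by near: n; exact: n4.
  rewrite bn.
  rewrite [X in `|X|](_ : _ = ((s n.+1 - q * t n.+1) / abar n.+1 * (abar n.+1 / b n.+1) +
    q * (t n.+1 / abar n.+1) * (abar n.+1 / b n.+1 - c)) / n.+1%:R); last first.
    have fe (S B Aa X y : R) : B != 0 -> Aa != 0 ->
        S / B * y - c * q * (X / Aa * y) =
        ((S - q * X) / Aa * (Aa / B) + q * (X / Aa) * (Aa / B - c)) * y.
      by move=> ? ?; field; apply/andP.
    by apply: fe; rewrite gt_eqF.
  rewrite normrM [`|_^-1|]ger0_norm ?invr_ge0// [leRHS]mulrA; apply: ler_wpM2r; first by rewrite invr_ge0.
  apply: le_trans (ler_normD _ _) _.
  have r1 : `|abar n.+1 / b n.+1| <= c + dl.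
    rewrite -[X in `|X|](subrK c) addrC; apply: le_trans (ler_normD _ _) _.
    by rewrite gtr0_norm// lerD2l.
  have ta : 0 <= t n.+1 / abar n.+1 by rewrite divr_ge0// ltW.
  apply: (@le_trans _ _ (dl * (t n.+1 / abar n.+1) * (c + dl) +
      `|q| * (t n.+1 / abar n.+1) * dl)).
    apply: lerD.
      rewrite normrM; apply: ler_pM => //.
      rewrite normrM [`|_^-1|]ger0_norm ?invr_ge0 ?(ltW an)// mulrA.
      by apply: ler_wpM2r => //; rewrite invr_ge0 ltW.
    rewrite 2!normrM [`|t _ / _|]ger0_norm//.
    by apply: ler_wpM2l => //; rewrite mulr_ge0.
  rewrite [leLHS](_ : _ = (dl * (c + dl + `|q|)) * (t n.+1 / abar n.+1)); last by ring.
  apply: ler_wpM2r => //; apply: le_trans dle; apply: ler_wpM2l; first exact: ltW.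
  by rewrite lerD2r lerD2l.
- by apply: cvgn_ln; exact: cvgr_idn.
Unshelve. all: by end_near. Qed.

(** Two replacements of different nature. The weights 1/abar become 1/b by Toeplitz's lemma, as the
    increments of t are nonnegative; then t becomes s by summation by parts, which needs 1/b
    monotone. Finally ln b and ln abar are asymptotic because abar / b has a positive limit. *)
Lemma chung_erdos_transfer (s : nat -> R) N0 :
  (forall n, (N0 <= n)%N -> b n <= b n.+1) ->
  (forall e : R, 0 < e -> \forall n \near \oo, `|s n - q * t n| <= e * t n) ->
  (ln (abar n))^-1 * (\sum_(0 <= k < n) (t k.+1 - t k) / abar k.+1)
    @[n --> \oo] --> (1 : R) ->
  (forall n, 0 <= abar n) ->
  (ln (b k))^-1 * (\sum_(1 <= n < k.+1 | 0 < b n) (s n - s n.-1) / b n)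
    @[k --> \oo] --> c * q.
Proof.
move=> b_nd st H abar0.
have lnoo : ln (abar n) @[n --> \oo] --> +oo by exact: cvgn_ln.
have E : (fun k : nat => (ln (b k))^-1 * (\sum_(1 <= n < k.+1 | 0 < b n) (s n - s n.-1) / b n)) =
   (fun k => (ln (b k))^-1 * (\sum_(0 <= n < k) (s n.+1 - s n) * (b n.+1)^-1)).
  apply/funext => k; congr (_ * _); rewrite big_mkcond big_add1/=.
  apply: eq_bigr => n _; case: ltP => // h.
  have -> : b n.+1 = 0 by apply/eqP; rewrite eq_le h b0.
  by rewrite invr0 mulr0.
rewrite E.
have H1 : (ln (abar n))^-1 * (\sum_(0 <= k < n) (t k.+1 - t k) * (b k.+1)^-1)
    @[n --> \oo] --> c.
  rewrite -[X in _ --> X]mulr1; apply: (toeplitz _ _ _ H) => [n|e e0|//].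
    by rewrite divr_ge0// subr_ge0 t_nd.
  have [N _ hN] := near_c e0; have [N1 _ hN1] := cvgry_gt aoo 0; have [N2 _ hN2] := b_gt0.
  exists (maxn N (maxn N1 N2)) => // n /=; rewrite !geq_max => /and3P[n1 n2 n3].
  have h1 := hN n.+1 (leqW n1); have h2 := hN1 n.+1 (leqW n2); have h3 := hN2 n.+1 (leqW n3).
  rewrite [X in `|X|](_ : _ = (t n.+1 - t n) / abar n.+1 * (abar n.+1 / b n.+1 - c)); last first.
    have fe (S B Aa : R) : B != 0 -> Aa != 0 ->
      S / B - c * (S / Aa) = S / Aa * (Aa / B - c) by move=> ? ?; field; apply/andP.
    by apply: fe; rewrite gt_eqF.
  rewrite normrM [X in X * _]ger0_norm ?divr_ge0 ?subr_ge0 ?t_nd// mulrC.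
  by apply: ler_wpM2r; rewrite ?divr_ge0 ?subr_ge0 ?t_nd.
have [N2 _ hN2] := b_gt0.
have H2 := @abel_transfer _ (fun n => (b n)^-1) s t _ q c (maxn N0 N2) _ t0 st lnoo H1.
have {}H2 : (ln (abar k))^-1 * (\sum_(0 <= n < k) (s n.+1 - s n) * (b n.+1)^-1)
    @[k --> \oo] --> q * c.
  apply: H2 => n; rewrite geq_max => /andP[n0 n2].
  have bn := hN2 n n2; have bn1 := hN2 n.+1 (leqW n2).
  by rewrite invr_ge0 (ltW bn1) lef_pV2 ?posrE//= b_nd.
have boo : ln (b n) @[n --> \oo] --> +oo.
  apply: cvgn_ln; apply/cvgryPge => M; near=> n.
  have bn : 0 < b n by near: n; exact: b_gt0.
  have h2 : `|abar n / b n - c| <= 1 by near: n; exact: near_c.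
  have h3 : `|M| * (c + 1) <= abar n by near: n; exact: (cvgry_ge aoo).
  have h4 : abar n / b n <= c + 1.
    by rewrite -lerBlDl; exact: le_trans (ler_norm _) h2.
  rewrite ler_pdivrMr// in h4; have h5 := le_trans h3 h4.
  rewrite mulrC ler_pM2l ?addr_gt0// in h5.
  exact: le_trans (ler_norm _) h5.
have lnratio : (ln (b n))^-1 * ln (abar n) @[n --> \oo] --> (1 : R).
  have l1 : ln (abar n / b n) @[n --> \oo] --> ln c.
    by apply: (cvg_comp _ _ ratio); exact: continuous_ln.
  have l3 : 1 + (ln (b n))^-1 * ln (abar n / b n) @[n --> \oo] --> 1 + 0 * ln c.
    by apply: cvgD; [exact: cvg_cst|exact: cvgM (cvgn_inv0 boo) l1].
  rewrite mul0r addr0 in l3.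
  apply: (cvg_trans _ l3); apply: near_eq_cvg; near=> n.
  have bn : 0 < b n by near: n; exact: b_gt0.
  have an : 0 < abar n by near: n; exact: (cvgry_gt aoo).
  have lb : 0 < ln (b n) by near: n; exact: (cvgry_gt boo).
  rewrite /= lnM ?posrE ?invr_gt0// lnV ?posrE//.
  by field; rewrite gt_eqF.
rewrite mulrC -[X in _ --> X]mul1r.
apply: (cvg_trans _ (cvgM lnratio H2)); apply: near_eq_cvg; near=> n.
have la : 0 < ln (abar n) by near: n; exact: (cvgry_gt lnoo).
rewrite /= -mulrA; congr (_ * _).
by rewrite mulrA mulfV ?mul1r// gt_eqF.
Unshelve. all: by end_near. Qed.

End transfer.

Lemma ratio_shift (R : realType) (s N t : nat -> R) (q K : R) :
  N n @[n --> \oo] --> +oo -> (forall n, `|N n - t n| <= K) ->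
  (forall e : R, 0 < e -> \forall n \near \oo, `|s n - q * N n| <= e * N n) ->
  forall e : R, 0 < e -> \forall n \near \oo, `|s n - q * t n| <= e * t n.
Proof.
move=> Noo NK sN e e0; near=> n.
have K0 : 0 <= K by apply: le_trans (NK 0%N).
have h1 : `|s n - q * N n| <= e / 2 * N n.
  by near: n; apply: sN; rewrite divr_gt0.
have h2 : K + (e / 2)^-1 * ((e / 2 + `|q|) * K) <= N n by near: n; exact: (cvgry_ge Noo).
have h3 := NK n.
have h4 : N n <= t n + K by rewrite -lerBlDl (le_trans _ h3)// ler_norm.
have h5 : (e / 2)^-1 * ((e / 2 + `|q|) * K) <= t n.
  by rewrite -(lerD2l K) [K + t n]addrC (le_trans h2).
rewrite ler_pdivrMl ?divr_gt0// in h5.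
rewrite [X in `|X|](_ : _ = (s n - q * N n) + q * (N n - t n)); last by ring.
apply: le_trans (ler_normD _ _) _; rewrite normrM.
have h6 := ler_wpM2l (normr_ge0 q) h3.
apply: (le_trans (lerD h1 h6)).
apply: (@le_trans _ _ (e / 2 * (t n + K) + `|q| * K)).
  by rewrite lerD2r ler_wpM2l// divr_ge0// ltW.
rewrite mulrDr -addrA -mulrDl [leRHS](_ : _ = e / 2 * t n + e / 2 * t n); last by field.
by rewrite lerD2l.
Unshelve. all: by end_near. Qed.

Section occupation.
Context {R : realType} {A : countType} (a : A).
Variables (P : A -> A -> R) (pi : A -> R).
Variable rho : {measure set (Paths a) -> \bar R}.
Hypothesis mk : markov_measure P pi rho.
Hypothesis inv : invariant_measure rho (left_shift a).
Hypothesis cons : conservative rho (left_shift a).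
Hypothesis erg : ergodic rho (left_shift a).
Hypothesis rhoA : rho (state_set a) = 1%E.
Local Notation T := (Paths a).
Local Notation Q := (base_probability rhoA).
Local Notation visit_count := (ergodic_sum (left_shift a) (\1_(state_set a) : T -> R)).

Let Vset k : set T := [set x : T | x k.+1%:Z = a].
Let V k (x : T) : R := \1_(Vset k) x.
Let v k : R := renewal_prob rho k.+1.

Let mVset k : measurable (Vset k). Proof. exact: measurable_coordinate. Qed.

Let VE k x : V k x = \1_(state_set a) (iter k.+1 (left_shift a) x).
Proof.
have e := shiftE k.+1 x 0; rewrite add0r in e.
rewrite /V !indicE; congr (nat_of_bool _)%:R; apply/idP/idP; rewrite !inE /Vset /state_set/=.
  by move=> xk; exact: etrans e xk.
by move=> xk; exact: etrans (esym e) xk.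
Qed.

Let EV k : \int[Q]_x V k x = v k.
Proof.
rewrite /Rintegral integral_indic// setIT [X in fine X](_ : _ = rho (Vset k `&` state_set a)).
  by rewrite setIC.
exact: base_probabilityE.
Qed.

Let EVV j k : (j < k)%N -> \int[Q]_x (V j x * V k x) = v j * v (k - j.+1)%N.
Proof.
move=> jk; transitivity (\int[Q]_x \1_(Vset j `&` Vset k) x).
  by apply: eq_Rintegral => x _; rewrite indicI.
rewrite /Rintegral integral_indic//; last exact: measurableI.
rewrite setIT [X in fine X](_ : _ = rho (Vset j `&` Vset k `&` state_set a)); last first.
  exact: base_probabilityE.
have := rho_two_visits mk inv rhoA (ltnW jk : (j.+1 <= k.+1)%N).
rewrite (_ : Vset j `&` Vset k `&` state_set a = state_set a `&` Vset j `&` Vset k); last first.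
  by rewrite setIC setIA.
by move=> E; rewrite E/= /v subSS subnSK.
Qed.

Lemma occupation_timeE n x : occupation_time n x = \sum_(0 <= j < n) V j x.
Proof. by rewrite /occupation_time big_add1/=; apply: eq_bigr => j _; rewrite VE. Qed.

Lemma return_sequenceE n : return_sequence rho n = \sum_(0 <= j < n) renewal_prob rho j.+1.
Proof.
rewrite /return_sequence; under eq_Rintegral do rewrite occupation_timeE.
have mA : measurable (state_set a : set T) by exact: measurable_state.
have iV k : rho.-integrable (state_set a) (EFin \o V k).
  apply/integrableP; split.
    by apply/measurable_EFinP; apply: measurable_funTS; exact: measurable_indic.
  rewrite (eq_integral (fun x => (V k x)%:E)); last by move=> x _; rewrite /= ger0_norm.
  rewrite integral_indic//; apply: (@le_lt_trans _ _ (rho (state_set a))).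
    by apply: le_measure; rewrite ?inE//; exact: measurableI.
  by rewrite rhoA ltry.
have [_ ->] := integrable_sum_seq (index_iota 0 n) mA iV.
apply: eq_bigr => j _; rewrite /Rintegral integral_indic//.
by rewrite setIC.
Qed.

Let V01 k x : 0 <= V k x <= 1.
Proof. by rewrite /V indicE; case: (_ \in _); rewrite ?ler01 ?lexx. Qed.

Let VV k x : V k x * V k x = V k x.
Proof. by rewrite /V indicE; case: (_ \in _); rewrite ?mulr1 ?mulr0. Qed.

Let v01 k : 0 <= v k <= 1. Proof. exact: renewal_prob01. Qed.

Lemma return_sequence_nd : {homo return_sequence rho : m n / (m <= n)%N >-> m <= n}.
Proof.
apply: homo_leq => [//|y x z|n]; first exact: le_trans.
by rewrite !return_sequenceE big_nat_recr//= lerDl; have /andP[] := v01 n.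
Qed.

Lemma return_sequence_ge0 n : 0 <= return_sequence rho n.
Proof.
by rewrite return_sequenceE; apply: sumr_ge0 => j _; have /andP[] := v01 j.
Qed.

(* If the renewal measure were bounded by K, its Laplace transform
   1 / (1 - E e^(-w tau)) would be, although it diverges as w -> 0. *)
Lemma return_sequence_infty : return_sequence rho n @[n --> \oo] --> +oo.
Proof.
apply/cvgryPge => K; apply: contrapT => nK.
have bnd n : return_sequence rho n <= K.
  rewrite leNgt; apply/negP => Kn; apply: nK; exists n => // m /= nm.
  by apply: (le_trans (ltW Kn)); exact: return_sequence_nd.
pose u := renewal_prob rho; pose f := return_prob rho.
have u01 m : 0 <= u m <= 1 by exact: renewal_prob01.
have f01 m : 0 <= f m <= 1 by exact: return_prob01.
have K0 : 0 <= K by apply: le_trans (bnd 0%N); rewrite return_sequence_ge0.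
have K1 : 0 < K + 1 by rewrite ltr_wpDl.
have AK w : 0 < w -> laplace_series u w <= K + 1.
  move=> w0; apply: limr_le; first exact: laplace_series_cvg.
  apply: nearW => n; apply: (@le_trans _ _ (\sum_(0 <= m < n) u m)).
    apply: ler_sum => m _; have /andP[um _] := u01 m.
    by rewrite -[leRHS]mulr1 ler_wpM2l// expR_le1 oppr_le0 mulr_ge0// ltW.
  case: n => [|n]; first by rewrite big_geq// ltW.
  rewrite big_nat_recl//= /u (renewal_prob0 inv rhoA) addrC lerD2r.
  by rewrite -return_sequenceE.
(* If f-mass above 1 - e is weighted by at least 1 - e, then 1 - laplace_series f w < 2e = 1/(K +
   1), so its product with the renewal transform, at most K + 1, would be less than 1. *)
pose e : R := (2 * (K + 1))^-1.
have e0 : 0 < e by rewrite invr_gt0 mulr_gt0.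
have e1 : e <= 1.
  by rewrite invf_le1 ?mulr_gt0//; lra.
have [n fn] : exists n, 1 - e < \sum_(0 <= k < n) f k.
  have := return_prob_sum inv rhoA cons => fs.
  have : (\sum_(0 <= k < n) (f k)%:E)%E @[n --> \oo] --> (1 : \bar R)%E.
    rewrite -fs; apply: is_cvg_nneseries => k _ _; rewrite lee_fin.
    by have /andP[] := f01 k.
  move=> /fine_cvg cf.
  have /cvgr_gt/(_ (1 - e)) : (fun n => \sum_(0 <= k < n) f k) @ \oo --> (1 : R).
    by apply: (cvg_trans _ cf); apply: near_eq_cvg; apply: nearW => n; rewrite /= sumEFin.
  rewrite ltrBlDr ltrDl => H; have [N _ hN] := H e0; exists N; exact: hN (leqnn N).
pose w : R := e / n.+1%:R.
have w0 : 0 < w by rewrite divr_gt0.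
have wn : 1 - e <= expR (- (w * n%:R)).
  apply: le_trans (expR_ge1Dx _); rewrite lerD2l lerN2 /w mulrAC ler_pdivrMr ?ltr0n//.
  by apply: ler_wpM2l; [exact: ltW|rewrite ler_nat].
have fw : (1 - e) * (1 - e) <= laplace_series f w.
  apply: le_trans (laplace_series_partial n f01 w0).
  apply: (@le_trans _ _ (\sum_(0 <= m < n) f m * (1 - e))).
    by rewrite -mulr_suml; apply: ler_wpM2r; [rewrite subr_ge0|exact: ltW].
  apply: ler_sum_nat => m /andP[_ mn]; have /andP[fm _] := f01 m.
  apply: ler_wpM2l => //; apply: (le_trans wn).
  by rewrite ler_expR lerN2 ler_wpM2l ?(ltW w0)// ler_nat ltnW.
have := renewal_laplace u01 f01 (renewal_equation mk inv rhoA) w0.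
have A0 : 0 <= laplace_series u w by apply: le_trans (laplace_series_partial 0 u01 w0); rewrite big_geq.
have fw2 : 1 - laplace_series f w < 2 * e by have := mulr_gt0 e0 e0; lra.
have l1 : laplace_series u w * (1 - laplace_series f w) <= laplace_series u w * (2 * e).
  by apply: ler_wpM2l => //; exact: ltW.
have [Az|Ap] := eqVneq (laplace_series u w) 0; first by rewrite Az mul0r => /eqP; rewrite eq_sym oner_eq0.
move=> E; have : laplace_series u w * (1 - laplace_series f w) < 1.
  apply: (@lt_le_trans _ _ (laplace_series u w * (2 * e))).
    by rewrite ltr_pM2l// lt_def Ap.
  apply: (@le_trans _ _ ((K + 1) * (2 * e))); first by rewrite ler_wpM2r ?AK// mulr_ge0// ltW.
  by rewrite /e le_eqVlt; apply/orP; left; apply/eqP; field; rewrite gt_eqF.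
by rewrite E ltxx.
Qed.

(** The set of paths with visits at arbitrarily late times is invariant. Were it null, almost every
    path starting at the state would have a last visit and lie in a preimage of [never]; countably
    many null sets would then cover a set of mass 1. *)
Lemma visits_infinite :
  {ae rho, forall x, visit_count n x @[n --> \oo] --> +oo}.
Proof.
pose B := \bigcap_n \bigcup_k path_shift (n + k) @^-1` state_set a : set T.
have mA : measurable (state_set a : set T) by exact: measurable_state.
have mB : measurable B.
  by apply: bigcap_measurableType => n _; apply: bigcup_measurable => k _; exact: measurable_shift_preimage.
have invB : left_shift a @^-1` B = B.
  apply/seteqP; split => x h n _.
    have [k _ hk] := h n I; exists k.+1 => //.
    by rewrite /= addnS /path_shift iterSr.
  have [k _ hk] := h n.+1 I; exists k => //.
  by rewrite /= /path_shift -iterSr; exact: hk.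
have null : rho (~` B) = 0%E.
  have [B0|//] := erg mB invB; exfalso.
  pose Z k := path_shift k @^-1` (@never A a) : set T.
  have mZ k : measurable (Z k) by apply: measurable_shift_preimage; exact: measurable_never.
  have Z0 k : rho (Z k) = 0%E.
    apply: etrans (shift_invariant inv k (@measurable_never A a)) _.
    exact: rho_never.
  have nZ : rho.-negligible (\bigcup_k Z k).
    by apply: negligible_bigcup => k; apply/negligibleP => //; exact: Z0.
  have nB : rho.-negligible B by apply/negligibleP.
  have : rho.-negligible (state_set a : set T).
    apply: (negligibleS _ (negligibleU nB nZ)) => x x0.
    have [Bx|nBx] := pselect (B x); [by left|right].
    have [n hn] : exists n, forall k, ~ state_set a (path_shift (n + k) x).
      apply: contrapT => h; apply: nBx => n _; apply: contrapT => h'; apply: h.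
      by exists n => k hk; apply: h'; exists k.
    have ex : exists m : nat, x m%:Z == a by exists 0%N; rewrite x0.
    have ub m : x m%:Z == a -> (m <= n)%N.
      move=> /eqP xm; rewrite leqNgt; apply/negP => nm; apply: (hn (m - n)%N).
      by rewrite /state_set/= shiftE add0r subnKC// ltnW.
    case: (ex_maxnP ex ub) => m /eqP xm mmax.
    exists m => //; split; first by rewrite /state_set/= shiftE add0r.
    move=> k [k0 xk _]; rewrite shiftE -PoszD in xk.
    by have := mmax _ (introT eqP xk); lia.
  move=> h; have : 1%E = 0%E :> \bar R.
    exact: etrans (esym rhoA) (measure_negligible mA h).
  by move=> /eqP; rewrite onee_eq0.
exists (~` B); split => //; first exact: measurableC.
move=> x nx Bx; apply: nx; apply/cvgryPge => K.
have hm : {homo (visit_count ^~ x) : m n / (m <= n)%N >-> m <= n}.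
  apply: homo_leq => [//|y u w|n]; first exact: le_trans.
  by rewrite /ergodic_sum big_nat_recr//= lerDl.
suff ex (N : nat) : exists n, N%:R <= visit_count n x.
  have [n hn] := ex (Num.truncn K).+1; exists n => // m /= nm.
  by apply: (le_trans (ltW (truncnS_gt K))); apply: (le_trans hn); exact: hm.
elim: N => [|N [n hn]]; first by exists 0%N; rewrite /ergodic_sum big_geq.
have [k _ hk] := Bx n I; exists (n + k).+1.
rewrite /ergodic_sum big_nat_recr//= -natr1; apply: lerD.
  by apply: (le_trans hn); apply: hm; exact: leq_addr.
by rewrite indicE mem_set.
Qed.

(** By invariance the exceptional set, intersected with the state, has rho-null preimages under all
    shifts, and almost every path visits the state at some time tau. *)
Lemma ae_first_visit (G : T -> Prop) : {ae Q, forall x, G x} ->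
  {ae rho, forall x, exists tau, G (path_shift tau x)}.
Proof.
move=> [Z [mZ QZ nG]].
have mA : measurable (state_set a : set T) by exact: measurable_state.
have mZA : measurable (Z `&` state_set a) by exact: measurableI.
have N k : rho.-negligible (path_shift k @^-1` (Z `&` state_set a)).
  apply/negligibleP; first exact: measurable_shift_preimage.
  apply: etrans (shift_invariant inv k mZA) _; apply: etrans QZ; apply: esym.
  exact: base_probabilityE.
have : {ae rho, forall x, ~ (\bigcup_k path_shift k @^-1` (Z `&` state_set a)) x}.
  have [Z' [mZ' Z'0 sub]] := negligible_bigcup N; exists Z'; split => //.
  by move=> x /= nx; apply: sub; apply: contrapT.
apply: filterS2 visits_infinite => x xoo nx.
have [n _ hn] := cvgry_ge xoo 1.
have : 1 <= visit_count n x by apply: hn => /=.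
rewrite /ergodic_sum => h.
have [k hk] : exists k, state_set a (iter k (left_shift a) x).
  apply: contrapT => nk; move: h; rewrite big1 ?ler10// => i _.
  by rewrite indicE memNset// => hi; apply: nk; exists i.
exists k; apply: contrapT => nGk; apply: nx; exists k => //; split => //.
exact: nG.
Qed.

Lemma visit_countS n x :
  visit_count n.+1 x = visit_count n x + \1_(state_set a) (path_shift n x).
Proof. by rewrite /ergodic_sum big_nat_recr. Qed.

(** The windows differ only near their ends, since visits are counted from time 0 for x and from tau
    + 1 for the shifted path. The form with n + 1 serves average (ii), whose n-th term is the last
    one of a Birkhoff sum of length n + 1. *)
Lemma visit_count_shift tau n x :
  `|visit_count n x - occupation_time n (path_shift tau x)| <= 2 * tau.+1%:R /\
  `|visit_count n.+1 x - occupation_time n (path_shift tau x)| <= 2 * tau.+1%:R.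
Proof.
have ind01 (y : T) : 0 <= (\1_(state_set a) y : R) <= 1.
  by rewrite indicE; case: (_ \in _); rewrite ?ler01 ?lexx.
have step m l : visit_count m x <= visit_count (m + l)%N x <= visit_count m x + l%:R.
  elim: l => [|l /andP[h1 h2]]; first by rewrite addn0 addr0 lexx.
  rewrite addnS visit_countS; have /andP[g1 g2] := ind01 (path_shift (m + l) x).
  rewrite (le_trans h1) ?lerDl//= -natr1 addrA; exact: lerD.
have E : occupation_time n (path_shift tau x) = visit_count (n + tau.+1)%N x - visit_count tau.+1 x.
  rewrite occupation_timeE /ergodic_sum addnC [X in _ = X - _](@big_cat_nat _ _ _ tau.+1)//= ?leq_addr//.
  rewrite addrAC subrr add0r -{1}[tau.+1]add0n [(tau.+1 + n)%N]addnC big_addn addnK.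
  by apply: eq_bigr => j _; rewrite VE -[in RHS]addSnnS iterD.
have /andP[a1 a2] := step n tau.+1; have := step 0%N tau.+1.
have vc0 : visit_count 0 x = 0 by rewrite /ergodic_sum big_geq.
rewrite add0n vc0 add0r => /andP[b1 b2].
have /andP[c1 c2] := step n 1%N; rewrite addn1 in c1 c2.
have /andP[d1 d2] := step n.+1 tau.
rewrite addSnnS in d1 d2.
have e : tau.+1%:R = tau%:R + 1 :> R by rewrite natr1.
by rewrite E; split; rewrite ler_norml; apply/andP; split; lra.
Qed.

(** The normalisation b is abstract so that the inverse function with constant [c] and the return
    sequence with constant 1 are two instances. *)
Lemma log_averages (alpha c : R) (b : nat -> R) N0 : 0 < alpha ->
  regvar_seq (return_sequence rho) alpha -> 0 < c -> (forall n, 0 <= b n) ->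
  (forall n, (N0 <= n)%N -> b n <= b n.+1) ->
  return_sequence rho n / (c * b n) @[n --> \oo] --> (1 : R) ->
  log_average rho b c /\ chung_erdos_average rho b c.
Proof.
move=> al0 rv c0 b0 b_nd ratio.
have aoo := return_sequence_infty.
have aE : (fun n => \sum_(0 <= j < n) v j) = return_sequence rho.
  by apply/funext => n; rewrite return_sequenceE.
have mV k : measurable_fun setT (V k) by exact: measurable_indic.
have aoo' := aoo; rewrite -aE in aoo'.
have rv' := rv; rewrite -aE in rv'.
have ce := chung_erdos mV V01 VV EV EVV aoo'.
have la := count_log_average mV V01 VV EV EVV aoo' al0 rv'.
have occ_nd (y : T) : {homo (fun n => occupation_time n y : R) : m n / (m <= n)%N >-> m <= n}.
  apply: homo_leq => [//|? ? ?|n]; first exact: le_trans.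
  by rewrite !occupation_timeE big_nat_recr//= lerDl; have /andP[] := V01 n y.
have occ0 n (y : T) : 0 <= occupation_time n y :> R.
  by rewrite occupation_timeE; apply: sumr_ge0 => j _; have /andP[] := V01 j y.
have good : {ae rho, forall x, exists tau,
  ((ln (return_sequence rho n))^-1 * (\sum_(0 <= k < n)
     (occupation_time k.+1 (path_shift tau x) - occupation_time k (path_shift tau x)) /
       return_sequence rho k.+1) @[n --> \oo] --> (1 : R)) /\
  ((ln n%:R)^-1 * (\sum_(0 <= k < n)
     occupation_time k.+1 (path_shift tau x) / return_sequence rho k.+1 / k.+1%:R)
    @[n --> \oo] --> (1 : R))}.
  apply: (@ae_first_visit (fun y =>
    ((ln (return_sequence rho n))^-1 * (\sum_(0 <= k < n)
     (occupation_time k.+1 y - occupation_time k y) /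
       return_sequence rho k.+1) @[n --> \oo] --> (1 : R)) /\
    ((ln n%:R)^-1 * (\sum_(0 <= k < n)
     occupation_time k.+1 y / return_sequence rho k.+1 / k.+1%:R)
    @[n --> \oo] --> (1 : R)))).
  apply: filterS2 ce la => y h1 h2; split.
    apply: (cvg_trans _ h1); apply: near_eq_cvg; apply: nearW => n.
    rewrite return_sequenceE; congr (_ * _); apply: eq_bigr => k _.
    rewrite return_sequenceE; congr (_ / _).
    by rewrite !occupation_timeE big_nat_recr//= addrAC subrr add0r.
  apply: (cvg_trans _ h2); apply: near_eq_cvg; apply: nearW => n.
  congr (_ * _); apply: eq_bigr => k _.
  by rewrite return_sequenceE !occupation_timeE.
have hopf phi (ip : rho.-integrable setT (EFin \o phi)) :=
  ergodic_ratio (@measurable_left_shift A a) inv erg (@measurable_state A a) rhoA ip erefl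
    visits_infinite.
split => phi ip.
  apply: filterS3 good (hopf phi ip) visits_infinite => x [tau [_ h2]] hx xoo.
  apply: (log_average_transfer c0 aoo b0 ratio (occ0 ^~ _) _ h2 return_sequence_ge0).
  exact: (ratio_shift xoo (fun n => (visit_count_shift tau n x).1) hx).
apply: filterS3 good (hopf phi ip) visits_infinite => x [tau [h1 _]] hx xoo.
have xoo' : visit_count n.+1 x @[n --> \oo] --> +oo.
  apply/cvgryPge => K; have [N _ hN] := cvgry_ge xoo K; exists N => // n /= Nn.
  by apply: hN; exact: leqW.
have hx' (e : R) : 0 < e -> \forall n \near \oo,
   `|birkhoff_sum phi n.+1 x - (\int[rho]_y phi y) * visit_count n.+1 x| <=
   e * visit_count n.+1 x.
  by move=> e0; have [N _ hN] := hx e e0; exists N => // n /= Nn; apply: hN; exact: leqW.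
have sh n : `|visit_count n.+1 x - occupation_time n (path_shift tau x)| <= 2 * tau.+1%:R.
  by have [] := visit_count_shift tau n x.
have := chung_erdos_transfer c0 aoo b0 ratio (occ_nd _) (occ0 ^~ _) b_nd
  (ratio_shift xoo' sh hx') h1 return_sequence_ge0.
apply: cvg_trans; apply: near_eq_cvg; apply: nearW => k.
congr (_ * _); rewrite big_nat_cond [RHS]big_nat_cond; apply: eq_bigr => n /andP[/andP[n0 _] _].
congr (_ / _); case: n n0 => // n _ /=.
by rewrite /birkhoff_sum big_nat_recr//= addrAC subrr add0r.
Qed.

End occupation.

(** * Domain of attraction and regular variation *)

Lemma ae_eq_Rintegral d (W : measurableType d) (R : realType)
    (mu : {measure set W -> \bar R}) (f g : W -> R) :
  measurable_fun setT f -> measurable_fun setT g ->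
  {ae mu, forall w, f w = g w} -> \int[mu]_w f w = \int[mu]_w g w.
Proof.
move=> mf mg fg; rewrite /Rintegral; congr fine; apply: ae_eq_integral => //.
- exact/measurable_EFinP.
- exact/measurable_EFinP.
- by apply: filterS fg => w -> _.
Qed.

Lemma measurable_exp_linear (R : realType) (w : R) :
  measurable_fun setT (fun y : R => expR (- (w * y))).
Proof.
apply: (measurableT_comp (@measurable_expR R)).
by apply: measurable_funN; exact: measurable_funM.
Qed.

Lemma measurable_exp_pos (R : realType) (w : R) :
  measurable_fun setT (fun y : R => expR (- (w * Num.max y 0))).
Proof.
apply: (measurableT_comp (measurable_exp_linear w)).
by apply: measurable_maxr; [exact: measurable_id|exact: measurable_cst].
Qed.

(** * The constant in the exponent of the stable law *)

Section stable_constant.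
Context {R : realType} (alpha : R) (G : probability (measurableTypeR R) R).
Hypothesis stG : stable_law alpha G.
Hypothesis alpha01 : 0 < alpha < 1.

Definition stable_constant : R := Gamma (3 - alpha) / (alpha * (1 - alpha)).

Lemma stable_law_gt0 : {ae G, forall y, 0 < y}.
Proof.
have [G1 _] := stG; exists (~` `]0, +oo[%classic); split.
- by apply: measurableC.
- by rewrite probability_setC// G1 subee.
- by move=> y /= ny; rewrite in_itv/= andbT.
Qed.

Lemma stable_law_laplace w : 0 <= w ->
  \int[G]_y expR (- (w * Num.max y 0)) = expR (- (stable_constant * w `^ alpha)).
Proof.
have FG : Filter (almost_everywhere G) by exact: ae_filter_ringOfSetsType.
move=> w0; have [_ <-//] := stG; apply: ae_eq_Rintegral.
- exact: measurable_exp_pos.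
- exact: measurable_exp_linear.
by apply: (filterS _ stable_law_gt0) => y y0; rewrite max_l// ltW.
Qed.

(** The sign is read off from G instead of the Gamma function: the transform at 1 is e^(-C), and C
    <= 0 would force e^(-y) = 1 almost everywhere although G charges positive numbers only. *)
Lemma stable_constant_gt0 : 0 < stable_constant.
Proof.
have FG : Filter (almost_everywhere G) by exact: ae_filter_ringOfSetsType.
have L1 := @stable_law_laplace 1 ler01; rewrite powR1 mulr1 in L1.
rewrite ltNge; apply/negP => C0.
have e1 : 1 <= \int[G]_y expR (- (1 * Num.max y 0)).
  by rewrite L1 -expR0 ler_expR oppr_ge0.
pose g (y : R) := 1 - expR (- (1 * Num.max y 0)).
have g0 y : 0 <= g y.
  by rewrite subr_ge0 expR_le1 oppr_le0 mul1r le_max lexx orbT.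
have ie : G.-integrable setT (EFin \o (fun y : R => expR (- (1 * Num.max y 0)))).
  apply: (bounded_integrable G (M := 1)) => [|y]; first exact: measurable_exp_pos.
  by rewrite ger0_norm ?expR_ge0// -subr_ge0; exact: g0.
have i1 : G.-integrable setT (EFin \o (fun _ : R => 1)).
  by apply: (bounded_integrable G (M := 1)) => // y; rewrite normr1.
have ig : \int[G]_y g y = 0.
  apply/eqP; rewrite eq_le; apply/andP; split; last by apply: Rintegral_ge0 => y _; exact: g0.
  by rewrite RintegralB// expectation1 subr_le0.
have mg : measurable_fun setT g.
  by apply: measurable_funB => //; exact: measurable_exp_pos.
have : (\int[G]_y `|(g y)%:E| = 0)%E.
  under eq_integral do rewrite gee0_abs ?lee_fin//.
  have fin := integrable_fin_num measurableT (integrableB measurableT i1 ie).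
  by rewrite -[LHS]fineK//; congr EFin.
move=> /(ae_eq_integral_abs G measurableT (f := EFin \o g))-/(_ (proj2 (measurable_EFinP _ _) mg)).
move=> g_ae0; have : {ae G, forall y : R, False}.
  have g_ae1 : {ae G, forall y : R, setT y -> (g y)%:E = 0%E} := g_ae0.
  apply: (@filterS2 _ _ FG (fun y : R => 0 < y) (fun y : R => setT y -> (g y)%:E = 0%E) (fun=> False)
    _ stable_law_gt0 g_ae1) => y y0 /(_ I) [].
  rewrite /g max_l ?ltW// mul1r => /eqP; rewrite subr_eq0 eq_sym.
  by rewrite lt_eqF// expR_lt1 oppr_lt0.
move=> [Z [mZ Z0 sub]]; have ZT : Z = setT.
  by apply/seteqP; split => // y _; apply: sub.
by move: Z0; rewrite ZT probability_setT => /eqP; rewrite onee_eq0.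
Qed.

End stable_constant.

Section domain_of_attraction.
Context {R : realType} {A : countType} (a : A).
Variables (P : A -> A -> R) (pi : A -> R).
Variable rho : {measure set (Paths a) -> \bar R}.
Hypothesis mk : markov_measure P pi rho.
Hypothesis inv : invariant_measure rho (left_shift a).
Hypothesis cons : conservative rho (left_shift a).
Hypothesis erg : ergodic rho (left_shift a).
Hypothesis rhoA : rho (state_set a) = 1%E.
Local Notation T := (Paths a).
Local Notation f := (return_prob rho).
Local Notation u := (renewal_prob rho).

Let f01 m : 0 <= f m <= 1. Proof. exact: return_prob01. Qed.
Let u01 m : 0 <= u m <= 1. Proof. exact: renewal_prob01. Qed.
Let u0 : u 0%N = 1. Proof. exact: renewal_prob0. Qed.
Let ren m : u m = (m == 0%N)%:R + \sum_(0 <= k < m.+1) f k * u (m - k)%N.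
Proof. exact: (renewal_equation mk). Qed.

Let e01 (w y : R) : 0 <= w -> 0 <= expR (- (w * Num.max y 0)) <= 1.
Proof. by move=> w0; apply: expRN_in01; rewrite mulr_ge0// le_max lexx orbT. Qed.

Section with_law.
Context d (W : measurableType d) (Q : probability W R) (X : {RV Q >-> R}).
Hypothesis cX : forall t, cdf X t = (return_df rho t)%:E.

Lemma expectation_return_laplace w : 0 < w ->
  \int[Q]_x expR (- (w * Num.max (X x) 0)) = laplace_series f w.
Proof.
move=> w0; rewrite /Rintegral.
rewrite (integral_return_law inv rhoA (g := fun y => (expR (- (w * Num.max y 0)))%:E) cX).
- have E : (\sum_(k <oo) ((f k)%:E * (expR (- (w * Num.max k%:R 0)))%:E) =
      (laplace_series f w)%:E)%E.
    rewrite /laplace_series -EFin_lim; last by exact: laplace_series_cvg.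
    apply: congr_lim; apply/funext => n; rewrite /series /= -sumEFin.
    by apply: eq_bigr => k _; rewrite -EFinM max_l.
  by rewrite E.
- by apply/measurable_EFinP; exact: measurable_exp_pos.
- by move=> y; rewrite lee_fin expR_ge0.
Qed.

Lemma return_rv_ge0 : {ae Q, forall x, 0 <= X x}.
Proof.
pose N : set R := `]-oo, 0[%classic.
have mN : measurable (X @^-1` N).
  by rewrite -[X in measurable X]setTI; apply: (measurable_funP X) => //; exact: measurable_itv.
exists (X @^-1` N); split => //; last first.
  by move=> x /= /negP; rewrite /N/= in_itv/= -ltNge.
have := integral_return_law inv rhoA (g := fun y => (\1_N y)%:E) cX.
have E : (\int[Q]_x (\1_N (X x))%:E = Q (X @^-1` N))%E.
  rewrite (eq_integral (fun x => (\1_(X @^-1` N) x)%:E)).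
    by rewrite integral_indic// setIT.
  by move=> x _.
rewrite E => ->.
- rewrite eseries0// => k _ _; rewrite indicE memNset ?mule0//=.
  by rewrite /N/= in_itv/= => h; move: (lt_le_trans h (ler0n R k)); rewrite ltxx.
- by apply/measurable_EFinP; apply: measurable_indic; exact: measurable_itv.
- by move=> y; rewrite lee_fin.
Qed.

End with_law.

Lemma laplace_return_sum d (W : measurableType d) (Q : probability W R)
    (X : nat -> {RV Q >-> R}) w n : 0 < w -> iid_with_df (return_df rho) X ->
  \int[Q]_x expR (- (w * Num.max (\sum_(i < n) X i x) 0)) = laplace_series f w ^+ n.
Proof.
move=> w0 [ind cX]; pose h (y : R) := expR (- (w * Num.max y 0)).
have mX i : measurable_fun setT (X i) by exact: measurable_funP.
transitivity (\int[Q]_x \prod_(i < n) h (X i x)).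
  apply: ae_eq_Rintegral.
  - by apply: (measurableT_comp (measurable_exp_pos w)); exact: measurable_sum.
  - by apply: measurable_prod => i _; exact: measurableT_comp (measurable_exp_pos w) (mX i).
  have := ae_foralln (fun i => return_rv_ge0 (cX i)); apply: filterS => x X0.
  rewrite max_l ?sumr_ge0// -expR_sum; congr expR.
  by rewrite mulr_sumr -sumrN; apply: eq_bigr => i _; rewrite max_l.
rewrite (expectation_prod_indep mX (measurable_exp_pos w) _ ind); last by move=> y; exact: e01 (ltW w0).
rewrite (eq_bigr (fun=> laplace_series f w)) ?prodr_const ?card_ord// => i _.
exact: expectation_return_laplace.
Qed.

Variables (alpha : R) (G : probability (measurableTypeR R) R).
Hypothesis stG : stable_law alpha G.
Hypothesis alpha01 : 0 < alpha < 1.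
Local Notation C := (stable_constant alpha).

Let f_laplace01 w : 0 < w -> 0 <= 1 - laplace_series f w <= 1.
Proof.
move=> w0; rewrite (survival_laplace u01 f01 u0 ren w0).
have A1 := laplace_series_ge1 u01 u0 w0.
by rewrite invr_ge0 (le_trans ler01 A1)/= invf_le1// (lt_le_trans ltr01).
Qed.

(** By independence the transform of the normalised sum is the n-th power of that of one return at w
    / a_n; [cvg_mul_of_pow] takes the logarithm of the limit. *)
Lemma normalizing_survival (an : nat -> R) : normalizing_sequence (return_df rho) G an ->
  forall w, 0 < w ->
    n%:R * (1 - laplace_series f (w / an n)) @[n --> \oo] --> C * w `^ alpha.
Proof.
move=> [an0 [d [W [Q [X [iid law]]]]]] w w0.
(* The entry at 0 is unconstrained; the value 1 makes every term positive. *)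
pose an' n := if n == 0%N then 1 else an n.
have an'0 n : 0 < an' n by rewrite /an'; case: eqP => // /eqP; rewrite -lt0n => /an0.
have eqn : \forall n \near \oo, an' n = an n.
  by exists 1%N => // -[].
(* Truncation at 0 makes the exponential a bounded test function, as convergence in law demands;
   return times and G are almost surely nonnegative, so no integral changes. *)
have cf : continuous (fun y : R => expR (- (w * Num.max y 0))).
  move=> y; have c1 : - (w * Num.max z 0) @[z --> y] --> - (w * Num.max y 0); last first.
    exact: (cvg_comp _ _ c1 (@continuous_expR R _)).
  apply: cvgN; apply: cvgMr; apply: cvg_maxr2; [exact: cvg_id|exact: cvg_cst].
have bf : exists M, forall y : R, `|expR (- (w * Num.max y 0))| <= M.
  by exists 1 => y; rewrite ger0_norm ?expR_ge0//; have /andP[] := e01 y (ltW w0).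
have := law _ cf bf; rewrite (stable_law_laplace stG (ltW w0)) => cv.
have cv' : (1 - (1 - laplace_series f (w / an' n))) ^+ n @[n --> \oo] -->
    expR (- (C * w `^ alpha)).
  apply: (cvg_trans _ cv); apply: near_eq_cvg; near=> n.
  have n0 : (0 < n)%N by near: n; exact: nbhs_infty_gt.
  have -> : an' n = an n by near: n; exact: eqn.
  rewrite opprB addrC subrK -(laplace_return_sum _ _ iid) ?divr_gt0 ?an0//.
  apply: eq_Rintegral => x _; congr (expR (- _)).
  rewrite -mulrA; congr (_ * _).
  by rewrite maxr_pMr ?mulr0// invr_ge0 ltW// an0.
have := cvg_mul_of_pow (fun n => f_laplace01 (divr_gt0 w0 (an'0 n))) cv'.
apply: cvg_trans; apply: near_eq_cvg; near=> n.
have -> : an' n = an n by near: n; exact: eqn.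
by [].
Unshelve. all: by end_near. Qed.

Lemma regular_of_domain : domain_of_attraction (return_df rho) G ->
  regular_laplace u alpha.
Proof.
move=> [an nrm]; have [an0 _] := nrm.
exact: (regular_of_normalizing u01 f01 u0 ren alpha01
  (stable_constant_gt0 stG) an0 (normalizing_survival nrm)).
Qed.

(** The chain itself supplies the independent variables: its successive returns under the base
    probability. The transform at k = 0 is treated apart because the survival limit concerns w >
    0. *)
Lemma domain_of_regular : regular_laplace u alpha ->
  domain_of_attraction (return_df rho) G.
Proof.
move=> reg; have [an [an0 cv]] := normalizing_of_regular u01 f01 u0 ren alpha01
  (stable_constant_gt0 stG) reg.
exists an; split; first by move=> n _.
have iid := iid_returns mk inv cons rhoA.
eexists; eexists; eexists; eexists; split; first exact: iid.
apply: (cvg_in_law_laplace _ _ stG.1).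
- move=> n; apply: measurable_funM => //; apply: measurable_sum => i.
  exact: (@measurable_return_rv R A a i).
- move=> n x; rewrite mulr_ge0 ?invr_ge0 ?(ltW (an0 n))//.
  by apply: sumr_ge0 => i _; exact: ler0n.
move=> k; have [->|k0] := eqVneq k 0%N.
  under eq_fun do under eq_Rintegral do rewrite mul0r oppr0 expR0.
  under eq_Rintegral do rewrite mul0r oppr0 expR0.
  by rewrite expectation1; under eq_fun do rewrite expectation1; exact: cvg_cst.
have kp : 0 < k%:R :> R by rewrite ltr0n lt0n.
have [_ ->] := stG; last exact: ler0n.
have cv' := cvg_pow_of_mul (fun n => f_laplace01 (divr_gt0 kp (an0 n))) (cv _ kp).
apply: (cvg_trans _ cv'); apply: near_eq_cvg; apply: nearW => n.
rewrite opprB addrC subrK -(laplace_return_sum n _ iid) ?divr_gt0//.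
apply: eq_Rintegral => x _; rewrite max_l; first by rewrite mulrA.
by apply: sumr_ge0 => i _; exact: ler0n.
Qed.

(** The renewal sum counts the visit at time 0, the occupation time does not. The extra 1 is
    harmless because both tend to infinity. *)
Lemma sum_upto_return_sequence t : 0 <= t ->
  sum_upto u t = 1 + return_sequence rho (Num.truncn t).
Proof. by move=> t0; rewrite /sum_upto big_nat_recl// u0 return_sequenceE. Qed.

Lemma regular_of_return_sequence : regvar_seq (return_sequence rho) alpha ->
  regular_laplace u alpha.
Proof.
move=> [_ pos rv]; apply: (regular_laplace_of_sum u01 u0 alpha01) => lam l0.
pose b (t : R) : R := return_sequence rho (Num.truncn t).
have boo : b t @[t --> +oo] --> +oo.
  apply/cvgryPge => M; have [N _ hN] := cvgry_ge (return_sequence_infty mk inv cons rhoA) M.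
  near=> t; apply: hN; rewrite /= truncn_ge_nat; last by near: t; exact: nbhs_pinfty_ge (num_real _).
  by near: t; exact: nbhs_pinfty_ge (num_real _).
have ib : (b t)^-1 @[t --> +oo] --> (0 : R).
  by apply/(gtr0_cvgV0 (f := b)) => //; exact: (cvgry_gt boo).
have lim : (b (lam * t) / b t + (b t)^-1) / (1 + (b t)^-1) @[t --> +oo] -->
    (lam `^ alpha + 0) / (1 + 0).
  apply: cvgM; first by apply: cvgD => //; exact: rv.
  have c1 : 1 + (b t)^-1 @[t --> +oo] --> 1 + (0 : R).
    by apply: cvgD; [exact: cvg_cst|exact: ib].
  by apply: cvgV; [rewrite addr0 oner_eq0|exact: c1].
rewrite addr0 addr0 divr1 in lim.
apply: (cvg_trans _ lim); apply: near_eq_cvg; near=> t.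
have t0 : 0 <= t by near: t; exact: nbhs_pinfty_ge (num_real _).
have bt : 0 < b t by near: t; exact: (cvgry_gt boo).
rewrite !sum_upto_return_sequence ?mulr_ge0 ?(ltW l0)// -/(b t) -/(b (lam * t)).
have fe (p q : R) : 0 < q -> (p / q + q^-1) / (1 + q^-1) = (1 + p) / (1 + q).
  move=> q0; have q1 : 1 + q != 0 by rewrite gt_eqF// addr_gt0.
  rewrite (_ : 1 + q^-1 = (1 + q) / q); last by field; rewrite gt_eqF.
  by field; rewrite q1 gt_eqF.
by rewrite fe.
Unshelve. all: by end_near. Qed.

Lemma return_sequence_regular : regular_laplace u alpha ->
  regvar_seq (return_sequence rho) alpha.
Proof.
move=> reg; have [kap kap0 [tau _]] := tauberian u01 u0 alpha01 reg.
pose b (t : R) : R := return_sequence rho (Num.truncn t).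
have bE (t : R) : 0 <= t -> b t = sum_upto u t - 1.
  by move=> t0; rewrite sum_upto_return_sequence// addrC addKr.
have boo : b t @[t --> +oo] --> +oo.
  apply/cvgryPge => M; have [N _ hN] := cvgry_ge (return_sequence_infty mk inv cons rhoA) M.
  near=> t; apply: hN; rewrite /= truncn_ge_nat; last by near: t; exact: nbhs_pinfty_ge (num_real _).
  by near: t; exact: nbhs_pinfty_ge (num_real _).
have ib : (b t)^-1 @[t --> +oo] --> (0 : R).
  by apply/(gtr0_cvgV0 (f := b)) => //; exact: (cvgry_gt boo).
split.
- apply: (eq_measurable_fun (fun t : R => sum_upto u (1 * t) - 1)).
    move=> t; rewrite inE/= in_itv/= andbT => t0; rewrite mul1r.
    by rewrite sum_upto_return_sequence// addrC addKr.
  apply: measurable_funB => //; exact: measurable_sum_upto.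
- exact: (cvgry_gt boo).
move=> lam l0.
have scale : lam * t @[t --> +oo] --> +oo by exact: gt0_cvgMry.
have tau' : (sum_upto u (lam * t) / laplace_series u (lam * t)^-1) @[t --> +oo] --> kap.
  exact: (cvg_comp _ _ scale tau).
have il0 : 0 < lam^-1 by rewrite invr_gt0.
have rl := reg _ il0; rewrite powRV ?(ltW l0)// opprK in rl.
have tauV : (sum_upto u t / laplace_series u t^-1)^-1 @[t --> +oo] --> kap^-1.
  by apply: cvgV => //; rewrite gt_eqF.
have Ul : sum_upto u (lam * t) / sum_upto u t @[t --> +oo] --> lam `^ alpha.
  rewrite [X in _ --> X](_ : _ = kap * lam `^ alpha * kap^-1); last first.
    by rewrite mulrAC mulfV ?mul1r// gt_eqF.
  apply: (cvg_trans _ (cvgM (cvgM tau' rl) tauV)); apply: near_eq_cvg; near=> t.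
  have t0 : 0 < t by near: t; exact: nbhs_pinfty_gt (num_real _).
  have A1 : 0 < laplace_series u t^-1 by apply: (laplace_series_gt0 u01 u0); rewrite invr_gt0.
  have A2 : 0 < laplace_series u (lam * t)^-1.
    by apply: (laplace_series_gt0 u01 u0); rewrite invr_gt0 mulr_gt0.
  have U1 := sum_upto_gt0 u01 u0 t.
  rewrite /= -[lam^-1 / t]invfM; field.
  by rewrite !gt_eqF.
have lim : (sum_upto u (lam * t) / sum_upto u t - (sum_upto u t)^-1) /
    (1 - (sum_upto u t)^-1) @[t --> +oo] --> (lam `^ alpha - 0) / (1 - 0).
  have iU : (sum_upto u t)^-1 @[t --> +oo] --> (0 : R).
    apply/(gtr0_cvgV0 (f := sum_upto u)); first by apply: nearW => t; exact: sum_upto_gt0.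
    apply/cvgryPge => M; near=> t.
    have t0 : 0 <= t by near: t; exact: nbhs_pinfty_ge (num_real _).
    rewrite sum_upto_return_sequence// -/(b t).
    have : M <= b t by near: t; exact: (cvgry_ge boo).
    by move=> /le_trans; apply; rewrite lerDr.
  apply: cvgM; first exact: cvgB.
  have c1 : 1 - (sum_upto u t)^-1 @[t --> +oo] --> 1 - (0 : R).
    by apply: cvgB; [exact: cvg_cst|exact: iU].
  by apply: cvgV; [rewrite subr0 oner_eq0|exact: c1].
rewrite !subr0 divr1 in lim.
apply: (cvg_trans _ lim); apply: near_eq_cvg; near=> t.
have t0 : 0 <= t by near: t; exact: nbhs_pinfty_ge (num_real _).
have bt : 0 < b t by near: t; exact: (cvgry_gt boo).
rewrite !sum_upto_return_sequence ?mulr_ge0 ?(ltW l0)// -/(b t) -/(b (lam * t)).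
have fe (p q : R) : 0 < q -> ((1 + p) / (1 + q) - (1 + q)^-1) / (1 - (1 + q)^-1) = p / q.
  move=> q0; have q1 : 1 + q != 0 by rewrite gt_eqF// addr_gt0.
  by field; rewrite q1 gt_eqF//= [X in X != 0](_ : _ = q) ?gt_eqF//; ring.
by rewrite fe.
Unshelve. all: by end_near. Qed.

End domain_of_attraction.

(** * The inverse of the normalizing function *)

Section inverse_on_halfline.
Context {R : realType}.
Variables (a : R -> R).
Hypothesis a_ge0 : forall t, 0 <= t -> 0 <= a t.
Hypothesis a_lt : forall s t, 0 <= s -> s < t -> a s < a t.
Local Notation ahat := (inverse_on_halfline a).

Let a_le s t : 0 <= s -> s <= t -> a s <= a t.
Proof.
by move=> s0; rewrite le_eqVlt => /orP[/eqP -> //|st]; apply/ltW; exact: a_lt.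
Qed.

Let a_le_inv s t : 0 <= s -> 0 <= t -> a s <= a t -> s <= t.
Proof. by move=> s0 t0; apply: contraTT; rewrite -!ltNge; exact: a_lt. Qed.

Lemma inverse_on_halfline_ge0 y : 0 <= ahat y.
Proof. by rewrite /inverse_on_halfline; case: xgetP => [t _ []|]. Qed.

Lemma inverse_on_halflineK y : (exists2 t, 0 <= t & a t = y) -> a (ahat y) = y.
Proof.
move=> [t t0 aty]; rewrite /inverse_on_halfline.
by case: xgetP => [s _ []//|/(_ t)] [].
Qed.

Lemma halfline_continuous (g : R -> R) T : derivative_on_halfline a g ->
  {within `[0, T], continuous a}.
Proof.
move=> dg; apply/subspace_continuousP => x /=; rewrite in_itv/= => /andP[x0 _].
apply/cvgrPdist_lt => e e0.
have /cvgrPdist_lt/(_ 1 ltr01) h := dg x x0.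
pose K := `|g x| + 1; have K0 : 0 < K by rewrite ltr_wpDl.
have h2 : \forall s \near x, `|x - s| < e / K.
  by apply/nbhs_ballP; exists (e / K) => //=; rewrite divr_gt0.
rewrite near_withinE in h; rewrite near_withinE.
suff main : \forall s \near x, 0 <= s -> `|a x - a s| < e.
  by apply: filterS main => s hs /=; rewrite in_itv/= => /andP[/hs].
near=> s => s0.
have [->|sx] := eqVneq s x; first by rewrite subrr normr0.
have hs : `|g x - (a s - a x) / (s - x)| < 1.
  have : 0 <= s /\ s != x -> `|g x - (a s - a x) / (s - x)| < 1 by near: s; exact: h.
  by apply.
have hs2 : `|x - s| < e / K by near: s; exact: h2.
have q1 : `|(a s - a x) / (s - x)| <= K.
  rewrite -[X in `|X|](subKr (g x)); apply: le_trans (ler_normB _ _) _.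
  by rewrite lerD2l ltW.
rewrite distrC -[X in `|X|](_ : (a s - a x) / (s - x) * (s - x) = _); last first.
  by rewrite -mulrA mulVf ?mulr1// subr_eq0.
rewrite normrM; apply: (@le_lt_trans _ _ (K * `|s - x|)); first exact: ler_wpM2r.
by rewrite -ltr_pdivlMl// mulrC distrC.
Unshelve. all: by end_near. Qed.

Lemma inverse_on_halfline_exists (g : R -> R) : derivative_on_halfline a g ->
  (forall K, exists2 t, 0 <= t & K < a t) -> forall y, a 0 <= y ->
  exists2 t, 0 <= t & a t = y.
Proof.
move=> dg unb y y0; have [T T0 yT] := unb y.
have aT : a 0 <= a T by exact: a_le.
have IV : Num.min (a 0) (a T) <= y <= Num.max (a 0) (a T).
  by rewrite min_l// max_r// y0 ltW.
have [t] := IVT T0 (halfline_continuous (T := T) dg) IV.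
by rewrite in_itv/= => /andP[t0 _] aty; exists t.
Qed.

Lemma inverse_on_halfline_le x y :
  (exists2 t, 0 <= t & a t = x) -> (exists2 t, 0 <= t & a t = y) -> x <= y ->
  ahat x <= ahat y.
Proof.
move=> ex ey xy; apply: a_le_inv; rewrite ?inverse_on_halfline_ge0//.
by rewrite !inverse_on_halflineK.
Qed.

Variables (H : R -> R) (C : R).
Hypothesis C0 : 0 < C.
Hypothesis H_gt0 : forall t, 0 < t -> 0 < H t.
Hypothesis H_le : forall s t, 0 < s -> s <= t -> H s <= H t.
Hypothesis aH : n%:R / H (a n%:R) @[n --> \oo] --> C.

(** A bound K on [a] would give n <= (C + 1) H(K) for all large n. *)
Lemma normalizer_unbounded K : exists2 t, 0 <= t & K < a t.
Proof.
apply: contrapT => nb.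
have bnd t : 0 <= t -> a t <= K.
  by move=> t0; rewrite leNgt; apply/negP => Kt; apply: nb; exists t.
have a1 : 0 < a 1 by apply: le_lt_trans (a_lt (lexx 0) ltr01); exact: a_ge0.
have K0 : 0 < K by apply: lt_le_trans a1 (bnd _ ler01).
have HK := H_gt0 K0.
have : \forall n \near \oo, n%:R <= (C + 1) * H K.
  near=> n.
  have n0 : (0 < n)%N by near: n; exact: nbhs_infty_gt.
  have an : 0 < a n%:R.
    by apply: le_lt_trans (a_lt (lexx 0) (_ : 0 < n%:R)); rewrite ?a_ge0// ltr0n.
  have : n%:R / H (a n%:R) < C + 1 by near: n; apply: (cvgr_lt _ aH); rewrite ltrDl.
  rewrite ltr_pdivrMr ?H_gt0// => /ltW/le_trans; apply.
  by apply: ler_wpM2l; [rewrite addr_ge0// ltW|apply: H_le => //; exact: bnd].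
move=> [N _ hN].
pose M := maxn N (Num.truncn ((C + 1) * H K)).+1.
have := hN M (leq_maxl _ _); rewrite leNgt => /negP; apply.
by apply: (lt_le_trans (truncnS_gt _)); rewrite ler_nat leq_maxr.
Unshelve. all: by end_near. Qed.

(** With m the integer part of ahat n one has a(m) <= n <= a(m+1), and monotonicity of H places ahat
    n / H n between m / H(a(m+1)) and (m+1) / H(a(m)). Both tend to C. *)
Lemma inverse_on_halfline_asymp :
  (forall y, a 0 <= y -> exists2 t, 0 <= t & a t = y) ->
  ahat n%:R / H n%:R @[n --> \oo] --> C.
Proof.
move=> ex.
pose m n := Num.truncn (ahat n%:R).
have nb : \forall n \near \oo, a 0 <= (n : nat)%:R :> R.
  near=> n; near: n; exact: nbhs_infty_ger.
have nK (K : R) : 0 <= K -> \forall n \near \oo, K <= ahat n%:R.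
  move=> K0; near=> n.
  have an : a (ahat n%:R) = n%:R by apply: inverse_on_halflineK; apply: ex; near: n; exact: nb.
  apply: a_le_inv => //; first exact: inverse_on_halfline_ge0.
  by rewrite an; near: n; exact: nbhs_infty_ger.
have moo : m n @[n --> \oo] --> \oo.
  apply/cvgnyPge => N; near=> n.
  rewrite truncn_ge_nat ?inverse_on_halfline_ge0//.
  by near: n; exact: nK.
have inv0 : (fun n : nat => n%:R^-1 : R) n @[n --> \oo] --> (0 : R).
  by rewrite -cvg_shiftS; exact: cvg_harmonic.
have hi : (fun i => i%:R / H (a i%:R) * (1 + i%:R^-1)) i @[i --> \oo] --> C.
  rewrite -[X in _ --> X]mulr1 -[X in _ * X](addr0 1).
  by apply: cvgM => //; apply: cvgD => //; exact: cvg_cst.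
have lo : (fun i => i.+1%:R / H (a i.+1%:R) * (1 - i.+1%:R^-1)) i @[i --> \oo] --> C.
  rewrite -[X in _ --> X]mulr1 -[X in _ * X](subr0 1).
  apply: cvgM; first by move: aH; rewrite -cvg_shiftS.
  by apply: cvgB; [exact: cvg_cst|exact: cvg_harmonic].
have lo' := cvg_comp _ _ moo lo; have hi' := cvg_comp _ _ moo hi.
apply: (squeeze_cvgr _ lo' hi'); near=> n.
have an : a (ahat n%:R) = n%:R by apply: inverse_on_halflineK; apply: ex; near: n; exact: nb.
have t1 : 1 <= ahat n%:R by near: n; exact: nK.
have t0 : 0 <= ahat n%:R by exact: inverse_on_halfline_ge0.
have n0 : 0 < n%:R :> R by rewrite ltr0n; near: n; exact: nbhs_infty_gt.
have m1 : (1 <= m n)%N by rewrite truncn_ge_nat.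
have m0 : 0 < (m n)%:R :> R by rewrite ltr0n.
have l1 : (m n)%:R <= ahat n%:R by rewrite truncn_le.
have l2 : ahat n%:R <= (m n).+1%:R by apply/ltW; exact: truncnS_gt.
have am0 : 0 < a (m n)%:R.
  by apply: le_lt_trans (a_lt (lexx 0) m0); exact: a_ge0.
have k1 : H (a (m n)%:R) <= H n%:R by apply: H_le => //; rewrite -an; exact: a_le.
have k2 : H n%:R <= H (a (m n).+1%:R) by apply: H_le => //; rewrite -an; exact: a_le.
have Hn := H_gt0 n0; have Hm := H_gt0 am0.
have Hm1 : 0 < H (a (m n).+1%:R) by apply: lt_le_trans k2.
apply/andP; split => /=.
  rewrite [leLHS](_ : _ = (m n)%:R / H (a (m n).+1%:R)); last first.
    by rewrite -[(m n).+1%:R]natr1; field; rewrite natr1 gt_eqF//= natr1 pnatr_eq0.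
  by apply: ler_pM => //; [rewrite invr_ge0 ltW|rewrite lef_pV2].
rewrite [leRHS](_ : _ = (m n).+1%:R / H (a (m n)%:R)); last first.
  by rewrite -[(m n).+1%:R]natr1; field; rewrite (gt_eqF Hm) gt_eqF.
by apply: ler_pM => //; [rewrite invr_ge0 ltW|rewrite lef_pV2].
Unshelve. all: by end_near. Qed.

End inverse_on_halfline.

(** * The mean passage time of the stable process *)

Section stable_process.
Context {R : realType} {d} {W : measurableType d} (Q : probability W R).
Variables (alpha : R) (G : probability (measurableTypeR R) R) (Z : R -> {RV Q >-> R}).
Hypothesis stG : stable_law alpha G.
Hypothesis alpha01 : 0 < alpha < 1.
Hypothesis sp : stable_process G Z.
Local Notation C := (stable_constant alpha).

Let C0 : 0 < C. Proof. exact: stable_constant_gt0 stG. Qed.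

Let grid (j i : nat) : R := i%:R / j.+1%:R.

Let grid_ge0 j i : 0 <= grid j i. Proof. by rewrite divr_ge0. Qed.

Let gridS j i : grid j i.+1 = grid j i + j.+1%:R^-1.
Proof. by rewrite /grid -natr1 mulrDl mul1r. Qed.

Let grid_le j i : grid j i <= grid j i.+1.
Proof. by rewrite gridS lerDl. Qed.

Let grid1 j : grid j j.+1 = 1.
Proof. by rewrite /grid mulfV// pnatr_eq0. Qed.

Let mZ s : measurable_fun setT (Z s). Proof. exact: measurable_funP. Qed.

Let incr j i (x : W) : R := Z (grid j i.+1) x - Z (grid j i) x.

Let m_incr j i : measurable_fun setT (incr j i). Proof. exact: measurable_funB. Qed.

Let incr_ind j : mutually_independent Q (incr j).
Proof. by apply: (stable_process_independent sp) => [|i]; [exact: grid_ge0|exact: grid_le]. Qed.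

Let incr_law j i (B : set R) : measurable B ->
  Q (incr j i @^-1` B) = Q (Z j.+1%:R^-1 @^-1` B).
Proof.
move=> mB; have h0 : 0 <= j.+1%:R^-1 :> R by rewrite invr_ge0.
have := stable_process_stationary sp (grid_ge0 j i) h0 mB.
by rewrite -gridS.
Qed.

Let incr_sum j n x : \sum_(i < n) incr j i x = Z (grid j n) x.
Proof.
rewrite -(big_mkord xpredT (fun i => incr j i x)) telescope_sumr//.
by rewrite {2}/grid mul0r (stable_process0 sp) subr0.
Qed.

(* By independence the probability that all j + 1 increments are negative is
   a power of the probability that one is; but then Z 1 < 0. *)
Let incr_neg j i : Q (incr j i @^-1` `]-oo, 0[%classic) = 0%E.
Proof.
pose N : set R := `]-oo, 0[%classic.
have mN : measurable N by exact: measurable_itv.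
have mQ (X : W -> R) : measurable_fun setT X -> measurable (X @^-1` N).
  by move=> mX; rewrite -[Y in measurable Y]setTI; exact: mX.
have EX (X : W -> R) : measurable_fun setT X ->
    \int[Q]_x \1_N (X x) = fine (Q (X @^-1` N)).
  move=> mX; rewrite /Rintegral (eq_integral (fun x => (\1_(X @^-1` N) x)%:E))//.
  by rewrite integral_indic ?setIT//; exact: mQ.
pose p := fine (Q (Z j.+1%:R^-1 @^-1` N)).
rewrite incr_law//; suff p0 : p = 0.
  by rewrite -[LHS]fineK ?fin_num_measure//; [rewrite -/p p0|exact: mQ].
have E := @expectation_prod_indep _ _ _ Q (incr j) (\1_N) (m_incr j)
  (measurable_indic mN) _ (incr_ind j) j.+1.
have {}E : \int[Q]_x \prod_(i < j.+1) (\1_N (incr j i x) : R) = p ^+ j.+1.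
  rewrite E => [|y]; last by rewrite indicE; case: (_ \in _); rewrite ?ler01 ?lexx.
  rewrite (eq_bigr (fun=> p)) ?prodr_const ?card_ord// => k _.
  by rewrite EX// incr_law.
have le : \int[Q]_x \prod_(i < j.+1) (\1_N (incr j i x) : R) <= \int[Q]_x \1_N (Z 1 x).
  have i01 (y : R) : 0 <= (\1_N y : R) <= 1.
    by rewrite indicE; case: (_ \in _); rewrite ?ler01 ?lexx.
  have mp : measurable_fun setT (fun x => \prod_(i < j.+1) (\1_N (incr j i x) : R)).
    apply: measurable_prod => k _.
    exact: (measurableT_comp (measurable_indic mN) (m_incr j k)).
  apply: le_Rintegral => //.
  - apply: (bounded_integrable Q (M := 1)) => // x.
    rewrite ger0_norm; first by apply: prodr_ile1 => k _; exact: i01.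
    by apply: prodr_ge0 => k _; have /andP[] := i01 (incr j k x).
  - apply: (bounded_integrable Q (M := 1)) => [|x].
      exact: (measurableT_comp (measurable_indic mN) (mZ 1)).
    by have /andP[h1 h2] := i01 (Z 1 x); rewrite ger0_norm.
  move=> x _.
  have [neg|/existsNP[k hk]] := pselect (forall k : 'I_j.+1, incr j k x < 0).
    rewrite [leRHS]indicE mem_set; last first.
      rewrite /N/= in_itv/= -(grid1 j) -incr_sum big_ord_recr/=.
      rewrite -[ltRHS]addr0; apply: ler_ltD (neg ord_max).
      by apply: sumr_le0 => k _; exact/ltW/(neg (widen_ord (leqnSn j) k)).
    by apply: prodr_ile1 => k _; exact: i01.
  rewrite (bigD1 k)//= indicE memNset ?mul0r; first by have /andP[] := i01 (Z 1 x).
  by rewrite /N/= in_itv/=.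
have : p ^+ j.+1 <= 0.
  rewrite -E; apply: (le_trans le); rewrite EX//.
  have := stable_process_law1 sp mN; rewrite [LHS](_ : _ = Q (Z 1 @^-1` N))// => ->.
  pose Pos : set R := `]0, +oo[%classic.
  have : (G N <= G (~` Pos))%E.
    apply: le_measure; rewrite ?inE//; first by apply: measurableC; exact: measurable_itv.
    by move=> y; rewrite /N/Pos/= !in_itv/= andbT => y0; apply/negP; rewrite -leNgt ltW.
  rewrite probability_setC; last exact: measurable_itv.
  rewrite stG.1 subee// => GN.
  by have -> : G N = 0%E by apply/eqP; rewrite eq_le GN measure_ge0.
have p0 : 0 <= p by rewrite fine_ge0.
move=> pn; have : p ^+ j.+1 == 0 by rewrite eq_le pn exprn_ge0.
by rewrite expf_eq0/= => /eqP.
Qed.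

(** Countably many comparisons, so they hold simultaneously almost surely; right-continuity extends
    them to all times. *)
Let monotone_path (x : W) : Prop := forall j i, Z (grid j i) x <= Z (grid j i.+1) x.

Lemma stable_process_monotone_ae : {ae Q, forall x, monotone_path x}.
Proof.
apply: ae_foralln => j; apply: ae_foralln => i.
exists (incr j i @^-1` `]-oo, 0[%classic); split.
- rewrite -[Y in measurable Y]setTI; apply: m_incr => //; exact: measurable_itv.
- exact: incr_neg.
- by move=> x /= /negP; rewrite in_itv/= -ltNge /incr subr_lt0.
Qed.

Let grid_homo x j : monotone_path x -> {homo (fun i => Z (grid j i) x) : m n / (m <= n)%N >-> m <= n}.
Proof. by move=> mx; apply: homo_leq => // y u v; exact: le_trans. Qed.

Let grid_path_ge0 x j i : monotone_path x -> 0 <= Z (grid j i) x.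
Proof.
move=> mx; have := grid_homo j mx (leq0n i).
by rewrite {1}/grid mul0r (stable_process0 sp).
Qed.

(** The successor makes the grid point lie strictly beyond s, as needed to approach s from the
    right. *)
Let next (j : nat) (s : R) : nat := (Num.truncn (s * j.+1%:R)).+1.

Let next_gt j s : s < grid j (next j s).
Proof. by rewrite /grid ltr_pdivlMr ?ltr0n// truncnS_gt. Qed.

Let next_le j s : 0 <= s -> grid j (next j s) <= s + j.+1%:R^-1.
Proof.
move=> s0; rewrite gridS lerD2r ler_pdivrMr ?ltr0n// truncn_le//.
by rewrite mulr_ge0.
Qed.

Let next_cvg s : 0 <= s -> grid j (next j s) @[j --> \oo] --> s^'+.
Proof.
move=> s0 P /nbhs_ballP[e /= e0 hP].
suff : \forall j \near \oo, P (grid j (next j s)) by [].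
near=> j; apply: hP; last exact: next_gt.
rewrite /ball/= distrC ger0_norm; last by rewrite subr_ge0 ltW// next_gt.
rewrite ltrBlDl; apply: (le_lt_trans (next_le j s0)); rewrite ltrD2l.
by near: j; apply: (cvgr_lt _ (@cvg_harmonic R)).
Unshelve. all: by end_near. Qed.

Lemma stable_process_homo x : monotone_path x ->
  forall s t, 0 <= s -> s <= t -> Z s x <= Z t x.
Proof.
move=> mx s t s0 st; have [rc _] := stable_process_cadlag sp x.
have t0 : 0 <= t by exact: le_trans st.
have cs := cvg_comp _ _ (next_cvg s0) (rc s s0).
have ct := cvg_comp _ _ (next_cvg t0) (rc t t0).
apply: (ler_cvg_to cs ct); apply: nearW => j /=.
apply: (grid_homo j mx); rewrite /next ltnS; apply: le_truncn.
by rewrite ler_wpM2r.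
Qed.

Let laplace_increment j w i : 0 < w ->
  \int[Q]_x expR (- (w * Num.max (incr j i x) 0)) =
  \int[Q]_x expR (- (w * Num.max (Z j.+1%:R^-1 x) 0)).
Proof.
move=> w0; pose h (y : R) := (expR (- (w * Num.max y 0)))%:E.
have mh : measurable_fun setT h by apply/measurable_EFinP; exact: measurable_exp_pos.
have h0 y : (0 <= h y)%E by rewrite lee_fin expR_ge0.
have key (X Y : W -> R) : measurable_fun setT X -> measurable_fun setT Y ->
   (forall B, measurable B -> Q (X @^-1` B) = Q (Y @^-1` B)) ->
   (\int[Q]_x h (X x) = \int[Q]_x h (Y x))%E.
  move=> mX mY XY.
  have := ge0_integral_pushforward mX Q measurableT mh (fun y _ => h0 y).
  have := ge0_integral_pushforward mY Q measurableT mh (fun y _ => h0 y).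
  rewrite !preimage_setT => <- <-.
  by apply: eq_measure_integral => B mB _; exact: XY.
by rewrite /Rintegral; congr fine; apply: key => // B mB; exact: incr_law.
Qed.

Let grid_laplace_pow j w n : 0 < w ->
  \int[Q]_x expR (- (w * Num.max (Z (grid j n) x) 0)) =
  (\int[Q]_x expR (- (w * Num.max (Z j.+1%:R^-1 x) 0))) ^+ n.
Proof.
move=> w0; pose h (y : R) := expR (- (w * Num.max y 0)).
have mh : measurable_fun setT h by exact: measurable_exp_pos.
transitivity (\int[Q]_x \prod_(i < n) h (incr j i x)).
  apply: ae_eq_Rintegral.
  - exact: (measurableT_comp mh (mZ _)).
  - by apply: measurable_prod => i _; exact: (measurableT_comp mh (m_incr j i)).
  apply: filterS stable_process_monotone_ae => x mx.
  rewrite max_l ?grid_path_ge0// -expR_sum; congr expR.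
  rewrite sumrN -mulr_sumr -incr_sum; congr (- (_ * _)); apply: eq_bigr => i _.
  by rewrite max_l// subr_ge0.
rewrite (expectation_prod_indep (m_incr j) mh _ (incr_ind j)); last first.
  by move=> y; apply: expRN_in01; rewrite mulr_ge0 ?(ltW w0)// le_max lexx orbT.
rewrite (eq_bigr (fun=> \int[Q]_x expR (- (w * Num.max (Z j.+1%:R^-1 x) 0)))).
  by rewrite prodr_const card_ord.
by move=> i _; exact: laplace_increment.
Qed.

(** The transform p of one increment satisfies p^(j+1) = e^(-C w^alpha), the transform at time 1,
    and nonnegativity selects the root. *)
Lemma grid_laplace j w n : 0 < w ->
  \int[Q]_x expR (- (w * Num.max (Z (grid j n) x) 0)) =
  expR (- (C * w `^ alpha)  * grid j n).
Proof.
move=> w0; rewrite grid_laplace_pow//; set p := \int[Q]_x _.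
have p0 : 0 <= p by apply: Rintegral_ge0 => x _; exact: expR_ge0.
have E1 : p ^+ j.+1 = expR (- (C * w `^ alpha)).
  rewrite -grid_laplace_pow// grid1 -(stable_law_laplace stG (ltW w0)).
  pose h (y : R) := (expR (- (w * Num.max y 0)))%:E.
  have mh : measurable_fun setT h by apply/measurable_EFinP; exact: measurable_exp_pos.
  rewrite /Rintegral; congr fine.
  have h0 y : (0 <= h y)%E by rewrite lee_fin expR_ge0.
  have := ge0_integral_pushforward (mZ 1) Q measurableT mh (fun y _ => h0 y).
  rewrite preimage_setT => <-.
  have mid : measurable_fun (setT : set (measurableTypeR R)) (idfun : measurableTypeR R -> R).
    by move=> _ B mB; rewrite setTI.
  have := ge0_integral_pushforward mid G measurableT mh (fun y _ => h0 y).
  rewrite preimage_setT => <-.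
  by apply: eq_measure_integral => B mB _; exact: (stable_process_law1 sp mB).
have -> : p = expR (- (C * w `^ alpha) / j.+1%:R).
  apply/eqP; rewrite -(@eqrXn2 _ j.+1)// ?expR_ge0// E1 -expRM_natr.
  by rewrite mulfVK// pnatr_eq0.
by rewrite -expRM_natr /grid -!mulrA; congr (expR (_ * _)); rewrite mulrC.
Qed.

(** By right-continuity a passage before s is already witnessed at a grid time before s, so the
    event is a countable union. *)
Lemma measurable_passage_time t : measurable_fun setT (passage_time Z ^~ t).
Proof.
apply: (measurability _ (ErealGenInftyO.measurableE R)) => // _ [_ [s ->] <-].
rewrite setTI (_ : _ @^-1` _ = \bigcup_j \bigcup_i
    [set x | grid j i < s /\ t < Z (grid j i) x]).
  apply: bigcup_measurable => j _; apply: bigcup_measurable => i _.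
  have [gs|gs] := ltP (grid j i) s; last first.
    by rewrite (_ : [set x | _] = set0)// -subset0 => x [].
  rewrite (_ : [set x | _] = Z (grid j i) @^-1` `]t, +oo[%classic).
    by rewrite -[Y in measurable Y]setTI; apply: mZ => //; exact: measurable_itv.
  by apply/seteqP; split => x /=; rewrite in_itv/= andbT; [move=> []|].
apply/seteqP; split => x /=.
  rewrite in_itv/= => /ereal_inf_lt[_ [r [r0 Zr] <-]]; rewrite lte_fin => rs.
  have [rc _] := stable_process_cadlag sp x.
  have nZ : \forall u \near r^'+, t < Z u x by exact: (cvgr_gt _ (rc r r0)).
  have ns : \forall u \near r^'+, u < s by exact: nbhs_right_lt.
  have [j _ hj] := (next_cvg r0) _ (filterI nZ ns).
  have [h1 h2] := hj j (leqnn j).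
  by exists j => //; exists (next j r).
move=> [j _ [i _ [gs tZ]]]; rewrite in_itv/=.
apply/ereal_inf_ltP; exists (grid j i)%:E; last by rewrite lte_fin.
by exists (grid j i).
Qed.

Lemma passage_time_ge0 t x : (0 <= passage_time Z x t)%E.
Proof. by apply: le_ereal_inf_tmp => _ [s [s0 _] <-]; rewrite lee_fin. Qed.

(** Together with [count_ge]: counting multiples of h below x measures x, truncated at N h, up to
    one mesh; the strict count serves the lower bound, the weak one the upper. *)
Let count_le (x h : R) N : 0 <= h -> 0 <= x ->
  Num.min x (N%:R * h) <= \sum_(k < N) h * (k%:R * h < x)%R%:R.
Proof.
move=> h0 x0; elim: N => [|N IH]; first by rewrite big_ord0 mul0r ge_min lexx orbT.
rewrite big_ord_recr/=; have [Nx|xN] := ltP (N%:R * h) x.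
  rewrite (min_r (ltW Nx)) in IH; rewrite mulr1 ge_min; apply/orP; right.
  by rewrite -natr1 mulrDl mul1r lerD2r.
by rewrite mulr0 addr0; rewrite (min_l xN) in IH; rewrite ge_min IH.
Qed.

Let count_ge (x h : R) N : 0 <= h ->
  \sum_(k < N) h * (k%:R * h <= x)%R%:R <= Num.max 0 (Num.min x (N%:R * h) + h).
Proof.
move=> h0; elim: N => [|N IH]; first by rewrite big_ord0 le_max lexx.
rewrite big_ord_recr/=; have [Nx|xN] := leP (N%:R * h) x.
  rewrite mulr1 le_max; apply/orP; right; apply: (@le_trans _ _ (N%:R * h + h)).
    rewrite lerD2r; apply: (@le_trans _ _ (\sum_(k < N) h)).
      by apply: ler_sum => k _; case: (k%:R * h <= x); rewrite ?mulr1 ?mulr0.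
    by rewrite sumr_const card_ord mulr_natl.
  by rewrite lerD2r le_min Nx -natr1 mulrDl mul1r lerDl.
rewrite mulr0 addr0; rewrite (min_l (ltW xN)) in IH.
by rewrite min_l// (le_trans (ltW xN))// ler_wpM2r// ler_nat.
Qed.

(** With mesh 1/(j+1) this many steps reach time j + 1, so the grid becomes finer and longer at
    once. *)
Let gsize j : nat := (j.+1 * j.+1)%N.
Let step j : R := j.+1%:R^-1.

Let below j k (x : W) : R := (Z (grid j k) x <= 1)%R%:R.

Let occupation j x : R := \sum_(k < gsize j) step j * below j k x.

Let passage_min j x : \bar R := mine (passage_time Z x 1) j.+1%:R%:E.

Let grid_step j k : grid j k = k%:R * step j. Proof. by []. Qed.

Let gsize_step j : (gsize j)%:R * step j = j.+1%:R.
Proof. by rewrite /gsize natrM -mulrA mulfV ?mulr1// pnatr_eq0. Qed.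

(* For a nondecreasing path both sides count the grid times at which the path is
   still below level 1. *)
Let passage_min_occupation j x : monotone_path x ->
  (passage_min j x <= (occupation j x)%:E /\ (occupation j x)%:E <= passage_min j x + (step j)%:E)%E.
Proof.
move=> mx; have s0 : 0 <= step j by rewrite invr_ge0.
have fin : passage_min j x \is a fin_num.
  rewrite fin_numElt; apply/andP; split.
    by rewrite lt_min ltNyr andbT (lt_le_trans (ltNyr 0))// passage_time_ge0.
  by rewrite gt_min ltry orbT.
pose y := fine (passage_min j x).
have yE : passage_min j x = y%:E by rewrite fineK.
have y0 : 0 <= y by rewrite -lee_fin -yE le_min passage_time_ge0 lee_fin ler0n.
have yj : y <= j.+1%:R by rewrite -lee_fin -yE ge_min lexx orbT.
have b1 k : k%:R * step j < y -> Z (grid j k) x <= 1.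
  move=> ky; rewrite leNgt; apply/negP => Zk.
  have : (passage_time Z x 1 <= (grid j k)%:E)%E.
    by apply: ereal_inf_lbound; exists (grid j k).
  have : ((k%:R * step j)%:E < passage_time Z x 1)%E.
    by apply: (@lt_le_trans _ _ y%:E); rewrite ?lte_fin// -yE ge_min lexx.
  by move=> /lt_le_trans h /h; rewrite ltxx.
have b2 k : (k < gsize j)%N -> Z (grid j k) x <= 1 -> k%:R * step j <= y.
  move=> kj Zk; rewrite -lee_fin -yE le_min; apply/andP; split; last first.
    rewrite lee_fin -gsize_step ler_wpM2r// ler_nat; exact: ltnW.
  apply: le_ereal_inf_tmp => _ [s [s0' Zs] <-]; rewrite lee_fin leNgt; apply/negP => sk.
  have := stable_process_homo mx s0' (ltW sk).
  by move=> /(lt_le_trans Zs)/lt_le_trans/(_ Zk); rewrite ltxx.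
rewrite yE -EFinD !lee_fin; split.
  have := @count_le y (step j) (gsize j) s0 y0; rewrite gsize_step min_l// => /le_trans; apply.
  apply: ler_sum => k _; rewrite /below; case: (ltP _ y) => [/b1 ->//|_].
  by rewrite mulr0 mulr_ge0.
have := @count_ge y (step j) (gsize j) s0; rewrite gsize_step min_l// max_r ?addr_ge0//.
apply: le_trans; apply: ler_sum => k _; rewrite /below.
by case: (leP _ 1) => [/(b2 k (ltn_ord k)) ->//|_]; rewrite mulr0 mulr_ge0.
Qed.

Let mbelow j k : measurable_fun setT (below j k).
Proof.
rewrite (_ : below j k = \1_(Z (grid j k) @^-1` `]-oo, 1%R]%classic)).
  by apply: measurable_indic; rewrite -[Y in measurable Y]setTI; apply: mZ => //; exact: measurable_itv.
apply/funext => x; rewrite /below indicE; congr (nat_of_bool _)%:R.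
by apply/idP/idP; rewrite inE/= in_itv.
Qed.

Let below01 j k x : 0 <= below j k x <= 1.
Proof. by rewrite /below; case: (_ <= 1); rewrite ?ler01 ?lexx. Qed.

Let iint (X : W -> R) c : measurable_fun setT X -> (forall x, 0 <= X x <= c) ->
  Q.-integrable setT (EFin \o X).
Proof.
move=> mX Xc; apply: (bounded_integrable Q (M := c)) => // x.
by have /andP[h ?] := Xc x; rewrite ger0_norm.
Qed.

Let ex j k (x : W) : R := expR (- Num.max (Z (grid j k) x) 0).

Let ex01 j k x : 0 <= ex j k x <= 1.
Proof. by apply: expRN_in01; rewrite le_max lexx orbT. Qed.

Let mex j k : measurable_fun setT (ex j k).
Proof.
apply: (measurableT_comp (@measurable_expR R)); apply: measurable_funN.
by apply: measurable_maxr => //; exact: mZ.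
Qed.

(** A Riemann sum for C times the integral over s of E[e^(-Z_s) g(e^(-Z_s))]. The density e^(-Z_s)
    makes the total mass finite, the factor C turns the limit of the k-th moment into
    (k+1)^(-alpha), and on [inv_step 1] the density cancels and leaves the time spent at or below
    level 1. *)
Let potential j (g : R -> R) : R :=
  (C * step j) * \sum_(k < gsize j) \int[Q]_x (ex j k x * g (ex j k x)).

Let potential_pf j : positive_functional (potential j).
Proof.
apply: (@pf_sum _ (gsize j) (fun k g => \int[Q]_x (ex j k x * g (ex j k x))) (C * step j)).
  by rewrite mulr_ge0 ?(ltW C0)// invr_ge0.
move=> k; exact: (pf_expectation Q (mex j k) (mex j k) (ex01 j k) (ex01 j k)).
Qed.

Let step_gt0 j : 0 < step j. Proof. by rewrite invr_gt0. Qed.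

Let step_cvg : step j @[j --> \oo] --> (0 : R).
Proof. exact: cvg_harmonic. Qed.

Let geometric_limit (D : R) : 0 < D ->
  C * step j * ((1 - expR (- (D * step j)) ^+ gsize j) / (1 - expR (- (D * step j))))
    @[j --> \oo] --> C / D.
Proof.
move=> D0.
have tail : expR (- (D * step j)) ^+ gsize j @[j --> \oo] --> (0 : R).
  have up : D^-1 * step j @[j --> \oo] --> (0 : R).
    by rewrite -(mulr0 D^-1); exact: cvgMr.
  apply: (squeeze_cvgr _ (cvg_cst 0) up); apply: nearW => j.
  rewrite exprn_ge0 ?expR_ge0//= -expRM_natr mulNr -mulrA [step j * _]mulrC gsize_step.
  have Dj : 0 < D * j.+1%:R by rewrite mulr_gt0.
  rewrite expRN -invfM lef_pV2 ?posrE ?expR_gt0//.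
  by apply: le_trans (expR_ge1Dx _); rewrite lerDr.
have main : step j / (1 - expR (- (D * step j))) @[j --> \oo] --> D^-1.
  have up : D^-1 + step j @[j --> \oo] --> D^-1.
    by rewrite -[X in _ --> X]addr0; apply: cvgD => //; exact: cvg_cst.
  apply: (squeeze_cvgr _ (cvg_cst D^-1) up); apply: nearW => j.
  set x := D * step j; have x0 : 0 < x by rewrite mulr_gt0.
  have sx : step j = x / D by rewrite /x mulrAC mulfV ?mul1r// gt_eqF.
  have e1 : 1 - expR (- x) <= x by rewrite lerBlDr -lerBlDl; exact: expR_ge1Dx.
  have e0 : 0 < 1 - expR (- x) by rewrite subr_gt0 expR_lt1 oppr_lt0.
  have e2 : x <= (1 + x) * (1 - expR (- x)).
    have : (1 + x) * expR (- x) <= 1.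
      rewrite expRN ler_pdivrMr ?expR_gt0// mul1r; exact: expR_ge1Dx.
    by rewrite mulrBr mulr1 lerBrDr [x + _]addrC lerD2r.
  apply/andP; split.
    by rewrite sx ler_pdivlMr// mulrC ler_pM2r ?invr_gt0.
  rewrite ler_pdivrMr// [leLHS]sx ler_pdivrMr//.
  rewrite [leRHS](_ : _ = (1 + x) * (1 - expR (- x)))//.
  rewrite /x; field; rewrite gt_eqF//.
have lim : C * (step j / (1 - expR (- (D * step j))) * (1 - expR (- (D * step j)) ^+ gsize j))
    @[j --> \oo] --> C * (D^-1 * (1 - 0)).
  by apply: cvgMr; apply: cvgM => //; apply: cvgB => //; exact: cvg_cst.
rewrite subr0 mulr1 in lim; apply: (cvg_trans _ lim); apply: near_eq_cvg.
by apply: nearW => j; ring.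
Qed.

Let potential_moment l : potential j (fun y => y ^+ l) @[j --> \oo] --> l.+1%:R `^ (- alpha).
Proof.
pose D : R := C * l.+1%:R `^ alpha.
have D0 : 0 < D by rewrite mulr_gt0// powR_gt0.
have -> : l.+1%:R `^ (- alpha) = C / D.
  by rewrite /D powRN invfM mulrA mulfV ?mul1r// gt_eqF.
apply: (cvg_trans _ (geometric_limit D0)); apply: near_eq_cvg; apply: nearW => j.
rewrite /potential; congr (_ * _).
have r1 : 0 < 1 - expR (- (D * step j)).
  by rewrite subr_gt0 expR_lt1 oppr_lt0 mulr_gt0.
apply: (mulfI (lt0r_neq0 r1)); rewrite mulrC mulfVK ?gt_eqF//.
transitivity ((1 - expR (- (D * step j))) * \sum_(k < gsize j) expR (- (D * step j)) ^+ k).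
  by rewrite -[LHS]opprB subrX1 -mulNr opprB.
congr (_ * _); apply: eq_bigr => k _.
transitivity (\int[Q]_x expR (- (l.+1%:R * Num.max (Z (grid j k) x) 0))).
  rewrite grid_laplace// -expRM_natr -/D grid_step; congr expR; ring.
apply: eq_Rintegral => x _; rewrite -exprS /ex -expRM_natr; congr expR.
by rewrite mulNr mulrC.
Qed.

Let potential_step j : potential j (inv_step 1) = C * \int[Q]_x occupation j x.
Proof.
have ib k : Q.-integrable setT (EFin \o (fun x => step j * below j k x)).
  exact: (integrableZl measurableT (step j) (iint (mbelow j k) (below01 j k))).
have [_ E] := integrable_sum_seq (index_enum 'I_(gsize j)) measurableT (fun k : 'I_(gsize j) => ib k).
rewrite /occupation E /potential -mulrA; congr (_ * _); rewrite mulr_sumr.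
apply: eq_bigr => k _; rewrite RintegralZl//; last exact: (iint (mbelow j k) (below01 j k)).
congr (_ * _); apply: eq_Rintegral => x _.
rewrite /inv_step /ex /below ler_expR lerN2 ge_max ler01 andbT.
by case: (_ <= 1); rewrite ?mulr0// mulfV// gt_eqF// expR_gt0.
Qed.

(** The passage time truncated at j + 1 is within one mesh of the occupation of the levels up to 1,
    whose mean is the potential of [inv_step 1] divided by C. Monotone convergence removes the
    truncation. *)
Lemma passage_time_mean (kap : R) :
  (forall Psi : nat -> (R -> R) -> R, (forall j, positive_functional (Psi j)) ->
    (forall k, Psi j (fun y => y ^+ k) @[j --> \oo] --> k.+1%:R `^ (- alpha)) ->
    Psi j (inv_step 1) @[j --> \oo] --> kap) ->
  inverse_mean1 Q Z = kap / C.
Proof.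
move=> hk; have lim := hk potential potential_pf potential_moment.
have {}lim : \int[Q]_x occupation j x @[j --> \oo] --> kap / C.
  rewrite mulrC -[X in _ --> X]/(C^-1 * kap).
  have lim' : C^-1 * potential j (inv_step 1) @[j --> \oo] --> C^-1 * kap by exact: cvgMr.
  apply: (cvg_trans _ lim'); apply: near_eq_cvg; apply: nearW => j.
  by rewrite potential_step mulrA mulVf ?mul1r// gt_eqF.
have mocc j : measurable_fun setT (occupation j).
  by apply: measurable_sum => k; exact: measurable_funM.
have occ0 j x : 0 <= occupation j x <= j.+1%:R.
  apply/andP; split.
    by apply: sumr_ge0 => k _; rewrite mulr_ge0 ?invr_ge0//; have /andP[] := below01 j k x.
  rewrite -gsize_step mulrC mulr_natr -[gsize j in leRHS]card_ord -sumr_const.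
  apply: ler_sum => k _; rewrite -[leRHS]mulr1 ler_wpM2l ?invr_ge0//.
  by have /andP[] := below01 j k x.
have iocc j : Q.-integrable setT (EFin \o occupation j) by exact: iint (mocc j) (occ0 j).
have mmin j : measurable_fun setT (passage_min j).
  apply: measurable_mine => //; exact: measurable_passage_time.
have min0 j x : (0 <= passage_min j x)%E.
  by rewrite le_min passage_time_ge0 lee_fin ler0n.
have up j : (\int[Q]_x passage_min j x <= (\int[Q]_x occupation j x)%:E)%E.
  rewrite /Rintegral fineK; last exact: (integrable_fin_num measurableT (iocc j)).
  apply: ae_ge0_le_integral => //.
  - by move=> x _; rewrite lee_fin; have /andP[] := occ0 j x.
  - exact/measurable_EFinP.
  by apply: filterS stable_process_monotone_ae => x mx _; have [] := passage_min_occupation j mx.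
have lo j : ((\int[Q]_x occupation j x - step j)%:E <= \int[Q]_x passage_min j x)%E.
  rewrite EFinB leeBlDr//.
  have -> : ((step j)%:E = \int[Q]_x (step j)%:E)%E.
    rewrite integral_cst// [X in (_ * X)%E](_ : _ = 1%E) ?mule1//.
    exact: probability_setT.
  rewrite -ge0_integralD//; last by move=> x _; rewrite lee_fin invr_ge0.
  rewrite /Rintegral fineK; last exact: (integrable_fin_num measurableT (iocc j)).
  apply: ae_ge0_le_integral => //.
  - by move=> x _; rewrite lee_fin; have /andP[] := occ0 j x.
  - exact/measurable_EFinP.
  - by move=> x _; rewrite adde_ge0// lee_fin invr_ge0.
  - exact: emeasurable_funD.
  by apply: filterS stable_process_monotone_ae => x mx _; have [] := passage_min_occupation j mx.
have lim1 : (\int[Q]_x passage_min j x)%E @[j --> \oo] --> (kap / C)%:E.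
  apply: (squeeze_cvge _ (f := fun j => (\int[Q]_x occupation j x - step j)%:E)
    (h := fun j => (\int[Q]_x occupation j x)%:E)).
  - by apply: nearW => j; rewrite lo up.
  - apply: cvg_EFin; first by apply: nearW.
    by rewrite -[X in _ --> X]subr0; exact: cvgB.
  - by apply: cvg_EFin; first by apply: nearW.
have lim2 : (\int[Q]_x passage_min j x)%E @[j --> \oo] --> (\int[Q]_x passage_time Z x 1)%E.
  have := cvg_monotone_convergence measurableT mmin (fun j x _ => min0 j x) (mu := Q).
  have E : (fun x => limn (passage_min ^~ x)) = (fun x => passage_time Z x 1).
    apply/funext => x; apply/cvg_lim => //; have := passage_time_ge0 1 x; rewrite /passage_min.
    case: (passage_time Z x 1) => [r| |] // r0.
      apply: cvg_near_cst; near=> j; apply/min_idPl; rewrite lee_fin.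
      apply: (@le_trans _ _ j%:R); last by rewrite ler_nat.
      by near: j; exact: nbhs_infty_ger.
    apply/cvgeyPge => M; near=> j; rewrite min_r ?leey// lee_fin.
    apply: (@le_trans _ _ j%:R); last by rewrite ler_nat.
    by near: j; exact: nbhs_infty_ger.
  rewrite E.
  apply => x _ m n mn; rewrite /passage_min le_min ge_min lexx/=.
  by rewrite ge_min lee_fin ler_nat ltnS mn orbT.
by rewrite /inverse_mean1 -(cvg_unique _ lim1 lim2).
Unshelve. all: by end_near. Qed.

End stable_process.

(** * The corollary *)

Section corollary.
Context {R : realType} {A : countType} (a : A).
Variables (P : A -> A -> R) (pi : A -> R).
Variable rho : {measure set (Paths a) -> \bar R}.
Hypothesis mk : markov_measure P pi rho.
Hypothesis inv : invariant_measure rho (left_shift a).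
Hypothesis cons : conservative rho (left_shift a).
Hypothesis erg : ergodic rho (left_shift a).
Hypothesis rhoA : rho (state_set a) = 1%E.
Variables (alpha : R) (G : probability (measurableTypeR R) R).
Hypothesis stG : stable_law alpha G.
Hypothesis alpha01 : 0 < alpha < 1.
Local Notation u := (renewal_prob rho).
Local Notation C := (stable_constant alpha).

Let f01 m : 0 <= return_prob rho m <= 1. Proof. exact: return_prob01. Qed.
Let u01 m : 0 <= u m <= 1. Proof. exact: renewal_prob01. Qed.
Let u0 : u 0%N = 1. Proof. exact: renewal_prob0. Qed.
Let C0 : 0 < C. Proof. exact: stable_constant_gt0 stG. Qed.

(** Both sequences are compared with A(1/n), the renewal transform: abar n is asymptotic to kap
    A(1/n) and ahat n to C A(1/n). *)
Lemma return_sequence_inverse (afun : R -> R) (kap : R) : 0 < kap ->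
  sum_upto u t / laplace_series u t^-1 @[t --> +oo] --> kap ->
  smooth_normalizer alpha (return_df rho) G afun ->
  let ahat := fun n : nat => inverse_on_halfline afun n%:R in
  return_sequence rho n / (kap / C * ahat n) @[n --> \oo] --> (1 : R) /\
  exists N, forall n, (N <= n)%N -> ahat n <= ahat n.+1.
Proof.
move=> kap0 tau sm ahat.
have a0 := normalizer_ge0 sm; have a_lt := normalizer_increasing sm.
have [g [dg _ _]] := normalizer_C1 sm.
pose H t := laplace_series u t^-1.
have H_gt0 t : 0 < t -> 0 < H t.
  by move=> t0; apply: (laplace_series_gt0 u01 u0); rewrite invr_gt0.
have H_le s t : 0 < s -> s <= t -> H s <= H t.
  move=> s0 st; have t0 : 0 < t by exact: lt_le_trans st.
  by apply: laplace_series_le => //; rewrite ?invr_gt0// lef_pV2.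
have aH : n%:R / H (afun n%:R) @[n --> \oo] --> C.
  have := normalizing_survival mk inv rhoA stG (normalizer_normalizing sm) ltr01.
  rewrite powR1 mulr1; apply: cvg_trans; apply: near_eq_cvg; near=> n.
  have n0 : 0 < n%:R :> R by rewrite ltr0n; near: n; exact: nbhs_infty_gt.
  have an : 0 < afun n%:R by apply: le_lt_trans (a_lt _ _ (lexx 0) n0); exact: a0.
  rewrite /H div1r (survival_laplace u01 f01 u0 (renewal_equation mk inv rhoA))//.
  by rewrite invr_gt0.
have unb := normalizer_unbounded a0 a_lt C0 H_gt0 H_le aH.
have ex := inverse_on_halfline_exists a_lt dg unb.
have as1 : ahat n / H n%:R @[n --> \oo] --> C.
  exact: (inverse_on_halfline_asymp a0 a_lt H_gt0 H_le aH ex).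
have as2 : sum_upto u n%:R / H n%:R @[n --> \oo] --> kap.
  exact: (cvg_comp _ _ (@cvgr_idn R) tau).
have aoo := return_sequence_infty mk inv cons rhoA.
split; last first.
  have [N _ hN] : \forall n \near \oo, afun 0 <= (n : nat)%:R by near=> n; near: n; exact: nbhs_infty_ger.
  exists N => n Nn; apply: (inverse_on_halfline_le a_lt); last by rewrite ler_nat.
    by apply: ex; exact: hN.
  by apply: ex; apply: hN; exact: leqW.
have as3 : return_sequence rho n / sum_upto u n%:R @[n --> \oo] --> (1 : R).
  have lim : 1 - (1 + return_sequence rho n)^-1 @[n --> \oo] --> (1 - 0 : R).
    apply: cvgB; first exact: cvg_cst.
    apply: cvgn_inv0; apply/cvgryPge => M; near=> n.
    have : M <= return_sequence rho n by near: n; exact: (cvgry_ge aoo).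
    by move=> /le_trans; apply; rewrite lerDr.
  rewrite subr0 in lim; apply: (cvg_trans _ lim); apply: near_eq_cvg; near=> n.
  rewrite (sum_upto_return_sequence inv rhoA)// natrK.
  by field; rewrite gt_eqF// ltr_pwDl// return_sequence_ge0.
have as1V : (ahat n / H n%:R)^-1 @[n --> \oo] --> C^-1 by apply: cvgV => //; rewrite gt_eqF.
have lim : return_sequence rho n / sum_upto u n%:R * (sum_upto u n%:R / H n%:R) *
    (ahat n / H n%:R)^-1 / (kap / C) @[n --> \oo] --> 1 * kap * C^-1 / (kap / C).
  by apply: cvgM; [apply: cvgM => //; exact: cvgM|exact: cvg_cst].
rewrite mul1r mulfV in lim; last by rewrite mulf_neq0 ?invr_neq0// gt_eqF.
apply: (cvg_trans _ lim); apply: near_eq_cvg; near=> n.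
have n0 : 0 < n%:R :> R by rewrite ltr0n; near: n; exact: nbhs_infty_gt.
have Hn := H_gt0 _ n0; have Un := sum_upto_gt0 u01 u0 n%:R.
have fe (x y z w c : R) : y != 0 -> z != 0 -> x / y * (y / z) * (w / z)^-1 / c = x / (c * w).
  move=> y0 z0; rewrite !invfM invrK [w^-1 * z]mulrC !mulrA.
  by rewrite mulfVK// mulfVK// mulrAC.
by rewrite /= fe ?gt_eqF.
Unshelve. all: by end_near. Qed.

End corollary.

Theorem corollary1p2 (R : realType) (A : countType) (a : A)
    (P : A -> A -> R) (pi : A -> R)
    (rho : {measure set (Paths a) -> \bar R})
    (alpha : R) (G : probability (measurableTypeR R) R) :
  row_stochastic P ->
  invariant_vector P pi ->
  infinite_mass pi ->
  markov_measure P pi rho ->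
  invariant_measure rho (left_shift a) ->
  conservative rho (left_shift a) ->
  ergodic rho (left_shift a) ->
  rho (state_set a) = 1%E ->
  0 < alpha < 1 ->
  stable_law alpha G ->
  let abar := return_sequence rho in
  let F := return_df rho in
  (regvar_seq abar alpha <-> domain_of_attraction F G) /\
  (regvar_seq abar alpha \/ domain_of_attraction F G ->
   forall (d : measure_display) (W : measurableType d) (Q : probability W R)
     (Z : R -> {RV Q >-> R}) (afun : R -> R),
   stable_process G Z ->
   smooth_normalizer alpha F G afun ->
   let c := inverse_mean1 Q Z in
   let ahat := fun n : nat => inverse_on_halfline afun n%:R in
   [/\ log_average rho ahat c,
       chung_erdos_average rho ahat c,
       abar n / (c * ahat n) @[n --> \oo] --> (1 : R),
       log_average rho ahat c <-> log_average rho abar 1 &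
       chung_erdos_average rho ahat c <-> chung_erdos_average rho abar 1]).
Proof.
move=> _ _ _ mk inv cons erg rhoA alpha01 stG abar F.
have equiv : regvar_seq abar alpha <-> domain_of_attraction F G.
  split => [rv|dom].
    apply: (domain_of_regular mk inv cons rhoA stG alpha01).
    exact: (regular_of_return_sequence mk inv cons rhoA alpha01 rv).
  apply: (return_sequence_regular mk inv cons rhoA alpha01).
  exact: (regular_of_domain mk inv rhoA stG alpha01 dom).
split => // h d W Q Z afun sp sm c ahat.
have rv : regvar_seq abar alpha by case: h => // /equiv.
have reg := regular_of_return_sequence mk inv cons rhoA alpha01 rv.
have [kap kap0 [tau uniq]] := tauberian (renewal_prob01 inv rhoA) (renewal_prob0 inv rhoA) alpha01 reg.
have C0 := stable_constant_gt0 stG.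
have cE : c = kap / stable_constant alpha.
  exact: (passage_time_mean stG sp uniq).
have c0 : 0 < c by rewrite cE divr_gt0.
have [ratio [N ahat_nd]] := return_sequence_inverse mk inv cons rhoA stG kap0 tau sm.
have al0 : 0 < alpha by have /andP[] := alpha01.
rewrite -cE in ratio.
have [la ce] := log_averages mk inv cons erg rhoA al0 rv c0
  (fun n => inverse_on_halfline_ge0 afun n%:R) ahat_nd ratio.
(* The return sequence is itself an admissible normalisation, with constant 1; eventually it is
   nonzero, so the quotient is exactly 1. *)
have ratio1 : abar n / (1 * abar n) @[n --> \oo] --> (1 : R).
  apply: cvg_near_cst; near=> n.
  rewrite mul1r mulfV// gt_eqF//; near: n.
  exact: (cvgry_gt (return_sequence_infty mk inv cons rhoA)).
have [la1 ce1] := log_averages mk inv cons erg rhoA al0 rv ltr01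
  (return_sequence_ge0 inv rhoA) (N0 := 0%N)
  (fun n _ => return_sequence_nd inv rhoA (leqnSn n)) ratio1.
by split.
Unshelve. all: by end_near. Qed.
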